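(* Let $\Omega\subset\mathbb R^d$ be open, $\omega\in\mathcal W$. If $g=[(g_\varepsilon)]$ belongs to $\mathcal G^{(\omega),\infty}(\Omega)$ and for all $\rho\in\mathcal D^{(\omega)}(\Omega)$ the net of numbers $(\langle g_\varepsilon,\rho\rangle)$ is Beurling negligible, i.e. $\langle g_\varepsilon,\rho\rangle=o(e^{-l\omega(1/\varepsilon)})$ as $\varepsilon\to0^+$ for all $l>0$, then $g=0$.
   Context: $\mathbb R^+=[0,\infty)$. $\mathcal W$ is the set of all nondecreasing continuous functions $\omega:\mathbb R^+\to\mathbb R^+$ such that $\omega(0)=0$; $\omega(x+y)\le\omega(x)+\omega(y)$ for all $x,y\ge 0$; $\int_1^\infty \frac{\omega(t)}{t^2}\,dt<\infty$; and $\lim_{t\to\infty}\frac{\omega(t)}{\log(1+t)}=\infty$. For a compactly supported continuous $f$ on $\mathbb R^d$ and $l>0$: $\|f\|_l^{\omega}=\int|\hat f(\xi)|e^{l\omega(|\xi|)}d\xi\in[0,\infty]$. $\mathcal D^{(\omega)}(\Omega)$ is the set of continuous $f$ with compact support in $\Omega$ and $\|f\|_l^\omega<\infty$ for all $l>0$. $\mathcal E^{(\omega)}(\Omega)$ is the set of smooth $f:\Omega\to\mathbb C$ with $\psi f\in\mathcal D^{(\omega)}(\Omega)$ for all $\psi\in\mathcal D^{(\omega)}(\Omega)$; for compact $K\subset\Omega$, $\|f\|_{K,l}^{\omega}=\inf\{\|\psi f\|_l^{\omega}:\psi\in\mathcal D^{(\omega)}(\Omega),\ \psi=1\text{ on }K\}$.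 Nets in $\mathcal E^{(\omega)}(\Omega)$ are indexed by $\varepsilon\in(0,1)$, $o(\cdot)$ is as $\varepsilon\to0^+$, $K$ ranges over compact subsets of $\Omega$. Moderate: $\forall K\,\forall h>0\,\exists k>0$: $\|g_\varepsilon\|_{K,h}^\omega=o(e^{k\omega(1/\varepsilon)})$. Negligible: $\forall K\,\forall h>0\,\forall k>0$: $\|g_\varepsilon\|_{K,h}^\omega=o(e^{-k\omega(1/\varepsilon)})$. $\mathcal G^{(\omega)}(\Omega)$ is the quotient of moderate by negligible nets. $g\in\mathcal G^{(\omega),\infty}(\Omega)$ (regular) means $g\in\mathcal G^{(\omega)}(\Omega)$ has a representative with $\forall K\ \exists k>0\ \forall h>0$: $\|g_\varepsilon\|_{K,h}^\omega=o(e^{k\omega(1/\varepsilon)})$. $\langle g_\varepsilon,\rho\rangle=\int g_\varepsilon\rho$. *)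

(* Defs.v *)
From HB Require Import structures.
From mathcomp Require Import all_boot all_order all_algebra.
From mathcomp Require Import all_classical all_reals all_analysis.
From mathcomp Require Import complex.

Set Implicit Arguments.
Unset Strict Implicit.
Unset Printing Implicit Defensive.

Import Order.TTheory GRing.Theory Num.Theory.
Import numFieldNormedType.Exports.
Local Open Scope classical_set_scope.
Local Open Scope ring_scope.

(* d-dimensional Lebesgue measure, by induction on d. It lives on d.-tuple R,
   whose sigma-algebra is the product one; 'rV[R]_d carries the topology. *)
Section lebesgue_tuple.
Variable R : realType.

Definition tcons (n : nat)
    (p : measurableTypeR R * n.-tuple (measurableTypeR R)) :
  n.+1.-tuple (measurableTypeR R) := [tuple of p.1 :: p.2].

Lemma measurable_tcons (n : nat) : measurable_fun setT (@tcons n).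
Proof. exact: (measurable_cons measurable_fst measurable_snd). Qed.

Section step.
Variables (n : nat)
  (mu : {sigma_finite_measure set (n.-tuple (measurableTypeR R)) -> \bar R}).

Definition leb_step : set (n.+1.-tuple (measurableTypeR R)) -> \bar R :=
  pushforward (@lebesgue_measure R \x mu)%E (@tcons n).

Let leb_step0 : leb_step set0 = 0%E.
Proof. by rewrite /leb_step /pushforward preimage_set0; exact: measure0. Qed.

Let measurable_pre A : measurable A -> measurable (@tcons n @^-1` A).
Proof.
by move=> mA; rewrite -[X in measurable X]setTI; exact: measurable_tcons.
Qed.

Let leb_step_ge0 A : (0 <= leb_step A)%E.
Proof. by rewrite /leb_step /pushforward; exact: measure_ge0. Qed.

Let leb_step_sigma_additive : semi_sigma_additive leb_step.
Proof.
move=> F mF tF mUF; rewrite /leb_step /pushforward preimage_bigcup.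
apply: measure_semi_sigma_additive.
- by move=> k; exact: measurable_pre.
- apply/trivIsetP => /= i j _ _ ij; rewrite -preimage_setI.
  by move/trivIsetP : tF => /(_ _ _ _ _ ij) ->//; rewrite preimage_set0.
- by rewrite -preimage_bigcup; exact: measurable_pre.
Qed.

HB.instance Definition _ := isMeasure.Build _ _ _ leb_step
  leb_step0 leb_step_ge0 leb_step_sigma_additive.

Let leb_step_sigma_finite : sigma_finite setT leb_step.
Proof.
have /sigma_finiteP[F [TF ndF Foo]] := sigma_finiteT (@lebesgue_measure R).
have /sigma_finiteP[G [TG ndG Goo]] := sigma_finiteT mu.
pose h (t : n.+1.-tuple (measurableTypeR R)) :
  measurableTypeR R * n.-tuple (measurableTypeR R) :=
  (thead t, [tuple of behead t]).
have hK : cancel (@tcons n) h.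
  by move=> [x t]; rewrite /h /tcons theadE /=; congr pair; exact/val_inj.
have mh : measurable_fun setT h.
  apply/measurable_fun_pairP; split; first exact: measurable_tnth.
  exact: measurable_behead.
exists (fun k => h @^-1` (F k `*` G k)).
  rewrite predeqE => t; split => // _.
  have [n1 _ Fn] : (\bigcup_k F k) (h t).1 by rewrite -TF.
  have [n2 _ Gn] : (\bigcup_k G k) (h t).2 by rewrite -TG.
  exists (maxn n1 n2) => //; split.
  - by move: Fn; exact/subsetPset/ndF/leq_maxl.
  - by move: Gn; exact/subsetPset/ndG/leq_maxr.
move=> k; have [mF Fk] := Foo k; have [mG Gk] := Goo k; split.
  by rewrite -[X in measurable X]setTI; apply: mh => //; exact: measurableX.
rewrite /leb_step /pushforward -comp_preimage.
rewrite (_ : h \o @tcons n = id); last by apply/funext => x /=; exact: hK.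
rewrite preimage_id; have /= -> := product_measure1E (@lebesgue_measure R) mu mF mG.
by rewrite lte_mul_pinfty // ge0_fin_numE.
Qed.

HB.instance Definition _ := Measure_isSigmaFinite.Build _ _ _ leb_step
  leb_step_sigma_finite.

End step.

Fixpoint lebesgue_tuple (n : nat) :
    {sigma_finite_measure set (n.-tuple (measurableTypeR R)) -> \bar R} :=
  if n is m.+1 then leb_step (lebesgue_tuple m)
  else \d_([tuple] : 0.-tuple (measurableTypeR R)).

End lebesgue_tuple.

Local Open Scope complex_scope.

Section complex_analysis_Rd.
Variables (R : realType) (d : nat).
Implicit Types (x xi : 'rV[R]_d) (f : 'rV[R]_d -> R[i]).

Definition row_of_tuple (t : d.-tuple (measurableTypeR R)) : 'rV[R]_d :=
  \row_i tnth t i.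

Definition dot x xi : R := \sum_(i < d) x ord0 i * xi ord0 i.

(* The library norm on 'rV[R]_d is the sup norm, hence: *)
Definition enorm x : R := Num.sqrt (dot x x).

Definition cmod (z : R[i]) : R := Normc.normc z.

Definition expi (t : R) : R[i] := cos t +i* sin t.

Definition integral_Rd (h : 'rV[R]_d -> \bar R) : \bar R :=
  (\int[lebesgue_tuple R d]_t h (row_of_tuple t))%E.

Definition cintegral_Rd f : R[i] :=
  fine (integral_Rd (fun x => (complex.Re (f x))%:E)) +i*
  fine (integral_Rd (fun x => (complex.Im (f x))%:E)).

(* Convention: integral of f(x) exp(-i x.xi) dx, without prefactor. *)
Definition fourier f xi : R[i] :=
  cintegral_Rd (fun x => f x * expi (- dot x xi)).

(* Continuity and smoothness of complex-valued functions are componentwise: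
   R[i] is not a normed module over R in the library. *)
Definition ccontinuous f : Prop :=
  continuous (fun x => complex.Re (f x)) /\
  continuous (fun x => complex.Im (f x)).

Definition csupport f : set 'rV[R]_d := closure [set x | f x != 0].

Fixpoint iter_partial (s : seq 'I_d) (u : 'rV[R]_d -> R) : 'rV[R]_d -> R :=
  if s is i :: s' then 'D_(delta_mx ord0 i) (iter_partial s' u) else u.

(* All iterated partial derivatives exist and are continuous on the open set
   Omega. *)
Definition smooth_on (Omega : set 'rV[R]_d) (u : 'rV[R]_d -> R) : Prop :=
  forall (s : seq 'I_d) x, Omega x ->
    {for x, continuous (iter_partial s u)} /\
    (forall i : 'I_d, derivable (iter_partial s u) x (delta_mx ord0 i)).

Definition csmooth_on (Omega : set 'rV[R]_d) f : Prop :=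
  smooth_on Omega (fun x => complex.Re (f x)) /\
  smooth_on Omega (fun x => complex.Im (f x)).

End complex_analysis_Rd.

(* A weight is a function on [0, +oo[; its values on negative reals are
   irrelevant. *)
Record weight_class (R : realType) (w : R -> R) : Prop := WeightClass {
  weight_ge0 : forall x : R, 0 <= x -> 0 <= w x ;
  weight_ndecr : forall x y : R, 0 <= x -> x <= y -> w x <= w y ;
  weight_cont : {within `[0, +oo[, continuous w} ;
  weight0 : w 0 = 0 ;
  weight_subadd : forall x y : R, 0 <= x -> 0 <= y -> w (x + y) <= w x + w y ;
  weight_integral :
    (\int[lebesgue_measure]_(t in `[1%R, +oo[) (w t / t ^+ 2)%:E < +oo)%E ;
  weight_log : w t / ln (1 + t) @[t --> +oo] --> +oo
}.

Section ultradifferentiable.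
Variables (R : realType) (d : nat) (w : R -> R).
Implicit Types (Omega K : set 'rV[R]_d) (f psi : 'rV[R]_d -> R[i]) (l : R).

Definition wnorm l f : \bar R :=
  integral_Rd (fun xi => (cmod (fourier f xi) * expR (l * w (enorm xi)))%:E).

Definition D_space Omega : set ('rV[R]_d -> R[i]) :=
  [set f | [/\ ccontinuous f, compact (csupport f), csupport f `<=` Omega &
               forall l : R, 0 < l -> (wnorm l f < +oo)%E]].

(* A function on Omega is represented by any function on the whole space with
   the same restriction to Omega: the values outside Omega play no role, as psi
   vanishes there. *)
Definition E_space Omega : set ('rV[R]_d -> R[i]) :=
  [set f | csmooth_on Omega f /\
    forall psi, D_space Omega psi -> D_space Omega (fun x => psi x * f x)].

(* The infimum over the empty set is +oo. *)
Definition wnorm_on Omega K l f : \bar R :=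
  ereal_inf [set wnorm l (fun x => psi x * f x) |
    psi in [set psi | D_space Omega psi /\ forall x, K x -> psi x = 1]].

End ultradifferentiable.

(* u e = o(v e) as e tends to 0 from the right; the library's littleo does not
   apply to extended real-valued u. *)
Definition ereal_littleo (R : realType) (u : R -> \bar R) (v : R -> R) : Prop :=
  forall c : R, 0 < c -> \forall e \near 0^'+, (`|u e| <= (c * `|v e|)%:E)%E.

Section colombeau.
Variables (R : realType) (d : nat) (w : R -> R) (Omega : set 'rV[R]_d).

(* Nets are indexed by ]0, 1[; the values at other indices are irrelevant. *)
Definition net := R -> 'rV[R]_d -> R[i].
Implicit Types g : net.

Definition E_net : set net :=
  [set g | forall e : R, 0 < e < 1 -> E_space w Omega (g e)].

Definition growth (k : R) : R -> R := fun e => expR (k * w e^-1).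

Definition moderate : set net := [set g | E_net g /\
  forall K : set 'rV[R]_d, compact K -> K `<=` Omega -> forall h : R, 0 < h ->
  exists2 k : R, 0 < k &
    ereal_littleo (fun e => wnorm_on w Omega K h (g e)) (growth k)].

Definition negligible_net : set net := [set g | E_net g /\
  forall K : set 'rV[R]_d, compact K -> K `<=` Omega -> forall h : R, 0 < h -> forall k : R, 0 < k ->
    ereal_littleo (fun e => wnorm_on w Omega K h (g e)) (growth (- k))].

(* The class of g modulo negligible nets, as a set of moderate nets. *)
Definition gclass g : set net :=
  [set g' | moderate g' /\ negligible_net (fun e x => g' e x - g e x)].

Definition G_algebra : set (set net) := [set gclass g | g in moderate].

Definition G_zero : set net := gclass (fun _ _ => 0).

Definition regular_net g : Prop :=
  forall K : set 'rV[R]_d, compact K -> K `<=` Omega ->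
  exists2 k : R, 0 < k & forall h : R, 0 < h ->
    ereal_littleo (fun e => wnorm_on w Omega K h (g e)) (growth k).

Definition G_regular : set (set net) :=
  [set A | G_algebra A /\ exists2 g, A g & regular_net g].

Definition pairing (f rho : 'rV[R]_d -> R[i]) : R[i] :=
  cintegral_Rd (fun x => f x * rho x).

Definition negligible_numbers (z : R -> R[i]) : Prop :=
  forall l : R, 0 < l -> ereal_littleo (fun e => (cmod (z e))%:E) (growth (- l)).

End colombeau.

(* Main.v *)
Require Import Defs.
From mathcomp Require Import all_boot all_order all_algebra.
From mathcomp Require Import all_classical all_reals all_analysis.
From mathcomp Require Import measurable_realfun.
From mathcomp Require Import complex ring lra.
Import Order.TTheory GRing.Theory Num.Theory.
Import numFieldNormedType.Exports.
Local Open Scope classical_set_scope.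
Local Open Scope ring_scope.

(** Write [e] for the parameter of the nets, [F f] for the Fourier transform
    of [f] and [W] for the weight [xi |-> w (enorm xi)].

    Cutoffs come from moderateness: the seminorm of a moderate net on a compact
    set [K] is eventually finite, and an infimum over the test functions equal
    to 1 on [K] is finite only if there are such functions ([moderate_cutoff]).

    Let [g0] be a regular representative, [psi] a cutoff and [u_e := psi g0_e].
    Since [F u_e xi] is the pairing of [g0_e] with the test function
    [x |-> psi x * expi (- dot x xi)], it is negligible in [e] for each fixed
    [xi].  A gliding hump makes this uniform in [xi]: for every [l] there is an
    [n] with [|F u_e xi| <= n exp (- l w (1/e)) exp (n W xi)] for small [e]
    ([fourier_cutoff_bounded]).  Were this false, one could choose frequencies
    [xi_j] and fast decreasing coefficients [a_j] such that the single test
    function [psi * \sum_j a_j expi (- dot x xi_j)] pairs with [g0] to a net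
    which is not negligible ([gliding_hump], [D_charseries],
    [pairing_charseries]).

    Regularity bounds the norms of [u_e] of all orders [H] by
    [exp (kappa w (1/e))] with one [kappa].  The exponent [n] above is lost by
    taking the geometric mean of the two bounds, with [H] large compared to
    [n]; what remains is integrated against [exp (- a W)], which is integrable
    because [w] dominates the logarithm.  The norm of order [h] of [u_e] is thus
    at most a constant times [exp ((kappa - l / 2) w (1/e))], and [l] is
    arbitrary ([wnorm_interpolation], [cutoff_negligible]).

    The seminorms of a net are infima over cutoffs which vary with [e].  To
    compare them with a fixed cutoff [psi] write [psi f = psi (psi' f)], where
    [psi'] is 1 on the support of [psi], and use that the weighted norms are
    submultiplicative up to a constant ([wnormM_le], [wnorm_cutoff_le]).  This
    rests on the formula for the transform of a product ([fourierM]), hence on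
    Fourier inversion for continuous functions with compact support and
    integrable transform ([fourier_inversion]), obtained by Abel summation.  It
    also gives that negligible nets have negligible pairings and form a group,
    so that the hypothesis passes from [g] to [g0] and the conclusion back. *)

Set Implicit Arguments.
Unset Strict Implicit.
Unset Printing Implicit Defensive.

(** * Lebesgue measure on tuples *)

Section affine_line.
Variable R : realType.
Local Open Scope ereal_scope.

Lemma measurable_affine (a r : R) :
  measurable_fun setT (fun x : R => (a + r * x)%R).
Proof. by apply: measurable_funD => //; apply: measurable_funM. Qed.

(** By uniqueness of Lebesgue measure it is enough to compare the lengths of
    half-open intervals. *)
Lemma lebesgue_measure_affine (a r : R) (A : set R) : (0 < r)%R ->
  measurable A ->
  lebesgue_measure ((fun x : R => (a + r * x)%R) @^-1` A) =
  r^-1%:E * lebesgue_measure A.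
Proof.
move=> r0 mA; pose phi : measurableTypeR R -> measurableTypeR R := fun x => (a + r * x)%R; rewrite -/phi.
pose m := mscale (NngNum (ltW r0)) (pushforward lebesgue_measure phi).
have mphi : measurable_fun setT phi by exact: measurable_affine.
suff -> : lebesgue_measure A = m mphi A.
  by rewrite /m /mscale /= muleA -EFinM mulVf ?gt_eqF// mul1e.
apply: lebesgue_measure_unique => //= _ [[b c]] _ <-.
have phiE : phi @^-1` `]b, c]%classic =
    `]((b - a) / r)%R, ((c - a) / r)%R]%classic.
  apply/seteqP; split => x /=; rewrite !in_itv /= /phi ltr_pdivrMr// ler_pdivlMr//.
    by rewrite ltrBlDl lerBrDl (mulrC x).
  by rewrite ltrBlDl lerBrDl (mulrC x).
change (lebesgue_measure `]b, c]%classic =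
  r%:E * lebesgue_measure (phi @^-1` `]b, c]%classic)).
rewrite phiE !lebesgue_measure_itv/= !lte_fin ltr_pM2r ?invr_gt0// ltrD2r.
case: ifP => _; last by rewrite mule0.
by rewrite -!EFinD -EFinM; congr EFin; field; rewrite gt_eqF.
Qed.

Lemma ge0_integral_affine (a r : R) (f : R -> \bar R) : (0 < r)%R ->
  measurable_fun [set: R] f -> (forall x, 0 <= f x) ->
  \int[lebesgue_measure]_x f (a + r * x)%R =
  r^-1%:E * \int[lebesgue_measure]_x f x.
Proof.
move=> r0 mf f0.
pose phi : measurableTypeR R -> measurableTypeR R := fun x => (a + r * x)%R.
have mphi : measurable_fun setT phi by exact: measurable_affine.
rewrite -[RHS]/((NngNum (ltW (etrans (invr_gt0 r) r0)))%:num%:E * _).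
rewrite -ge0_integral_mscale//.
transitivity (\int[pushforward lebesgue_measure phi]_x f x).
  by rewrite ge0_integral_pushforward// preimage_setT.
apply: eq_measure_integral => A mA _; exact: lebesgue_measure_affine.
Qed.

End affine_line.

Section lebesgue_tuple_fubini.
Variable R : realType.
Local Open Scope ereal_scope.
Notation T1 := (measurableTypeR R).
Notation mu n := (lebesgue_tuple R n).

(** Tonelli's theorem, as the measure on [n.+1]-tuples is by definition the
    image of a product measure under [tcons]. *)
Lemma ge0_integral_tcons n (f : n.+1.-tuple T1 -> \bar R) :
  measurable_fun setT f -> (forall t, 0 <= f t) ->
  \int[mu n.+1]_t f t =
  \int[lebesgue_measure]_x \int[mu n]_t f (tcons (x, t)).
Proof.
move=> mf f0.
have mt := @measurable_tcons R n.
rewrite /= /leb_step ge0_integral_pushforward//.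
rewrite preimage_setT (fubini_tonelli1 (f \o @tcons R n)); last 2 first.
  exact: measurableT_comp.
  by move=> x; exact: f0.
by [].
Qed.

Definition affine_tuple n (a : n.-tuple T1) (r : R) (t : n.-tuple T1) :
  n.-tuple T1 := [tuple (tnth a i + r * tnth t i)%R | i < n].

Lemma measurable_affine_tuple n (a : n.-tuple T1) r :
  measurable_fun setT (affine_tuple a r).
Proof.
apply/measurable_fun_tnthP => i.
rewrite (_ : _ \o _ = (fun x : T1 => (tnth a i + r * x)%R : T1) \o @tnth n T1 ^~ i).
  apply: measurableT_comp; first exact: measurable_affine.
  exact: measurable_tnth.
by apply/funext => t /=; rewrite tnth_mktuple.
Qed.

Lemma affine_tcons n (a : n.+1.-tuple T1) r x (t : n.-tuple T1) :
  affine_tuple a r (tcons (x, t)) =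
  tcons ((thead a + r * x)%R, affine_tuple [tuple of behead a] r t).
Proof.
apply: eq_from_tnth => i; rewrite tnth_mktuple.
case: (unliftP ord0 i) => [j ->|->]; last by rewrite /tcons !tnth0.
rewrite /tcons !tnthS tnth_mktuple; congr (_ + _)%R.
by rewrite [in LHS](tuple_eta a) tnthS.
Qed.

(** Homotheties and translations are handled one coordinate at a time; they are
    all that the approximate identity and the convolution estimate need. *)
Lemma ge0_integral_affine_tuple n (a : n.-tuple T1) r f : (0 < r)%R ->
  measurable_fun setT f -> (forall t, 0 <= f t) ->
  \int[mu n]_t f (affine_tuple a r t) = (r^-1 ^+ n)%:E * \int[mu n]_t f t.
Proof.
move=> r0; elim: n => [|n IH] in a f *.
  move=> mf f0; rewrite /= !integral_dirac//=; last first.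
    by apply: measurableT_comp => //; exact: measurable_affine_tuple.
  by rewrite expr0 mul1e (tuple0 (affine_tuple _ _ _)).
move=> mf f0.
rewrite ge0_integral_tcons//; last first.
  by apply: measurableT_comp => //; exact: measurable_affine_tuple.
have mf2 : measurable_fun setT (f \o @tcons R n).
  by apply: measurableT_comp => //; exact: measurable_tcons.
under eq_integral => x _.
  under eq_integral do rewrite affine_tcons.
  rewrite (IH [tuple of behead a] (fun t => f (tcons ((thead a + r * x)%R, t))))//.
    over.
  exact: (measurableT_comp mf2 (@pair1_measurable _ _ (measurableTypeR R) _ _)).
have mF := measurable_fun_fubini_tonelli_F (m2 := mu n) _ mf2 (fun x => f0 _).
rewrite ge0_integralZl//; last 3 first.
- exact: (measurableT_comp mF (measurable_affine (thead a) r)).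
- by move=> x _; apply: integral_ge0 => t _; exact: f0.
- by rewrite lee_fin exprn_ge0// invr_ge0 ltW.
rewrite (ge0_integral_affine (thead a) r0 mF)//; last first.
  by move=> x; apply: integral_ge0 => t _; exact: f0.
by rewrite muleA -EFinM -exprSr ge0_integral_tcons.
Qed.

End lebesgue_tuple_fubini.

(** * The Laplace kernel and its Fourier transform *)

Section laplace_kernel_line.
Variable R : realType.
Local Notation mu := (@lebesgue_measure R).

Definition laplace (x : R) : R := expR (- `|x|).

(** The Fourier transform of [laplace], that is, the Poisson kernel of the half
    plane at height 1 up to the factor [pi]. *)
Definition poisson (z : R) : R := 2 / (1 + z ^+ 2).

Let prim z (x : R) : R :=
  - expR (- x) + expR (- x) * (z * sin (x * z) - cos (x * z)) / (1 + z ^+ 2).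

Let is_derive_prim (z x : R) :
  is_derive x (1:R) (prim z) (expR (- x) * (1 + cos (x * z))).
Proof.
have z0 : 1 + z ^+ 2 != 0 by rewrite gt_eqF// ltr_pwDl// sqr_ge0.
have h0 : is_derive x (1:R) (fun x : R => x * z) z.
  by apply: is_derive_eq; rewrite /GRing.scale/= mulr0 add0r mulr1.
have h1 : is_derive x (1:R) (fun x : R => expR (- x)) (- expR (- x)).
  by rewrite -mulrN1; apply: (@is_derive1_comp _ expR -%R).
have h2 : is_derive x (1:R) (fun x : R => sin (x * z)) (cos (x * z) * z).
  by apply: (@is_derive1_comp _ sin (fun x : R => x * z)).
have h3 : is_derive x (1:R) (fun x : R => cos (x * z)) (- sin (x * z) * z).
  by apply: (@is_derive1_comp _ cos (fun x : R => x * z)).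
rewrite /prim; apply: is_derive_eq; rewrite /GRing.scale/=.
by field.
Qed.

Let cvg_prim z : prim z x @[x --> +oo%R] --> (0 : R).
Proof.
pose C := 1 + (`|z| + 1).
have C_ge x : `|prim z x| <= C * expR (- x).
  have z1 : 1 <= 1 + z ^+ 2 by rewrite lerDl sqr_ge0.
  have -> : prim z x =
    (- 1 + (z * sin (x * z) - cos (x * z)) / (1 + z ^+ 2)) * expR (- x).
    by rewrite /prim; ring.
  rewrite normrM (ger0_norm (expR_ge0 _)) ler_pM2r ?expR_gt0//.
  rewrite (le_trans (ler_normD _ _))// normrN normr1 lerD2l.
  rewrite normrM normfV (@ger0_norm _ (1 + z ^+ 2)); last by lra.
  rewrite ler_pdivrMr; last by lra.
  rewrite (@le_trans _ _ (`|z| + 1))//; last first.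
    by rewrite ler_peMr// addr_ge0.
  rewrite (le_trans (ler_normB _ _))// normrM lerD//.
    by rewrite ler_piMr// ler_norml sin_geN1 sin_le1.
  by rewrite ler_norml cos_geN1 cos_le1.
have h : C * expR (- x) @[x --> +oo%R] --> (0 : R).
  by rewrite -(mulr0 C); apply: cvgM; [exact: cvg_cst|exact: cvgr_expR].
apply: (@squeeze_cvgr _ _ _ _ (fun x => - (C * expR (- x)))
  (fun x => C * expR (- x))) => //; last by rewrite -oppr0; exact: cvgN.
by apply: nearW => x; rewrite -ler_norml.
Qed.

Let continuous_laplace : continuous laplace.
Proof.
move=> x; apply: continuous_comp; last exact: continuous_expR.
by apply: continuousN; exact: norm_continuous.
Qed.

Let continuous_cosM z : continuous (fun x : R => cos (x * z)).
Proof.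
move=> x; apply: (@continuous_comp _ _ _ (fun x : R => x * z)).
  by apply: continuousM => //; exact: cvg_cst.
exact: continuous_cos.
Qed.

Let continuous_sinM z : continuous (fun x : R => sin (x * z)).
Proof.
move=> x; apply: (@continuous_comp _ _ _ (fun x : R => x * z)).
  by apply: continuousM => //; exact: cvg_cst.
exact: continuous_sin.
Qed.

(** Adding 1 to the cosine makes the integrand nonnegative, as required by the
    fundamental theorem of calculus on a half line; the constant is removed
    afterwards by comparing with the case [z = 0]. *)
Let ge0_integral_laplace z :
  (\int[mu]_x (laplace x * (1 + cos (x * z)))%:E = (2 + poisson z)%:E)%E.
Proof.
have c0 x : 0 <= 1 + cos x :> R by have := cos_geN1 x; lra.
have cf : continuous (fun x => laplace x * (1 + cos (x * z))).
  move=> x; apply: continuousM; first exact: continuous_laplace.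
  by apply: continuousD; [exact: cvg_cst|exact: continuous_cosM].
have cg : continuous (fun x => expR (- x) * (1 + cos (x * z))).
  move=> x; apply: (@continuousM _ _ (fun x : R => expR (- x))).
    apply: continuous_comp; last exact: continuous_expR.
    exact: opp_continuous.
  by apply: continuousD; [exact: cvg_cst|exact: continuous_cosM].
rewrite ge0_symfun_integralT//; last 2 first.
- by move=> x; rewrite mulr_ge0// expR_ge0.
- by move=> x /=; rewrite /laplace normrN mulNr cosN.
rewrite -set_itvcy.
under eq_integral => x.
  rewrite inE/= in_itv/= andbT => x0.
  rewrite /laplace ger0_norm//.
  over.
rewrite (@ge0_continuous_FTC2y _ _ (prim z) 0 0)//.
- rewrite /prim /poisson oppr0 expR0 mul0r sin0 cos0 -EFinB -EFinM; congr EFin.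
  by field; rewrite gt_eqF// ltr_pwDl// sqr_ge0.
- exact: continuous_subspaceT.
- apply: cvg_at_right_filter.
  by apply: differentiable_continuous; apply/derivable1_diffP.
- by move=> x _; rewrite derive1E; have [_ ->] := is_derive_prim z x.
Qed.

Lemma integrable_laplace : mu.-integrable setT (EFin \o laplace).
Proof.
apply/integrableP; split.
  by apply/measurable_EFinP; apply: continuous_measurable_fun.
have := ge0_integral_laplace 0.
under eq_integral do rewrite mulr0 cos0.
move=> h.
apply: (@le_lt_trans _ _ (2 + poisson 0)%:E); last exact: ltry.
rewrite -h; apply: ge0_le_integral => //.
- by do 2 apply: measurableT_comp => //; apply: continuous_measurable_fun.
- apply/measurable_EFinP; apply: measurable_funM => //.
  by apply: continuous_measurable_fun.
- move=> x _; rewrite /= lee_fin ger0_norm ?expR_ge0// ler_peMr ?expR_ge0//.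
  by lra.
Qed.

Lemma integral_laplace : (\int[mu]_x (laplace x)%:E = 2%:E)%E.
Proof.
have := ge0_integral_laplace 0.
under eq_integral do rewrite mulr0 cos0 mulrC EFinM.
rewrite integralZl//; last exact: integrable_laplace.
rewrite /poisson expr0n addr0 divr1.
have /fineK <- : (\int[mu]_x (laplace x)%:E)%E \is a fin_num.
  by apply: integrable_fin_num => //; exact: integrable_laplace.
by rewrite -EFinM => -[h]; congr EFin; lra.
Qed.

Lemma integrable_laplace_bounded (f : R -> R) : measurable_fun setT f ->
  (forall x, `|f x| <= 1) ->
  mu.-integrable setT (EFin \o (fun x => laplace x * f x)).
Proof.
move=> mf f1; apply: (le_integrable _ _ _ integrable_laplace) => //.
  apply/measurable_EFinP; apply: measurable_funM => //.
  exact: continuous_measurable_fun.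
by move=> x _; rewrite /= lee_fin normrM ler_piMr.
Qed.

Lemma integrable_laplace_cos z :
  mu.-integrable setT (EFin \o (fun x => laplace x * cos (x * z))).
Proof.
apply: integrable_laplace_bounded => [|x].
  exact: continuous_measurable_fun.
by rewrite ler_norml cos_geN1 cos_le1.
Qed.

Lemma integrable_laplace_sin z :
  mu.-integrable setT (EFin \o (fun x => laplace x * sin (x * z))).
Proof.
apply: integrable_laplace_bounded => [|x].
  exact: continuous_measurable_fun.
by rewrite ler_norml sin_geN1 sin_le1.
Qed.

Lemma integral_laplace_cos z :
  (\int[mu]_x (laplace x * cos (x * z))%:E = (poisson z)%:E)%E.
Proof.
have := ge0_integral_laplace z.
under eq_integral do rewrite mulrDr mulr1 EFinD.
rewrite integralD//; [|exact: integrable_laplace|exact: integrable_laplace_cos].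
rewrite integral_laplace.
have /fineK <- : (\int[mu]_x (laplace x * cos (x * z))%:E)%E \is a fin_num.
  by apply: integrable_fin_num => //; exact: integrable_laplace_cos.
by rewrite -EFinD => -[h]; congr EFin; lra.
Qed.

(** The integrand is odd and Lebesgue measure is invariant under [-%R]. *)
Lemma integral_laplace_sin z :
  (\int[mu]_x (laplace x * sin (x * z))%:E = 0)%E.
Proof.
pose f x := laplace x * sin (x * z).
have fi : mu.-integrable setT (EFin \o f) := integrable_laplace_sin z.
have fN x : f (- x) = - f x.
  by rewrite /f /laplace normrN mulNr sinN mulrN.
have mN : measurable_fun setT (-%R : measurableTypeR R -> measurableTypeR R).
  exact: measurable_funN.
have h : (\int[mu]_x (f x)%:E = \int[mu]_x (f (- x))%:E)%E.
  transitivity (\int[pushforward mu (-%R : measurableTypeR R -> measurableTypeR R)]_x (f x)%:E)%E.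
    by apply: eq_measure_integral => A mA _; apply/esym/lebesgue_measureN.
  rewrite integral_pushforward//; first by case/integrableP : fi.
  rewrite preimage_setT.
  apply: eq_integrable (integrableN fi) => // x _ /=.
  by rewrite fN EFinN.
move: h; under [in RHS]eq_integral do rewrite fN -mulN1r EFinM.
rewrite integralZl//.
have /fineK <- : (\int[mu]_x (f x)%:E)%E \is a fin_num.
  by apply: integrable_fin_num.
by rewrite -EFinM => -[h]; congr EFin; lra.
Qed.

End laplace_kernel_line.

Section poisson_line.
Variable R : realType.
Local Notation mu := (@lebesgue_measure R).

Let denom_gt0 (z : R) : 0 < 1 + z ^+ 2.
Proof. by rewrite ltr_pwDl// sqr_ge0. Qed.

Lemma poisson_gt0 (z : R) : 0 < poisson z.
Proof. by rewrite divr_gt0. Qed.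

Lemma continuous_poisson : continuous (@poisson R).
Proof.
move=> x; exact: (cvgM (cvg_cst (2 : R)) (@continuous_oneDsqrV R x)).
Qed.

Lemma integral_poisson : (\int[mu]_x (poisson x)%:E = (2 * pi)%:E)%E.
Proof.
rewrite ge0_symfun_integralT//; last 3 first.
- by move=> x; rewrite ltW// poisson_gt0.
- exact: continuous_poisson.
- by move=> x; rewrite /poisson /= sqrrN.
rewrite -set_itvcy.
under eq_integral do rewrite /poisson EFinM.
rewrite ge0_integralZl//; last 2 first.
- apply/measurable_EFinP; apply: measurable_funTS.
  exact: continuous_measurable_fun (@continuous_oneDsqrV R).
- by move=> x _; rewrite lee_fin invr_ge0 ltW.
rewrite integral0y_oneDsqr -!EFinM; congr EFin; lra.
Qed.

Lemma integrable_poisson : mu.-integrable setT (EFin \o @poisson R).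
Proof.
apply/integrableP; split.
  by apply/measurable_EFinP; exact: continuous_measurable_fun continuous_poisson.
apply: (@le_lt_trans _ _ (2 * pi)%:E); last exact: ltry.
rewrite -integral_poisson le_eqVlt; apply/orP; left; apply/eqP.
by apply: eq_integral => x _ /=; rewrite ger0_norm// ltW// poisson_gt0.
Qed.

End poisson_line.

Section tuple_products.
Variable R : realType.
Notation T1 := (measurableTypeR R).
Notation mu n := (lebesgue_tuple R n).
Local Open Scope ereal_scope.

Lemma integrable_tcons n (f : n.+1.-tuple T1 -> \bar R) :
  measurable_fun setT f ->
  (lebesgue_measure \x mu n)%E.-integrable setT (f \o @tcons R n) ->
  (mu n.+1).-integrable setT f /\
  \int[mu n.+1]_t f t = \int[lebesgue_measure]_x \int[mu n]_t f (tcons (x, t)).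
Proof.
move=> mf fi; split.
  exact: (integrable_pushforward (@measurable_tcons R n)).
rewrite /= /leb_step (integral_pushforward (@measurable_tcons R n))//.
by rewrite preimage_setT -(integral12_prod_meas1 fi).
Qed.

(** Functions with separated variables: the source of all explicit integrals in
    several variables below. *)
Lemma integral_tcons_prod n (f : R -> R) (h : n.-tuple T1 -> R) :
  lebesgue_measure.-integrable setT (EFin \o f) ->
  (mu n).-integrable setT (EFin \o h) ->
  (mu n.+1).-integrable setT
    (fun t => (f (thead t) * h [tuple of behead t])%:E) /\
  \int[mu n.+1]_t (f (thead t) * h [tuple of behead t])%:E =
  \int[lebesgue_measure]_x (f x)%:E * \int[mu n]_t (h t)%:E.
Proof.
move=> fi hi.
have [/measurable_EFinP mf _] := integrableP _ _ _ fi.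
have [/measurable_EFinP mh _] := integrableP _ _ _ hi.
have tE x (t : n.-tuple T1) : thead (tcons (x, t)) = x by rewrite theadE.
have bE x (t : n.-tuple T1) : [tuple of behead (tcons (x, t))] = t.
  exact/val_inj.
have mF : measurable_fun setT
    (fun t : n.+1.-tuple T1 => (f (thead t) * h [tuple of behead t])%:E).
  apply/measurable_EFinP; apply: measurable_funM.
    by apply: (measurableT_comp mf); exact: measurable_tnth.
  by apply: (measurableT_comp mh); exact: measurable_behead.
have mP : measurable_fun setT (fun p : T1 * n.-tuple T1 => (f p.1 * h p.2)%:E).
  apply/measurable_EFinP; apply: measurable_funM.
    exact: (measurableT_comp mf).
  exact: (measurableT_comp mh).
have PE : (fun t : n.+1.-tuple T1 => (f (thead t) * h [tuple of behead t])%:E)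
    \o @tcons R n = fun p => (f p.1 * h p.2)%:E.
  by apply/funext => -[x t]; rewrite /= tE bE.
have [|] := integrable_tcons mF.
  rewrite PE; apply/integrable12ltyP => //.
  under eq_integral => x _.
    under eq_integral => t _ do rewrite /= normrM EFinM.
    rewrite ge0_integralZl_EFin//; last first.
      by apply/measurable_EFinP; exact: measurableT_comp.
    over.
  rewrite ge0_integralZr//; last 2 first.
  - by apply/measurable_EFinP; exact: measurableT_comp.
  - exact: integral_ge0.
  have [_ fo] := integrableP _ _ _ fi.
  have [_ ho] := integrableP _ _ _ hi.
  by rewrite lte_mul_pinfty// ?ge0_fin_numE//; exact: integral_ge0.
move=> Fi ->; split => //.
under eq_integral => x _.
  under eq_integral => t _ do rewrite tE bE EFinM.
  rewrite integralZl//.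
  over.
have hfin : \int[mu n]_t (h t)%:E \is a fin_num by exact: integrable_fin_num.
by rewrite -(fineK hfin) integralZr.
Qed.

Lemma integral_prod_tnth (f : R -> R) n :
  lebesgue_measure.-integrable setT (EFin \o f) ->
  (mu n).-integrable setT (fun t => (\prod_(i < n) f (tnth t i))%:E) /\
  \int[mu n]_t (\prod_(i < n) f (tnth t i))%:E =
  ((fine (\int[lebesgue_measure]_x (f x)%:E)) ^+ n)%:E.
Proof.
move=> fi; elim: n => [|n [IHi IH]].
  split; last first.
    rewrite [LHS](eq_integral (cst 1)); last by move=> t _; rewrite big_ord0.
    by rewrite /= integral_dirac//= diracT ?mul1e ?mule1 expr0.
  under eq_fun do rewrite big_ord0.
  by apply: finite_measure_integrable_cst.
have E (t : n.+1.-tuple T1) : (\prod_(i < n.+1) f (tnth t i) =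
    f (thead t) * \prod_(i < n) f (tnth [tuple of behead t] i))%R.
  rewrite big_ord_recl; congr (_ * _)%R; apply: eq_bigr => i _.
  by rewrite [in LHS](tuple_eta t) tnthS.
under eq_fun do rewrite E.
have [Fi ->] := integral_tcons_prod fi IHi.
split => //; rewrite IH exprS EFinM fineK//.
exact: integrable_fin_num.
Qed.

Definition laplace_tuple n (t : n.-tuple T1) : R :=
  (\prod_(i < n) laplace (tnth t i))%R.

Definition poisson_tuple n (t : n.-tuple T1) : R :=
  (\prod_(i < n) poisson (tnth t i))%R.

Definition dot_tuple n (t z : n.-tuple T1) : R :=
  (\sum_(i < n) tnth t i * tnth z i)%R.

(** The cosine and the sine integrals have to be treated together, because the
    addition formulas mix them in the induction step. *)
Lemma integral_laplace_tuple_cos_sin n (z : n.-tuple T1) :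
  [/\ (mu n).-integrable setT
        (fun t => (laplace_tuple t * cos (dot_tuple t z))%:E),
      \int[mu n]_t (laplace_tuple t * cos (dot_tuple t z))%:E =
        (poisson_tuple z)%:E,
      (mu n).-integrable setT
        (fun t => (laplace_tuple t * sin (dot_tuple t z))%:E) &
      \int[mu n]_t (laplace_tuple t * sin (dot_tuple t z))%:E = 0].
Proof.
elim: n => [|n IH] in z *.
  have lE t : @laplace_tuple 0 t = 1%R by rewrite /laplace_tuple big_ord0.
  have dE t : dot_tuple t z = 0%R by rewrite /dot_tuple big_ord0.
  have C t : (laplace_tuple t * cos (dot_tuple t z))%:E = 1.
    by rewrite lE dE cos0 mulr1.
  have S t : (laplace_tuple t * sin (dot_tuple t z))%:E = 0.
    by rewrite dE sin0 mulr0.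
  rewrite (funext C) (funext S) /poisson_tuple big_ord0.
  split; [exact: finite_measure_integrable_cst| |
          exact: finite_measure_integrable_cst|exact: integral0].
  by rewrite /= integral_dirac//= diracT mul1e.
set z0 := thead z; set z' := [tuple of behead z].
have [ci cE si sE] := IH z'.
have dE (t : n.+1.-tuple T1) :
    dot_tuple t z = (thead t * z0 + dot_tuple [tuple of behead t] z')%R.
  rewrite /dot_tuple big_ord_recl; congr (_ + _)%R; apply: eq_bigr => i _.
  by rewrite [in LHS](tuple_eta t) [in LHS](tuple_eta z) !tnthS.
have lE (t : n.+1.-tuple T1) :
    laplace_tuple t = (laplace (thead t) * laplace_tuple [tuple of behead t])%R.
  rewrite /laplace_tuple big_ord_recl; congr (_ * _)%R; apply: eq_bigr => i _.
  by rewrite [in LHS](tuple_eta t) tnthS.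
have kE : poisson_tuple z = (poisson z0 * poisson_tuple z')%R.
  rewrite /poisson_tuple big_ord_recl; congr (_ * _)%R; apply: eq_bigr => i _.
  by rewrite [in LHS](tuple_eta z) tnthS.
have [i1 e1] := integral_tcons_prod (integrable_laplace_cos z0) ci.
have [i2 e2] := integral_tcons_prod (integrable_laplace_sin z0) si.
have [i3 e3] := integral_tcons_prod (integrable_laplace_sin z0) ci.
have [i4 e4] := integral_tcons_prod (integrable_laplace_cos z0) si.
rewrite ?(integral_laplace_cos, integral_laplace_sin, cE, sE) in e1 e2 e3 e4.
have C t : (laplace_tuple t * cos (dot_tuple t z))%:E =
  (laplace (thead t) * cos (thead t * z0) * (laplace_tuple [tuple of behead t] *
     cos (dot_tuple [tuple of behead t] z')))%:E -
  (laplace (thead t) * sin (thead t * z0) * (laplace_tuple [tuple of behead t] *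
     sin (dot_tuple [tuple of behead t] z')))%:E.
  by rewrite lE dE cosD -EFinB; congr EFin; ring.
have S t : (laplace_tuple t * sin (dot_tuple t z))%:E =
  (laplace (thead t) * sin (thead t * z0) * (laplace_tuple [tuple of behead t] *
     cos (dot_tuple [tuple of behead t] z')))%:E +
  (laplace (thead t) * cos (thead t * z0) * (laplace_tuple [tuple of behead t] *
     sin (dot_tuple [tuple of behead t] z')))%:E.
  by rewrite lE dE sinD -EFinD; congr EFin; ring.
rewrite (funext C) (funext S).
split.
- exact: integrableB.
- by rewrite integralB// e1 e2 mul0e sube0 kE EFinM.
- exact: integrableD.
- by rewrite integralD// e3 e4 mul0e mule0 adde0.
Qed.

End tuple_products.

(** * Measurability of continuous functions *)

Section continuous_measurable.
Variables (R : realType) (d : nat).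
Notation T1 := (measurableTypeR R).

(** The Borel sets of ['rV_d] are defined by its topology and the measurable
    sets of tuples by the coordinates; they agree since an open set is a
    countable union of boxes with rational corners. *)
Lemma measurable_open_row (U : set 'rV[R]_d) : open U ->
  measurable (@row_of_tuple R d @^-1` U).
Proof.
move=> oU.
pose box (p : d.-tuple (rat * rat)) : set (d.-tuple T1) :=
  [set t | forall i, tnth t i \in `](ratr (tnth p i).1 : R), ratr (tnth p i).2[].
pose A p := if pselect (box p `<=` @row_of_tuple R d @^-1` U) then box p else set0.
have mbox p : measurable (box p).
  rewrite (_ : box p = \bigcap_(i in setT)
    (@tnth d T1 ^~ i @^-1` `](ratr (tnth p i).1 : R), ratr (tnth p i).2[%classic)).
    apply: fin_bigcap_measurable; first exact: finite_finset.
    move=> i _; rewrite -[X in measurable X]setTI; apply: measurable_tnth => //.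
  by apply/seteqP; split => t /= h i; [move=> _|]; exact: h.
suff -> : @row_of_tuple R d @^-1` U = \bigcup_p A p.
  apply: countable_bigcupT_measurable; first exact: countableP.
  by move=> p; rewrite /A; case: pselect => h; [exact: mbox|exact: measurable0].
apply/seteqP; split => [t Ut|t [p _]]; last first.
  by rewrite /A; case: pselect => // h /h.
have /nbhs_ballP[e /= e0 eU] : nbhs (row_of_tuple t) U.
  exact: open_nbhs_nbhs.
have lo i : {q : rat | ratr q \in `](tnth t i - e), (tnth t i)[}.
  by apply: cid; apply: rat_in_itvoo; rewrite ltrBlDr ltrDl.
have hi i : {q : rat | ratr q \in `](tnth t i), (tnth t i + e)[}.
  by apply: cid; apply: rat_in_itvoo; rewrite ltrDl.
exists [tuple (sval (lo i), sval (hi i)) | i < d] => //.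
rewrite /A; case: pselect => [_ i|[]].
  rewrite tnth_mktuple /= in_itv/=.
  by case: (lo i) => q /= /itvP ->; case: (hi i) => q' /= /itvP ->.
move=> s bs; apply: eU; split => // i j; rewrite !ord1 /ball /= !mxE.
have := bs j; rewrite tnth_mktuple /= in_itv/=.
case: (lo j) => q /=; case: (hi j) => q' /=; rewrite !in_itv/=.
move=> /andP[_ q'e] /andP[eq _] /andP[qs sq'].
by rewrite ltr_distlC; apply/andP; split; [exact: lt_trans qs|exact: lt_trans q'e].
Qed.

Lemma measurable_continuous_row (h : 'rV[R]_d -> R) : continuous h ->
  measurable_fun setT (h \o @row_of_tuple R d).
Proof.
move=> /continuousP ch.
apply: (measurability _ (RGenOpens.measurableE R)) => _ [_ [a [b ->] <-]].
rewrite setTI comp_preimage.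
by apply: measurable_open_row; apply: ch; exact: interval_open.
Qed.

End continuous_measurable.

(** * Complex-valued integrals *)

Section complex_modulus.
Local Open Scope complex_scope.
Variable R : realType.
Implicit Types z : R[i].

Lemma complex_ReM z1 z2 : complex.Re (z1 * z2) =
  complex.Re z1 * complex.Re z2 - complex.Im z1 * complex.Im z2.
Proof. by case: z1; case: z2. Qed.

Lemma complex_ImM z1 z2 : complex.Im (z1 * z2) =
  complex.Re z1 * complex.Im z2 + complex.Im z1 * complex.Re z2.
Proof. by case: z1 => a b; case: z2 => a' b' /=. Qed.

Lemma cmodM z1 z2 : cmod (z1 * z2) = cmod z1 * cmod z2.
Proof. exact: Normc.normcM. Qed.

Lemma cmod0 : cmod 0 = 0 :> R. Proof. exact: Normc.normc0. Qed.

Lemma cmodN z : cmod (- z) = cmod z. Proof. exact: normcN. Qed.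

Lemma le_cmodD z1 z2 : cmod (z1 + z2) <= cmod z1 + cmod z2.
Proof. exact: le_normcD. Qed.

Lemma cmod_ge0 z : 0 <= cmod z.
Proof. by case: z => a b; exact: sqrtr_ge0. Qed.

Lemma cmod_eq0 z : cmod z = 0 -> z = 0. Proof. exact: Normc.eq0_normc. Qed.

Lemma normr_Re_le z : `|complex.Re z| <= cmod z.
Proof.
by case: z => a b /=; rewrite -sqrtr_sqr ler_wsqrtr// lerDl sqr_ge0.
Qed.

Lemma normr_Im_le z : `|complex.Im z| <= cmod z.
Proof.
by case: z => a b /=; rewrite -sqrtr_sqr ler_wsqrtr// lerDr sqr_ge0.
Qed.

Lemma cmod_le z : cmod z <= `|complex.Re z| + `|complex.Im z|.
Proof.
case: z => a b /=; rewrite -[leRHS]ger0_norm ?addr_ge0// -sqrtr_sqr.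
rewrite ler_wsqrtr// sqrrD !real_normK ?num_real// lerD2r lerDl.
by rewrite mulrn_wge0// mulr_ge0.
Qed.

Lemma cmod_real (a : R) : cmod a%:C = `|a|.
Proof. by rewrite /cmod /= expr0n addr0 sqrtr_sqr. Qed.

Lemma cmod_expi (t : R) : cmod (expi t) = 1.
Proof. by rewrite /cmod /= cos2Dsin2 sqrtr1. Qed.

Lemma expiD (s t : R) : expi (s + t) = expi s * expi t.
Proof. by rewrite /expi cosD sinD; congr (_ +i* _); ring. Qed.

Lemma expi0 : expi (0 : R) = 1.
Proof. by rewrite /expi cos0 sin0. Qed.

End complex_modulus.

Section complex_integral.
Local Open Scope complex_scope.
Context (dT : measure_display) (T : measurableType dT) (R : realType).
Variable m : {measure set T -> \bar R}.
Implicit Types f g : T -> R[i].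

(** Linear operations and bounds for [cintegral_Rd] are developed over any
    measure, which also covers the two-variable integrals of Fubini's theorem;
    [cintegral_RdE] relates the two definitions. *)
Definition cint f : R[i] :=
  fine (\int[m]_x (complex.Re (f x))%:E)%E +i*
  fine (\int[m]_x (complex.Im (f x))%:E)%E.

Definition cmeasurable f : Prop :=
  measurable_fun setT (fun x => complex.Re (f x)) /\
  measurable_fun setT (fun x => complex.Im (f x)).

Definition cintegrable f : Prop :=
  cmeasurable f /\ m.-integrable setT (fun x => (cmod (f x))%:E).

Lemma cmeasurable_cst z : cmeasurable (fun _ => z).
Proof. by split. Qed.

Lemma cmeasurable_real (h : T -> R) : measurable_fun setT h ->
  cmeasurable (fun x => (h x)%:C).
Proof. by move=> mh; split => //=; exact: measurable_cst. Qed.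

Lemma cmeasurable_expi (h : T -> R) : measurable_fun setT h ->
  cmeasurable (fun x => expi (h x)).
Proof.
move=> mh; split => /=.
  apply: (measurableT_comp _ mh).
  exact: continuous_measurable_fun (@continuous_cos R).
apply: (measurableT_comp _ mh).
exact: continuous_measurable_fun (@continuous_sin R).
Qed.

Lemma cmeasurableM f g : cmeasurable f -> cmeasurable g ->
  cmeasurable (fun x => f x * g x).
Proof.
move=> [rf jf] [rg jg]; split.
  under eq_fun do rewrite complex_ReM.
  by apply: measurable_funB; exact: measurable_funM.
under eq_fun do rewrite complex_ImM.
by apply: measurable_funD; exact: measurable_funM.
Qed.

Lemma cmeasurableD f g : cmeasurable f -> cmeasurable g ->
  cmeasurable (fun x => f x + g x).
Proof.
move=> [rf jf] [rg jg]; split.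
  by under eq_fun do rewrite raddfD; exact: measurable_funD.
by under eq_fun do rewrite raddfD; exact: measurable_funD.
Qed.

Lemma cmeasurableN f : cmeasurable f -> cmeasurable (fun x => - f x).
Proof.
move=> [rf jf]; split.
  by under eq_fun do rewrite raddfN; exact: measurable_funN.
by under eq_fun do rewrite raddfN; exact: measurable_funN.
Qed.

Lemma measurable_cmod f : cmeasurable f ->
  measurable_fun setT (fun x => cmod (f x)).
Proof.
move=> [rf jf].
rewrite (_ : (fun x => _) = Num.sqrt \o
  (fun x => complex.Re (f x) ^+ 2 + complex.Im (f x) ^+ 2)); last first.
  by apply/funext => x /=; case: (f x).
apply: measurableT_comp.
  exact: continuous_measurable_fun (@sqrt_continuous R).
by apply: measurable_funD; exact: measurable_funX.
Qed.

Lemma cintegrable_Re f : cintegrable f ->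
  m.-integrable setT (fun x => (complex.Re (f x))%:E).
Proof.
move=> [[rf jf] fi]; apply: le_integrable fi => //.
  exact/measurable_EFinP.
by move=> x _ /=; rewrite lee_fin (ger0_norm (cmod_ge0 _)) normr_Re_le.
Qed.

Lemma cintegrable_Im f : cintegrable f ->
  m.-integrable setT (fun x => (complex.Im (f x))%:E).
Proof.
move=> [[rf jf] fi]; apply: le_integrable fi => //.
  exact/measurable_EFinP.
by move=> x _ /=; rewrite lee_fin (ger0_norm (cmod_ge0 _)) normr_Im_le.
Qed.

Lemma le_cintegrable f (b : T -> R) : cmeasurable f ->
  m.-integrable setT (EFin \o b) -> (forall x, cmod (f x) <= b x) ->
  cintegrable f.
Proof.
move=> mf bi fb; split => //; apply: le_integrable bi => //.
  exact/measurable_EFinP/measurable_cmod.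
move=> x _ /=; rewrite lee_fin (ger0_norm (cmod_ge0 _)).
by rewrite (le_trans (fb x))// ler_norm.
Qed.

Lemma cintegrable_lty f : cmeasurable f ->
  (\int[m]_x (cmod (f x))%:E < +oo)%E -> cintegrable f.
Proof.
move=> mf foo; split => //; apply/integrableP; split.
  exact/measurable_EFinP/measurable_cmod.
by under eq_integral do rewrite /= (ger0_norm (cmod_ge0 _)).
Qed.

Lemma cintegrableD f g : cintegrable f -> cintegrable g ->
  cintegrable (fun x => f x + g x).
Proof.
move=> [mf fi] [mg gi].
apply: (@le_cintegrable _ (fun x => cmod (f x) + cmod (g x))).
- exact: cmeasurableD.
- exact: (integrableD measurableT fi gi).
- by move=> x; exact: le_cmodD.
Qed.

Lemma cintegrableZl z f : cintegrable f -> cintegrable (fun x => z * f x).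
Proof.
move=> [mf fi].
apply: (@le_cintegrable _ (fun x => cmod z * cmod (f x))).
- by apply: cmeasurableM => //; exact: cmeasurable_cst.
- exact: (integrableZl measurableT _ fi).
- by move=> x; rewrite cmodM.
Qed.

Lemma cintegrableN f : cintegrable f -> cintegrable (fun x => - f x).
Proof.
move=> [mf fi]; split; first exact: cmeasurableN.
by under eq_fun do rewrite cmodN.
Qed.

Lemma cintD f g : cintegrable f -> cintegrable g ->
  cint (fun x => f x + g x) = cint f + cint g.
Proof.
move=> fi gi; rewrite /cint.
have rf := cintegrable_Re fi; have jf := cintegrable_Im fi.
have rg := cintegrable_Re gi; have jg := cintegrable_Im gi.
rewrite -[RHS]/(_ +i* _)%C; congr (_ +i* _).
  under eq_integral do rewrite raddfD EFinD.
  by rewrite integralD// fineD//; exact: integrable_fin_num.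
under eq_integral do rewrite raddfD EFinD.
by rewrite integralD// fineD//; exact: integrable_fin_num.
Qed.

Lemma cintZl z f : cintegrable f ->
  cint (fun x => z * f x) = z * cint f.
Proof.
move=> fi; rewrite /cint.
have rf := cintegrable_Re fi; have jf := cintegrable_Im fi.
case: z => a b; rewrite -[RHS]/(_ +i* _)%C; congr (_ +i* _).
  under eq_integral do rewrite complex_ReM /= EFinB !EFinM.
  rewrite integralB//; [|exact: integrableZl|exact: integrableZl].
  rewrite !integralZl// fineB; last 2 first.
  - by rewrite fin_numM//; exact: integrable_fin_num.
  - by rewrite fin_numM//; exact: integrable_fin_num.
  by rewrite !fineM//; exact: integrable_fin_num.
under eq_integral do rewrite complex_ImM /= EFinD !EFinM.
rewrite integralD//; [|exact: integrableZl|exact: integrableZl].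
rewrite !integralZl// fineD; last 2 first.
- by rewrite fin_numM//; exact: integrable_fin_num.
- by rewrite fin_numM//; exact: integrable_fin_num.
by rewrite !fineM//; exact: integrable_fin_num.
Qed.

Lemma cintN f : cintegrable f -> cint (fun x => - f x) = - cint f.
Proof.
move=> fi; rewrite -[RHS]mulN1r -cintZl//; congr cint.
by apply/funext => x; rewrite mulN1r.
Qed.

(** The factor 2 comes from adding the bounds for the real and the imaginary
    part; absolute constants are harmless in what follows. *)
Lemma cmod_cint_le f : cintegrable f ->
  ((cmod (cint f))%:E <= 2%:E * \int[m]_x (cmod (f x))%:E)%E.
Proof.
move=> fi; have [mf ai] := fi.
have rf := cintegrable_Re fi; have jf := cintegrable_Im fi.
have ale (h : T -> R) : m.-integrable setT (EFin \o h) ->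
    (forall x, `|h x| <= cmod (f x)) ->
    (`|fine (\int[m]_x (h x)%:E)|%:E <= \int[m]_x (cmod (f x))%:E)%E.
  move=> hi hf; have [mh _] := integrableP _ _ _ hi.
  rewrite EFin_normr_Rintegral//.
  apply: (le_trans (le_abse_integral _ _ _)) => //.
  apply: ge0_le_integral => //.
  - exact: measurableT_comp.
  - exact/measurable_EFinP/measurable_cmod.
  - by move=> x _ /=; rewrite lee_fin.
apply: le_trans (_ : _ <= (`|complex.Re (cint f)|%:E + `|complex.Im (cint f)|%:E)%E)%E _.
  by rewrite -EFinD lee_fin cmod_le.
rewrite mule_natl mule2n; apply: leeD; apply: ale => //.
  by move=> x; exact: normr_Re_le.
by move=> x; exact: normr_Im_le.
Qed.

(** Convergence of complex numbers is expressed by the modulus of the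
    difference, to which the real dominated convergence theorem applies. *)
Lemma cint_dominated_cvg (f_ : (T -> R[i])^nat) f (b : T -> R) :
  (forall n, cmeasurable (f_ n)) -> cmeasurable f ->
  m.-integrable setT (EFin \o b) ->
  (forall n x, cmod (f_ n x) <= b x) -> (forall x, cmod (f x) <= b x) ->
  (forall x, cmod (f_ n x - f x) @[n --> \oo] --> (0 : R)) ->
  cmod (cint (f_ n) - cint f) @[n --> \oo] --> (0 : R).
Proof.
move=> mf_ mf bi f_b fb f_f.
have fi_ n : cintegrable (f_ n) by exact: le_cintegrable bi _.
have fi : cintegrable f by exact: le_cintegrable bi _.
have Di n : cintegrable (fun x => f_ n x - f x).
  by apply: cintegrableD => //; exact: cintegrableN.
have DE n : cint (f_ n) - cint f = cint (fun x => f_ n x - f x).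
  by rewrite cintD ?cintN//; exact: cintegrableN.
have b2 : m.-integrable setT (fun x => (2%:E * (b x)%:E)%E) by exact: integrableZl.
have [||||_ _ cvg0] := @dominated_convergence _ T R m setT measurableT
    (fun n x => (cmod (f_ n x - f x))%:E) (cst 0%E) _ _ _ _ b2.
- by move=> n; apply/measurable_EFinP/measurable_cmod; exact: (Di n).1.
- exact: measurable_cst.
- apply: aeW => x _; apply/fine_cvgP; split; first exact: nearW.
  exact: f_f.
- apply: aeW => x n _ /=; rewrite lee_fin ger0_norm ?cmod_ge0//.
  by rewrite (le_trans (le_cmodD _ _))// cmodN mulr_natl mulr2n lerD.
rewrite integral0 in cvg0.
have cvg1 : fine (2%:E * \int[m]_x (cmod (f_ n x - f x))%:E)%E @[n --> \oo] --> (0:R).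
  apply: fine_cvg; rewrite (_ : 0%:E = 2%:E * 0)%E; last by rewrite mule0.
  by apply: cvgeZl => //; exact: cvg0.
apply: (squeeze_cvgr _ (cvg_cst 0) cvg1); apply: nearW => n.
rewrite cmod_ge0 DE -lee_fin fineK ?cmod_cint_le//.
rewrite fin_numM//; apply: integrable_fin_num => //.
exact: (Di n).2.
Qed.

End complex_integral.

Section complex_fubini.
Local Open Scope complex_scope.
Context d1 d2 (T1 : measurableType d1) (T2 : measurableType d2) (R : realType).
Variable m1 : {sigma_finite_measure set T1 -> \bar R}.
Variable m2 : {sigma_finite_measure set T2 -> \bar R}.

Let measurable_fine_integral2 (h : T1 * T2 -> R) : measurable_fun setT h ->
  measurable_fun setT (fun x => fine (\int[m2]_y (h (x, y))%:E)%E).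
Proof.
move=> mh; have mE : measurable_fun setT (EFin \o h) by exact/measurable_EFinP.
apply: (measurableT_comp (fine_measurable measurableT)).
rewrite (_ : (fun x => _) = fun x =>
    ((\int[m2]_y ((EFin \o h)^\+ (x, y))) - (\int[m2]_y ((EFin \o h)^\- (x, y))))%E);
  last first.
  by apply/funext => x; rewrite [LHS]integralE; congr (_ - _)%E;
    apply: eq_integral => y _; rewrite !unlock.
apply: emeasurable_funB.
  by apply: measurable_fun_fubini_tonelli_F => //; exact: measurable_funepos.
by apply: measurable_fun_fubini_tonelli_F => //; exact: measurable_funeneg.
Qed.

Lemma cmeasurable_cint2 (H : T1 * T2 -> R[i]) : cmeasurable H ->
  cmeasurable (fun x => cint m2 (fun y => H (x, y))).
Proof.
by move=> [rH jH]; split => /=; [exact: (measurable_fine_integral2 rH)|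
                                 exact: (measurable_fine_integral2 jH)].
Qed.

Lemma cmeasurable_pair1 (H : T1 * T2 -> R[i]) x : cmeasurable H ->
  cmeasurable (fun y => H (x, y)).
Proof.
by move=> [rH jH]; split => /=; [apply: (measurableT_comp rH)|
  apply: (measurableT_comp jH)]; exact: pair1_measurable.
Qed.

Lemma cmeasurable_pair2 (H : T1 * T2 -> R[i]) y : cmeasurable H ->
  cmeasurable (fun x => H (x, y)).
Proof.
by move=> [rH jH]; split => /=; [apply: (measurableT_comp rH)|
  apply: (measurableT_comp jH)]; exact: pair2_measurable.
Qed.

Variables (H : T1 * T2 -> R[i]) (a : T1 -> R) (b : T2 -> R).
Hypotheses (mH : cmeasurable H) (ia : m1.-integrable setT (EFin \o a))
  (ib : m2.-integrable setT (EFin \o b))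
  (Hab : forall x y, cmod (H (x, y)) <= a x * b y).

Let integrableH : (m1 \x m2)%E.-integrable setT (fun z => (cmod (H z))%:E).
Proof.
have [/measurable_EFinP ma aoo] := integrableP _ _ _ ia.
have [/measurable_EFinP mb boo] := integrableP _ _ _ ib.
have mP : measurable_fun setT (fun z : T1 * T2 => (a z.1 * b z.2)%:E).
  apply/measurable_EFinP; apply: measurable_funM.
    exact: (measurableT_comp ma measurable_fst).
  exact: (measurableT_comp mb measurable_snd).
have : (m1 \x m2)%E.-integrable setT (fun z => (a z.1 * b z.2)%:E).
  apply/integrable12ltyP => //.
  under eq_integral => x _.
    under eq_integral => t _ do rewrite /= normrM EFinM.
    rewrite ge0_integralZl_EFin//; last first.
      by apply/measurable_EFinP; exact: measurableT_comp.
    over.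
  rewrite ge0_integralZr//; last 2 first.
  - by apply/measurable_EFinP; exact: measurableT_comp.
  - exact: integral_ge0.
  by rewrite lte_mul_pinfty// ?ge0_fin_numE//; exact: integral_ge0.
apply: le_integrable => //; first exact/measurable_EFinP/measurable_cmod.
move=> [x y] _ /=; rewrite lee_fin (ger0_norm (cmod_ge0 _)).
by rewrite (le_trans (Hab x y))// ler_norm.
Qed.

Lemma cintegrable_pair1 x : cintegrable m2 (fun y => H (x, y)).
Proof.
apply: (@le_cintegrable _ _ _ _ _ (fun y => a x * b y)) => //.
  exact: cmeasurable_pair1.
exact: (integrableZl measurableT _ ib).
Qed.

Lemma cintegrable_pair2 y : cintegrable m1 (fun x => H (x, y)).
Proof.
apply: (@le_cintegrable _ _ _ _ _ (fun x => b y * a x)) => //.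
- exact: cmeasurable_pair2.
- exact: (integrableZl measurableT _ ia).
- by move=> x; rewrite mulrC.
Qed.

Let fubini_fine (h : T1 * T2 -> R) :
  (m1 \x m2)%E.-integrable setT (EFin \o h) ->
  (forall x, m2.-integrable setT (fun y => (h (x, y))%:E)) ->
  (forall y, m1.-integrable setT (fun x => (h (x, y))%:E)) ->
  fine (\int[m1]_x (fine (\int[m2]_y (h (x, y))%:E))%:E)%E =
  fine (\int[m2]_y (fine (\int[m1]_x (h (x, y))%:E))%:E)%E.
Proof.
move=> hi h1 h2; congr fine.
under eq_integral => x _ do rewrite (fineK (integrable_fin_num _ (h1 x)))//.
under [RHS]eq_integral => y _ do rewrite (fineK (integrable_fin_num _ (h2 y)))//.
exact: (Fubini hi).
Qed.

(** The bound by a product of integrable functions gives integrability of every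
    section, and not only of almost every one, so that the inner integrals are
    finite everywhere. *)
Lemma cint_fubini : cint m1 (fun x => cint m2 (fun y => H (x, y))) =
  cint m2 (fun y => cint m1 (fun x => H (x, y))).
Proof.
have iH : cintegrable (m1 \x m2)%E H by split.
rewrite /cint; congr (_ +i* _).
  exact: (fubini_fine (cintegrable_Re iH)
    (fun x => cintegrable_Re (cintegrable_pair1 x))
    (fun y => cintegrable_Re (cintegrable_pair2 y))).
exact: (fubini_fine (cintegrable_Im iH)
  (fun x => cintegrable_Im (cintegrable_pair1 x))
  (fun y => cintegrable_Im (cintegrable_pair2 y))).
Qed.

End complex_fubini.

(** * Integration over row vectors *)

Section integral_rows.
Local Open Scope complex_scope.
Variables (R : realType) (d : nat).
Notation T1 := (measurableTypeR R).
Notation mu := (lebesgue_tuple R d).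
Notation row := (@row_of_tuple R d).
Implicit Types (a x y z xi eta : 'rV[R]_d) (f : 'rV[R]_d -> R[i]).

Definition tuple_of_row x : d.-tuple T1 := [tuple x ord0 i | i < d].

Lemma tuple_of_rowK : cancel tuple_of_row row.
Proof. by move=> x; apply/rowP => i; rewrite mxE tnth_mktuple. Qed.

Lemma row_of_affine_tuple a r t :
  row (affine_tuple (tuple_of_row a) r t) = a + r *: row t.
Proof. by apply/rowP => i; rewrite !mxE !tnth_mktuple. Qed.

Lemma cintegral_RdE f : cintegral_Rd f = cint mu (f \o row).
Proof. by []. Qed.

Lemma measurable_row_affine (dT : measure_display) (T : measurableType dT)
    (h : 'rV[R]_d -> T) a r : measurable_fun setT (h \o row) ->
  measurable_fun setT ((fun x => h (a + r *: x)) \o row).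
Proof.
move=> mh; rewrite (_ : _ \o _ = (h \o row) \o affine_tuple (tuple_of_row a) r).
  by apply: measurableT_comp => //; exact: measurable_affine_tuple.
by apply/funext => t /=; rewrite row_of_affine_tuple.
Qed.

Lemma ge0_integral_Rd_affine (h : 'rV[R]_d -> \bar R) a r : 0 < r ->
  measurable_fun setT (h \o row) -> (forall x, (0 <= h x)%E) ->
  integral_Rd (fun x => h (a + r *: x)) = ((r^-1 ^+ d)%:E * integral_Rd h)%E.
Proof.
move=> r0 mh h0; rewrite /integral_Rd.
rewrite -(ge0_integral_affine_tuple (tuple_of_row a) r0 mh); last first.
  by move=> t; exact: h0.
by apply: eq_integral => t _ /=; rewrite row_of_affine_tuple.
Qed.

Let integrable_row_affine (h : 'rV[R]_d -> R) a r : 0 < r ->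
  mu.-integrable setT (EFin \o (h \o row)) ->
  mu.-integrable setT (EFin \o ((fun x => h (a + r *: x)) \o row)).
Proof.
move=> r0 /integrableP[/measurable_EFinP mh hoo]; apply/integrableP; split.
  by apply/measurable_EFinP; exact: measurable_row_affine.
have := @ge0_integral_Rd_affine (fun x => `|(h x)%:E|%E) a r r0.
rewrite /integral_Rd => ->//; last first.
  by apply: measurableT_comp => //; exact/measurable_EFinP.
by rewrite lte_mul_pinfty// lee_fin exprn_ge0// invr_ge0 ltW.
Qed.

Let integral_row_affine (h : 'rV[R]_d -> R) a r : 0 < r ->
  mu.-integrable setT (EFin \o (h \o row)) ->
  (\int[mu]_t (h (a + r *: row t))%:E =
   (r^-1 ^+ d)%:E * \int[mu]_t (h (row t))%:E)%E.
Proof.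
move=> r0 hi; have [mh _] := integrableP _ _ _ hi.
have mE : measurable_fun setT ((EFin \o h) \o row) by [].
rewrite [LHS]integralE [in RHS]integralE.
rewrite muleBr//; last first.
  by apply: fin_num_adde_defr; exact: integrable_pos_fin_num.
have P : ((fun t => (h (row t))%:E)^\+ = (EFin \o h)^\+ \o row)%E.
  by rewrite -funepos_comp.
have N : ((fun t => (h (row t))%:E)^\- = (EFin \o h)^\- \o row)%E.
  by rewrite -funeneg_comp.
congr (_ - _)%E.
  rewrite P -[in RHS]/(integral_Rd _) -(@ge0_integral_Rd_affine _ a)//.
  - by apply: eq_integral => t _; rewrite !unlock.
  - by rewrite -P; exact: measurable_funepos.
rewrite N -[in RHS]/(integral_Rd _) -(@ge0_integral_Rd_affine _ a)//.
- by apply: eq_integral => t _; rewrite !unlock.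
- by rewrite -N; exact: measurable_funeneg.
Qed.

Lemma cmeasurable_row_affine f a r : cmeasurable (f \o row) ->
  cmeasurable ((fun x => f (a + r *: x)) \o row).
Proof.
move=> [rf jf]; split.
  exact: (@measurable_row_affine _ _ (fun x => complex.Re (f x))).
exact: (@measurable_row_affine _ _ (fun x => complex.Im (f x))).
Qed.

Lemma cintegral_Rd_affine f a r : 0 < r -> cintegrable mu (f \o row) ->
  cintegral_Rd (fun x => f (a + r *: x)) = (r^-1 ^+ d)%:C * cintegral_Rd f.
Proof.
move=> r0 fi; have rf := cintegrable_Re fi; have jf := cintegrable_Im fi.
rewrite !cintegral_RdE /cint; apply/eqP; rewrite eq_complex; apply/andP; split.
  rewrite /= mul0r subr0.
  rewrite (@integral_row_affine (fun x => complex.Re (f x)))// fineM//.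
  exact: integrable_fin_num.
rewrite /= mul0r addr0.
rewrite (@integral_row_affine (fun x => complex.Im (f x)))// fineM//.
exact: integrable_fin_num.
Qed.

Lemma cintegrable_row_affine f a r : 0 < r -> cintegrable mu (f \o row) ->
  cintegrable mu ((fun x => f (a + r *: x)) \o row).
Proof.
move=> r0 [mf fi]; split; first exact: cmeasurable_row_affine.
exact: (@integrable_row_affine (fun x => cmod (f x))).
Qed.

End integral_rows.

(** * Continuous functions with compact support *)

Section test_functions.
Local Open Scope complex_scope.
Variables (R : realType) (d : nat).
Notation mu := (lebesgue_tuple R d).
Notation row := (@row_of_tuple R d).
Implicit Types (x y z xi eta : 'rV[R]_d) (f : 'rV[R]_d -> R[i]).

Definition test_function f : Prop := ccontinuous f /\ compact (csupport f).

Lemma ccontinuous_cmeasurable f : ccontinuous f -> cmeasurable (f \o row).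
Proof.
by move=> [rf jf]; split; [exact: (measurable_continuous_row rf)|
                           exact: (measurable_continuous_row jf)].
Qed.

Lemma continuous_cmod f : ccontinuous f -> continuous (fun x => cmod (f x)).
Proof.
move=> [rf jf] x.
rewrite (_ : (fun x => _) = Num.sqrt \o
  (fun x => complex.Re (f x) * complex.Re (f x) +
            complex.Im (f x) * complex.Im (f x))); last first.
  by apply/funext => y /=; case: (f y).
apply: continuous_comp; last exact: sqrt_continuous.
exact: (cvgD (cvgM (rf x) (rf x)) (cvgM (jf x) (jf x))).
Qed.

Lemma csupport_out f x : ~ csupport f x -> f x = 0.
Proof.
move=> nf; apply/eqP; apply: contrapT => /negP fx0; apply: nf.
exact: subset_closure.
Qed.

(** The quotient of the modulus by [p] is continuous with compact support, hence
    bounded.  With [p] the Poisson kernel this gives integrability, and with [p]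
    constant it gives boundedness. *)
Lemma test_function_le f (p : 'rV[R]_d -> R) : test_function f ->
  continuous p -> (forall x, 0 < p x) ->
  exists2 M : R, 0 <= M & forall x, cmod (f x) <= M * p x.
Proof.
move=> [cf sf] cp p0.
pose q x := cmod (f x) / p x.
have cq : continuous q.
  move=> x; have px0 : p x != 0 by rewrite gt_eqF.
  exact: (cvgM (@continuous_cmod _ cf x) (cvgV px0 (cp x))).
have cqs : {within csupport f, continuous q} by exact: continuous_subspaceT.
have [M [_ qM]] := compact_bounded (continuous_compact cqs sf).
have M1 := qM (`|M| + 1) (ltr_pwDr ltr01 (ler_norm M)).
exists (`|M| + 1); first by rewrite addr_ge0.
move=> x; have [sx|/csupport_out ->] := pselect (csupport f x); last first.
  by rewrite cmod0 mulr_ge0// ?addr_ge0// ltW.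
rewrite -ler_pdivrMr//; apply: le_trans (ler_norm _) _.
by apply: M1; exists x.
Qed.

Lemma continuous_prod (I : Type) (s : seq I) (F : I -> 'rV[R]_d -> R) :
  (forall i, continuous (F i)) ->
  continuous (fun x => \prod_(i <- s) F i x).
Proof.
move=> cF; elim: s => [|i s IH].
  rewrite (_ : (fun _ => _) = fun _ => 1); last first.
    by apply/funext => x; rewrite big_nil.
  exact: cst_continuous.
rewrite (_ : (fun _ => _) = fun x => F i x * \prod_(j <- s) F j x).
  by move=> x; exact: (cvgM (cF i x) (IH x)).
by apply/funext => x; rewrite big_cons.
Qed.

Lemma continuous_sum (I : Type) (s : seq I) (F : I -> 'rV[R]_d -> R) :
  (forall i, continuous (F i)) ->
  continuous (fun x => \sum_(i <- s) F i x).
Proof.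
move=> cF; elim: s => [|i s IH].
  rewrite (_ : (fun _ => _) = fun _ => 0); last first.
    by apply/funext => x; rewrite big_nil.
  exact: cst_continuous.
rewrite (_ : (fun _ => _) = fun x => F i x + \sum_(j <- s) F j x).
  by move=> x; exact: (cvgD (cF i x) (IH x)).
by apply/funext => x; rewrite big_cons.
Qed.

Lemma continuous_dotl y : continuous (fun x => dot x y).
Proof.
apply: continuous_sum => i x.
exact: (cvgM (@coord_continuous R 1 d ord0 i x) (@cst_continuous _ _ (y ord0 i) x)).
Qed.

Lemma continuous_enorm : continuous (@enorm R d).
Proof.
move=> x; apply: continuous_comp; last exact: sqrt_continuous.
apply: continuous_sum => i z.
exact: (cvgM (@coord_continuous R 1 d ord0 i z) (@coord_continuous R 1 d ord0 i z)).
Qed.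

Definition laplace_row x : R := \prod_(i < d) laplace (x ord0 i).
Definition poisson_row x : R := \prod_(i < d) poisson (x ord0 i).

Lemma poisson_row_gt0 x : 0 < poisson_row x.
Proof. by apply: prodr_gt0 => i _; exact: poisson_gt0. Qed.

Lemma poisson_rowN x : poisson_row (- x) = poisson_row x.
Proof. by apply: eq_bigr => i _; rewrite mxE /poisson sqrrN. Qed.

Lemma continuous_poisson_row : continuous poisson_row.
Proof.
apply: continuous_prod => i x; apply: (@continuous_comp _ _ _ (fun x => x ord0 i)).
  exact: (@coord_continuous R 1 d ord0 i x).
exact: continuous_poisson.
Qed.

Lemma laplace_rowE x : laplace_row x = expR (- \sum_(i < d) `|x ord0 i|).
Proof. by rewrite /laplace_row -sumrN expR_sum. Qed.

Lemma laplace_row_gt0 x : 0 < laplace_row x.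
Proof. by rewrite laplace_rowE expR_gt0. Qed.

Lemma laplace_row_le1 x : laplace_row x <= 1.
Proof. by rewrite laplace_rowE -expR0 ler_expR oppr_le0 sumr_ge0. Qed.

Lemma laplace_rowZ x (r : R) : 0 <= r ->
  laplace_row (r *: x) = expR (r * (- \sum_(i < d) `|x ord0 i|)).
Proof.
move=> r0; rewrite laplace_rowE mulrN mulr_sumr; congr (expR (- _)).
by apply: eq_bigr => i _; rewrite mxE normrM ger0_norm.
Qed.

Let laplace_tupleE t : laplace_tuple t = laplace_row (row t).
Proof. by apply: eq_bigr => i _; rewrite mxE. Qed.

Let poisson_tupleE t : poisson_tuple t = poisson_row (row t).
Proof. by apply: eq_bigr => i _; rewrite mxE. Qed.

Let dot_tupleE t z : dot_tuple t (tuple_of_row z) = dot (row t) z.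
Proof. by apply: eq_bigr => i _; rewrite mxE tnth_mktuple. Qed.

Lemma integrable_poisson_row : mu.-integrable setT (EFin \o (poisson_row \o row)).
Proof.
have [h _] := integral_prod_tnth d (integrable_poisson R).
by apply: eq_integrable h => // t _ /=; rewrite -poisson_tupleE.
Qed.

Definition inversion_cst : R := (2 * pi) ^+ d.

Lemma inversion_cst_gt0 : 0 < inversion_cst.
Proof. by rewrite exprn_gt0// mulr_gt0// pi_gt0. Qed.

Lemma integral_poisson_row :
  (\int[mu]_t (poisson_row (row t))%:E = inversion_cst%:E)%E.
Proof.
have [_ h] := integral_prod_tnth d (integrable_poisson R).
rewrite integral_poisson /= in h; rewrite /inversion_cst -h.
by apply: eq_integral => t _; rewrite -poisson_tupleE.
Qed.

Lemma integrable_laplace_row : mu.-integrable setT (EFin \o (laplace_row \o row)).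
Proof.
have [h _] := integral_prod_tnth d (integrable_laplace R).
by apply: eq_integrable h => // t _ /=; rewrite -laplace_tupleE.
Qed.

Lemma measurable_dot (dT : measure_display) (T : measurableType dT)
    (u v : T -> d.-tuple (measurableTypeR R)) :
  measurable_fun setT u -> measurable_fun setT v ->
  measurable_fun setT (fun t => dot (row (u t)) (row (v t))).
Proof.
move=> mu_ mv.
rewrite (_ : (fun _ => _) = fun t => \sum_(i < d) tnth (u t) i * tnth (v t) i).
  apply: measurable_sum => i; apply: measurable_funM.
    exact: (measurableT_comp (measurable_tnth i) mu_).
  exact: (measurableT_comp (measurable_tnth i) mv).
by apply/funext => t; apply: eq_bigr => i _; rewrite !mxE.
Qed.

Lemma measurable_dotl y : measurable_fun setT (fun t => dot (row t) y).
Proof. exact: (measurable_continuous_row (@continuous_dotl y)). Qed.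

Lemma fourier_laplace_row z :
  cintegral_Rd (fun eta => (laplace_row eta)%:C * expi (dot eta z)) =
  (poisson_row z)%:C.
Proof.
have [_ C _ S] := integral_laplace_tuple_cos_sin (tuple_of_row z).
transitivity (fine (poisson_tuple (tuple_of_row z))%:E +i* fine (0%E : \bar R)).
  rewrite -C -S; congr (fine _ +i* fine _); apply: eq_integral => t _.
    by rewrite complex_ReM /= mul0r subr0 -laplace_tupleE -dot_tupleE.
  by rewrite complex_ImM /= mul0r addr0 -laplace_tupleE -dot_tupleE.
by rewrite /= poisson_tupleE tuple_of_rowK.
Qed.

Lemma test_function_integrable f : test_function f -> cintegrable mu (f \o row).
Proof.
move=> tf.
have [M M0 fM] := test_function_le tf continuous_poisson_row poisson_row_gt0.
apply: (@le_cintegrable _ _ _ _ _ (fun t => M * poisson_row (row t))).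
- exact: ccontinuous_cmeasurable tf.1.
- exact: (integrableZl measurableT _ integrable_poisson_row).
- by move=> t; exact: fM.
Qed.

Lemma test_function_bounded f : test_function f ->
  exists2 M : R, 0 <= M & forall x, cmod (f x) <= M.
Proof.
move=> tf; have [||M M0 fM] := @test_function_le f (fun _ => 1) tf.
- exact: cst_continuous.
- by [].
- by exists M => // x; have := fM x; rewrite mulr1.
Qed.

End test_functions.

(** * Fourier inversion *)

Section fourier_inversion.
Local Open Scope complex_scope.
Variables (R : realType) (d : nat).
Notation mu := (lebesgue_tuple R d).
Notation row := (@row_of_tuple R d).
Implicit Types (x y z xi eta : 'rV[R]_d) (f : 'rV[R]_d -> R[i]).

Lemma dotC x y : dot x y = dot y x.
Proof. by apply: eq_bigr => i _; rewrite mulrC. Qed.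

Lemma dotDr x y z : dot x (y + z) = dot x y + dot x z.
Proof. by rewrite -big_split; apply: eq_bigr => i _; rewrite mxE mulrDr. Qed.

Lemma dotZr x (r : R) y : dot x (r *: y) = r * dot x y.
Proof.
by rewrite /dot mulr_sumr; apply: eq_bigr => i _; rewrite mxE mulrCA.
Qed.

Lemma dotNr x y : dot x (- y) = - dot x y.
Proof. by rewrite -scaleN1r dotZr mulN1r. Qed.

Lemma ccontinuousM f g : ccontinuous f -> ccontinuous g ->
  ccontinuous (fun x => f x * g x).
Proof.
move=> [rf jf] [rg jg]; split => x.
  under eq_fun do rewrite complex_ReM.
  exact: (cvgB (cvgM (rf x) (rg x)) (cvgM (jf x) (jg x))).
under eq_fun do rewrite complex_ImM.
exact: (cvgD (cvgM (rf x) (jg x)) (cvgM (jf x) (rg x))).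
Qed.

Lemma ccontinuous_real (h : 'rV[R]_d -> R) : continuous h ->
  ccontinuous (fun x => (h x)%:C).
Proof. by move=> ch; split => //=; exact: cst_continuous. Qed.

Lemma ccontinuous_expi (h : 'rV[R]_d -> R) : continuous h ->
  ccontinuous (fun x => expi (h x)).
Proof.
move=> ch; split => x /=.
  exact: (continuous_comp (ch x) (@continuous_cos R (h x))).
exact: (continuous_comp (ch x) (@continuous_sin R (h x))).
Qed.

Lemma csupportM f g : csupport (fun x => f x * g x) `<=` csupport f.
Proof.
apply: closureS => x /=; apply: contra => /eqP ->.
by rewrite mul0r.
Qed.

Lemma test_functionM f g : test_function f -> ccontinuous g ->
  test_function (fun x => f x * g x).
Proof.
move=> [cf sf] cg; split; first exact: ccontinuousM.
apply: (subclosed_compact _ sf); first exact: closed_closure.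
exact: csupportM.
Qed.

(** The summability kernel [eta |-> laplace_row (r *: eta)] has as transform the
    approximate identity made of dilated Poisson kernels. *)
Lemma fourier_scaled_laplace (r : R) z : 0 < r ->
  cintegral_Rd (fun eta => (laplace_row (r *: eta))%:C * expi (dot eta z)) =
  (r^-1 ^+ d * poisson_row (r^-1 *: z))%:C.
Proof.
move=> r0.
pose h eta := (laplace_row eta)%:C * expi (dot eta (r^-1 *: z)).
have hi : cintegrable mu (h \o row).
  apply: (@le_cintegrable _ _ _ _ _ (fun t => laplace_row (row t))).
  - apply: cmeasurableM.
      apply: cmeasurable_real; apply/measurable_EFinP.
      by have /integrableP[] := integrable_laplace_row R d.
    by apply: cmeasurable_expi; exact: measurable_dotl.
  - exact: integrable_laplace_row.
  - by move=> t; rewrite /comp /h cmodM cmod_expi mulr1 cmod_real ger0_norm// ltW// laplace_row_gt0.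
rewrite rmorphM /= -fourier_laplace_row -(cintegral_Rd_affine 0 r0 hi).
congr cintegral_Rd; apply/funext => eta.
by rewrite /h add0r dotZr (dotC (r *: eta)) dotZr mulKf ?gt_eqF// dotC.
Qed.

(** The Abel means of the inverse Fourier integral of [f] are the convolutions
    of [f] with an approximate identity: exchange the two integrals, then
    substitute [x = y + r *: z]. *)
Lemma smoothed_fourier_inversion f (r : R) y : test_function f -> 0 < r ->
  cintegral_Rd (fun eta =>
    (laplace_row (r *: eta))%:C * (fourier f eta * expi (dot eta y))) =
  cintegral_Rd (fun z => f (y + r *: z) * (poisson_row z)%:C).
Proof.
move=> tf r0.
have fi := test_function_integrable tf.
pose H (p : d.-tuple (measurableTypeR R) * d.-tuple (measurableTypeR R)) :=
  (laplace_row (r *: row p.1))%:C * expi (dot (row p.1) y) *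
  (f (row p.2) * expi (- dot (row p.2) (row p.1))).
pose lap t := laplace_row (r *: row t).
have lapi : mu.-integrable setT (EFin \o lap).
  have li : cintegrable mu ((fun x => (laplace_row x)%:C) \o row).
    split.
      apply: cmeasurable_real; apply/measurable_EFinP.
      by have /integrableP[] := integrable_laplace_row R d.
    apply: eq_integrable (integrable_laplace_row R d) => // t _.
    by rewrite /comp cmod_real ger0_norm// ltW// laplace_row_gt0.
  have := cintegrable_Re (cintegrable_row_affine 0 r0 li).
  by apply: eq_integrable => // t _ /=; rewrite add0r.
have mlap : measurable_fun setT lap.
  by apply/measurable_EFinP; case/integrableP : lapi.
have mf := ccontinuous_cmeasurable tf.1.
have mH : cmeasurable H.
  apply: cmeasurableM; apply: cmeasurableM.
  - apply: cmeasurable_real; exact: (measurableT_comp mlap measurable_fst).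
  - apply: cmeasurable_expi.
    exact: (measurableT_comp (measurable_dotl y) measurable_fst).
  - split; [exact: (measurableT_comp mf.1 measurable_snd)|
            exact: (measurableT_comp mf.2 measurable_snd)].
  - apply: cmeasurable_expi; apply: measurable_funN.
    exact: (measurable_dot measurable_snd measurable_fst).
have HE t s : cmod (H (t, s)) <= lap t * cmod (f (row s)).
  rewrite /H !cmodM !cmod_expi !mulr1 cmod_real ger0_norm//.
  by rewrite ltW// laplace_row_gt0.
have fubini := cint_fubini mH lapi fi.2 HE.
pose G x := (f x * (r^-1 ^+ d * poisson_row (r^-1 *: (y - x)))%:C).
transitivity (cint mu (fun t => cint mu (fun s => H (t, s)))).
  congr cint; apply/funext => t; rewrite /H /comp.
  rewrite -[RHS]/(cint mu (fun s => (laplace_row (r *: row t))%:C *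
    expi (dot (row t) y) * (f (row s) * expi (- dot (row s) (row t))))).
  apply/esym; rewrite cintZl.
    by rewrite -mulrA; congr (_ * _); exact: mulrC.
  apply: (@le_cintegrable _ _ _ _ _ _ _ fi.2).
    apply: cmeasurableM; first exact: mf.
    apply: cmeasurable_expi.
    by apply: measurable_funN; exact: measurable_dotl.
  by move=> s; rewrite cmodM cmod_expi mulr1.
rewrite fubini {fubini mH HE}.
have -> : (fun s => cint mu (fun t => H (t, s))) = G \o row.
  apply/funext => s; rewrite [RHS]/(G (row s)) /G.
  rewrite -(fourier_scaled_laplace (y - row s) r0) cintegral_RdE -cintZl.
    congr cint; apply/funext => t; rewrite /H /comp [row (t, s).1]/(row t).
    rewrite [row (t, s).2]/(row s) dotDr dotNr expiD (dotC (row s)); ring.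
  apply: (@le_cintegrable _ _ _ _ _ _ _ lapi).
    apply: cmeasurableM; first exact: cmeasurable_real.
    by apply: cmeasurable_expi; exact: measurable_dotl.
  move=> t; rewrite /comp cmodM cmod_expi mulr1 cmod_real ger0_norm.
    exact: lexx.
  exact/ltW/laplace_row_gt0.
have tG : test_function G.
  apply: (test_functionM tf); apply: ccontinuous_real.
  have c1 : continuous (fun x => poisson_row (r^-1 *: (y - x))).
    move=> x; apply: (@continuous_comp _ _ _ (fun x => r^-1 *: (y - x))).
      exact: (cvgZl_tmp (cvgB (@cst_continuous _ _ y x) cvg_id)).
    exact: (@continuous_poisson_row R d).
  by move=> x; exact: (cvgM (@cst_continuous _ _ (r^-1 ^+ d) x) (c1 x)).
have rd0 : (r^-1 ^+ d)%:C != 0 :> R[i].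
  by rewrite (inj_eq (@complexI R)) expf_neq0// invr_eq0 gt_eqF.
apply: (mulfI rd0).
rewrite -[cint _ _]/(cintegral_Rd G).
rewrite -(cintegral_Rd_affine y r0 (test_function_integrable tG)).
have [M M0 fM] := test_function_bounded tf.
rewrite !cintegral_RdE -cintZl; last first.
  apply: (@le_cintegrable _ _ _ _ _ (fun t => M * poisson_row (row t))).
  - apply: cmeasurableM; first exact: cmeasurable_row_affine.
    apply: cmeasurable_real; apply/measurable_EFinP.
    by have /integrableP[] := integrable_poisson_row R d.
  - exact: (integrableZl measurableT _ (integrable_poisson_row R d)).
  - move=> t; rewrite /comp cmodM cmod_real ger0_norm.
      by rewrite ler_pM2r ?poisson_row_gt0.
    exact/ltW/poisson_row_gt0.
congr cint; apply/funext => t /=; rewrite /G.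
rewrite opprD addNKr -scalerN scalerA mulVf ?gt_eqF// scale1r poisson_rowN.
by rewrite rmorphM /= mulrCA.
Qed.

End fourier_inversion.

Section convolution_formula.
Local Open Scope complex_scope.
Variables (R : realType) (d : nat).
Notation mu := (lebesgue_tuple R d).
Notation row := (@row_of_tuple R d).
Notation c := (inversion_cst R d).
Implicit Types (x y z xi eta : 'rV[R]_d) (f : 'rV[R]_d -> R[i]).

Lemma cmeasurable_fourier f : cmeasurable (f \o row) ->
  cmeasurable (fourier f \o row).
Proof.
move=> mf.
apply: (@cmeasurable_cint2 _ _ _ _ R mu (fun p => f (row p.2) *
  expi (- dot (row p.2) (row p.1)))).
apply: cmeasurableM.
  by split; [exact: (measurableT_comp mf.1 measurable_snd)|
             exact: (measurableT_comp mf.2 measurable_snd)].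
apply: cmeasurable_expi; apply: measurable_funN.
exact: (measurable_dot measurable_snd measurable_fst).
Qed.

Lemma cmod_cvg_unique (u : (R[i])^nat) (a b : R[i]) :
  cmod (u n - a) @[n --> \oo] --> (0 : R) ->
  cmod (u n - b) @[n --> \oo] --> (0 : R) -> a = b.
Proof.
move=> ua ub; apply/eqP; rewrite -subr_eq0; apply/eqP/cmod_eq0/eqP.
rewrite eq_le cmod_ge0 andbT.
have h : cmod (u n - a) + cmod (u n - b) @[n --> \oo] --> (0 : R).
  by rewrite -(addr0 0); exact: (cvgD ua ub).
rewrite -(cvg_lim (@Rhausdorff R) h); apply: limr_ge.
  by apply/cvg_ex; exists 0.
apply: nearW => n; rewrite (_ : a - b = - (u n - a) + (u n - b)); last by ring.
by rewrite (le_trans (le_cmodD _ _))// cmodN.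
Qed.

Let rn n : R := n.+1%:R^-1.

Let rn_gt0 n : 0 < rn n. Proof. by rewrite invr_gt0. Qed.

Let rn_cvg : rn n @[n --> \oo] --> (0 : R).
Proof. exact: cvg_harmonic. Qed.

Let laplace_row_cvg eta : laplace_row (rn n *: eta) @[n --> \oo] --> (1 : R).
Proof.
under eq_fun => n do rewrite laplace_rowZ ?ltW//.
rewrite -(@expR0 R); apply: continuous_cvg; first exact: continuous_expR.
set S := - _; rewrite -[X in _ --> X](mul0r S).
exact: (cvgM rn_cvg (cvg_cst S)).
Qed.

(** Let [r] tend to 0 in [smoothed_fourier_inversion]: dominated convergence
    applies on the left because [fourier f] is integrable and on the right
    because [f] is bounded and continuous. *)
Theorem fourier_inversion f y : test_function f ->
  cintegrable mu (fourier f \o row) ->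
  c%:C * f y = cintegral_Rd (fun eta => fourier f eta * expi (dot eta y)).
Proof.
move=> tf [mF iF].
pose X t := fourier f (row t) * expi (dot (row t) y).
have mX : cmeasurable X.
  by apply: cmeasurableM => //; apply: cmeasurable_expi; exact: measurable_dotl.
have cX t : cmod (X t) = cmod (fourier f (row t)) by rewrite cmodM cmod_expi mulr1.
have mlap n : measurable_fun setT (fun t => laplace_row (rn n *: row t)).
  have ml : measurable_fun setT (laplace_row (d := d) \o row).
    by apply/measurable_EFinP; have /integrableP[] := integrable_laplace_row R d.
  have := measurable_row_affine 0 (rn n) ml.
  by rewrite (_ : _ \o _ = fun t => laplace_row (rn n *: row t))//;
    apply/funext => t /=; rewrite add0r.
have mpoi : measurable_fun setT (poisson_row (d := d) \o row).
  by apply/measurable_EFinP; have /integrableP[] := integrable_poisson_row R d.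
have lim1 := @cint_dominated_cvg _ _ R mu
  (fun n t => (laplace_row (rn n *: row t))%:C * X t) X
  (fun t => cmod (fourier f (row t))).
have [M M0 fM] := test_function_bounded tf.
have lim2 := @cint_dominated_cvg _ _ R mu
  (fun n t => f (y + rn n *: row t) * (poisson_row (row t))%:C)
  (fun t => f y * (poisson_row (row t))%:C)
  (fun t => M * poisson_row (row t)).
have E n : cint mu (fun t => (laplace_row (rn n *: row t))%:C * X t) =
  cint mu (fun t => f (y + rn n *: row t) * (poisson_row (row t))%:C).
  exact: (smoothed_fourier_inversion y tf (rn_gt0 n)).
have poiE : cint mu (fun t => f y * (poisson_row (row t))%:C) = c%:C * f y.
  rewrite cintZl; last first.
    split; first exact: cmeasurable_real.
    apply: eq_integrable (integrable_poisson_row R d) => // t _.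
    by rewrite /comp cmod_real ger0_norm// ltW// poisson_row_gt0.
  by rewrite mulrC /cint /= integral_poisson_row integral0.
rewrite -poiE; apply/esym.
rewrite -[LHS]/(cint mu X).
apply: (@cmod_cvg_unique (fun n => cint mu (fun t => (laplace_row (rn n *: row t))%:C * X t))).
  apply: lim1 => //.
  - by move=> n; apply: cmeasurableM => //; exact: cmeasurable_real.
  - move=> n t; rewrite cmodM cX cmod_real ger0_norm.
      by rewrite ler_piMl ?cmod_ge0// laplace_row_le1.
    exact/ltW/laplace_row_gt0.
  - by move=> t; rewrite cX.
  - move=> t; under eq_fun => n.
      rewrite (_ : _ - _ = (laplace_row (rn n *: row t) - 1)%:C * X t); last first.
        by rewrite rmorphB /= mulrBl mul1r.
      rewrite cmodM cmod_real.
      over.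
    have h : `|laplace_row (rn n *: row t) - 1| @[n --> \oo] --> (0 : R).
      rewrite -(@normr0 _ R) -(subrr 1); apply: cvg_norm.
      exact: (cvgB (laplace_row_cvg (row t)) (cvg_cst (1 : R))).
    rewrite -(mul0r (cmod (X t))).
    exact: (cvgM h (cvg_cst (cmod (X t)))).
under eq_fun do rewrite E.
apply: lim2.
- move=> n; apply: cmeasurableM; last exact: cmeasurable_real.
  by apply: (@cmeasurable_row_affine _ _ f); exact: ccontinuous_cmeasurable tf.1.
- by apply: cmeasurableM; [exact: cmeasurable_cst|exact: cmeasurable_real].
- exact: (integrableZl measurableT _ (integrable_poisson_row R d)).
- move=> n t; rewrite cmodM cmod_real ger0_norm.
    by rewrite ler_pM2r ?poisson_row_gt0.
  exact/ltW/poisson_row_gt0.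
- move=> t; rewrite cmodM cmod_real ger0_norm.
    by rewrite ler_pM2r ?poisson_row_gt0.
  exact/ltW/poisson_row_gt0.
- move=> t; under eq_fun => n.
    rewrite -mulrBl cmodM.
    over.
  have cf0 : continuous (fun z => cmod (f z - f y)).
    apply: continuous_cmod; split.
      move=> z; under eq_fun do rewrite raddfB.
      exact: (cvgB (tf.1.1 z) (@cst_continuous _ _ _ z)).
    move=> z; under eq_fun do rewrite raddfB.
    exact: (cvgB (tf.1.2 z) (@cst_continuous _ _ _ z)).
  have yn : y + rn n *: row t @[n --> \oo] --> y.
    rewrite -[X in _ --> X]addr0 -[X in _ + X](scale0r (row t)).
    exact: (cvgD (cvg_cst y) (cvgZr_tmp rn_cvg)).
  have h : cmod (f (y + rn n *: row t) - f y) @[n --> \oo] --> (0 : R).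
    have := cvg_comp _ _ yn (cf0 y); rewrite subrr cmod0; exact.
  rewrite -(mul0r (cmod (poisson_row (row t))%:C)).
  exact: (cvgM h (cvg_cst (cmod (poisson_row (row t))%:C))).
Qed.

End convolution_formula.

(** * The Fourier transform of a product *)

Section fourier_product.
Local Open Scope complex_scope.
Variables (R : realType) (d : nat).
Notation mu := (lebesgue_tuple R d).
Notation row := (@row_of_tuple R d).
Notation c := (inversion_cst R d).
Implicit Types (x y z xi eta : 'rV[R]_d) (f g : 'rV[R]_d -> R[i]).

Lemma ccontinuous_modulation xi : ccontinuous (fun x => expi (- dot x xi)).
Proof.
apply: ccontinuous_expi => x.
exact: (cvgN (@continuous_dotl R d xi x)).
Qed.

Lemma test_function_fourier_integrable f xi : test_function f ->
  cintegrable mu (fun t => f (row t) * expi (- dot (row t) xi)).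
Proof.
move=> tf; have := test_function_integrable
  (test_functionM tf (ccontinuous_modulation xi)).
exact.
Qed.

Lemma cmeasurable_pair_fst f : cmeasurable (f \o row) ->
  cmeasurable (fun p : d.-tuple (measurableTypeR R) * d.-tuple (measurableTypeR R) =>
    f (row p.1)).
Proof.
by move=> mf; split; [exact: (measurableT_comp mf.1 measurable_fst)|
                      exact: (measurableT_comp mf.2 measurable_fst)].
Qed.

Lemma cmeasurable_pair_snd f : cmeasurable (f \o row) ->
  cmeasurable (fun p : d.-tuple (measurableTypeR R) * d.-tuple (measurableTypeR R) =>
    f (row p.2)).
Proof.
by move=> mf; split; [exact: (measurableT_comp mf.1 measurable_snd)|
                      exact: (measurableT_comp mf.2 measurable_snd)].
Qed.

(** Insert the inversion formula for [f] into the integral defining the transform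
    of the product and exchange the integrals; the inner one becomes
    [fourier g (xi - eta)]. *)
Theorem fourierM f g xi : test_function f -> test_function g ->
  cintegrable mu (fourier f \o row) ->
  c%:C * fourier (fun x => f x * g x) xi =
  cintegral_Rd (fun eta => fourier f eta * fourier g (xi - eta)).
Proof.
move=> tf tg iF.
pose H (p : d.-tuple (measurableTypeR R) * d.-tuple (measurableTypeR R)) :=
  g (row p.1) * expi (- dot (row p.1) xi) *
  (fourier f (row p.2) * expi (dot (row p.2) (row p.1))).
have mg := ccontinuous_cmeasurable tg.1.
have mH : cmeasurable H.
  apply: cmeasurableM; apply: cmeasurableM.
  - exact: cmeasurable_pair_fst.
  - apply: cmeasurable_expi; apply: measurable_funN.
    exact: (measurableT_comp (measurable_dotl xi) measurable_fst).
  - exact: (cmeasurable_pair_snd iF.1).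
  - apply: cmeasurable_expi.
    exact: (measurable_dot measurable_snd measurable_fst).
have HE t s : cmod (H (t, s)) <= cmod (g (row t)) * cmod (fourier f (row s)).
  by rewrite /H !cmodM !cmod_expi !mulr1.
transitivity (cint mu (fun t => cint mu (fun s => H (t, s)))).
  have := test_function_fourier_integrable xi (test_functionM tf tg.1).
  move=> fgi; rewrite -[fourier _ _]/(cint mu _) -(cintZl _ fgi).
  congr cint; apply/funext => t.
  rewrite -[RHS]/(cint mu (fun s => g (row t) * expi (- dot (row t) xi) *
    (fourier f (row s) * expi (dot (row s) (row t))))).
  rewrite cintZl.
    rewrite -[cint mu _]/(cintegral_Rd (fun eta => fourier f eta * expi (dot eta (row t)))).
    by rewrite -(fourier_inversion (row t) tf iF); ring.
  apply: (@le_cintegrable _ _ _ _ _ _ _ iF.2).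
    apply: cmeasurableM; first exact: iF.1.
    by apply: cmeasurable_expi; exact: measurable_dotl.
  by move=> s; rewrite cmodM cmod_expi mulr1.
rewrite (cint_fubini mH (test_function_integrable tg).2 iF.2 HE).
rewrite cintegral_RdE; congr cint; apply/funext => s.
rewrite -[RHS]/(fourier f (row s) * (cint mu _)) -cintZl.
  congr cint; apply/funext => t.
  rewrite /H [row (t, s).1]/(row t) [row (t, s).2]/(row s) dotDr dotNr opprB.
  by rewrite expiD (dotC (row s)); ring.
exact: test_function_fourier_integrable.
Qed.

Lemma fourier_le f xi : test_function f ->
  ((cmod (fourier f xi))%:E <= 2%:E * integral_Rd (fun x => (cmod (f x))%:E))%E.
Proof.
move=> tf; apply: le_trans (cmod_cint_le (test_function_fourier_integrable xi tf)) _.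
rewrite le_eqVlt; apply/orP; left; apply/eqP; congr (_ * _)%E.
by apply: eq_integral => t _; rewrite cmodM cmod_expi mulr1.
Qed.

Lemma cmod_fourierM_le f g xi : test_function f -> test_function g ->
  cintegrable mu (fourier f \o row) ->
  ((cmod (fourier (fun x => f x * g x) xi))%:E <= (2 / c)%:E *
    integral_Rd (fun eta => (cmod (fourier f eta) * cmod (fourier g (xi - eta)))%:E))%E.
Proof.
move=> tf tg iF.
have c0 := inversion_cst_gt0 R d.
have [M [M0 gM]] : exists M : R, 0 <= M /\ forall eta, cmod (fourier g eta) <= M.
  have fin : integral_Rd (fun x => (cmod (g x))%:E) \is a fin_num.
    exact: (integrable_fin_num _ (test_function_integrable tg).2).
  exists (2 * fine (integral_Rd (fun x => (cmod (g x))%:E))); split.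
    rewrite mulr_ge0// fine_ge0//; apply: integral_ge0 => t _.
    by rewrite lee_fin cmod_ge0.
  by move=> eta; rewrite -lee_fin EFinM fineK//; exact: fourier_le.
have iFG : cintegrable mu (fun t => fourier f (row t) * fourier g (xi - row t)).
  apply: (@le_cintegrable _ _ _ _ _ (fun t => M * cmod (fourier f (row t)))).
  - apply: cmeasurableM; first exact: iF.1.
    have mg := ccontinuous_cmeasurable tg.1.
    apply: (@cmeasurable_cint2 _ _ _ _ R mu (fun p => g (row p.2) *
      expi (- dot (row p.2) (xi - row p.1)))).
    apply: cmeasurableM; first exact: cmeasurable_pair_snd.
    apply: cmeasurable_expi; apply: measurable_funN.
    under eq_fun do rewrite dotDr dotNr.
    apply: measurable_funB; last exact: (measurable_dot measurable_snd measurable_fst).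
    exact: (measurableT_comp (measurable_dotl xi) measurable_snd).
  - exact: (integrableZl measurableT _ iF.2).
  - by move=> t; rewrite cmodM mulrC ler_wpM2r ?cmod_ge0.
have -> : fourier (fun x => f x * g x) xi = (c^-1)%:C *
    cint mu (fun t => fourier f (row t) * fourier g (xi - row t)).
  have cC : c%:C != 0 :> R[i] by rewrite (inj_eq (@complexI R)) gt_eqF.
  apply: (mulfI cC); rewrite mulrA -rmorphM /= divff ?gt_eqF// mul1r.
  exact: fourierM.
rewrite cmodM cmod_real ger0_norm ?invr_ge0; last exact: ltW.
rewrite mulrC EFinM (mulrC 2) EFinM -muleA muleC lee_pmul2l//.
- apply: le_trans (cmod_cint_le iFG) _.
  rewrite le_eqVlt; apply/orP; left; apply/eqP; congr (_ * _)%E.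
  by apply: eq_integral => t _; rewrite cmodM.
- by rewrite lte_fin invr_gt0.
Qed.

Lemma fourier_modulation f zeta xi :
  fourier (fun x => f x * expi (- dot x zeta)) xi = fourier f (zeta + xi).
Proof.
congr cintegral_Rd; apply/funext => x.
by rewrite -mulrA -expiD dotDr opprD.
Qed.

End fourier_product.

(** * Weighted norms *)

Section euclidean_norm.
Local Open Scope complex_scope.
Variables (R : realType) (d : nat).
Implicit Types (x y : 'rV[R]_d).

Lemma enorm_ge0 x : 0 <= enorm x. Proof. exact: sqrtr_ge0. Qed.

Lemma enormN x : enorm (- x) = enorm x.
Proof. by congr Num.sqrt; apply: eq_bigr => i _; rewrite mxE mulrNN. Qed.

Lemma sqr_enorm x : enorm x ^+ 2 = dot x x.
Proof. by rewrite sqr_sqrtr// sumr_ge0// => i _; rewrite -expr2 sqr_ge0. Qed.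

(** Cauchy-Schwarz: expand the squared norm of
    [enorm x ^+ 2 *: y - dot x y *: x]. *)
Lemma dot_le_enorm x y : dot x y <= enorm x * enorm y.
Proof.
have [x0|x0] := eqVneq (enorm x) 0.
  have xi0 i : x ord0 i = 0.
    have /eqP : dot x x = 0 by rewrite -sqr_enorm x0 expr0n.
    rewrite psumr_eq0; last by move=> j _; rewrite -expr2 sqr_ge0.
    by move=> /allP /(_ i); rewrite mem_index_enum => /(_ isT)/eqP/eqP;
      rewrite mulf_eq0 orbb => /eqP.
  by rewrite x0 mul0r /dot big1// => i _; rewrite xi0 mul0r.
have xp : 0 < enorm x by rewrite lt_neqAle eq_sym x0 enorm_ge0.
have : 0 <= \sum_(i < d) (enorm x ^+ 2 * y ord0 i - dot x y * x ord0 i) ^+ 2.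
  by apply: sumr_ge0 => i _; exact: sqr_ge0.
under eq_bigr => i _.
  rewrite (_ : _ ^+ 2 = enorm x ^+ 4 * (y ord0 i * y ord0 i)
    - (2 * enorm x ^+ 2 * dot x y) * (x ord0 i * y ord0 i) +
    dot x y ^+ 2 * (x ord0 i * x ord0 i)); last by ring.
  over.
rewrite !big_split/= sumrN -!mulr_sumr -/(dot y y) -/(dot x y) -/(dot x x).
rewrite -!sqr_enorm => h.
have h2 : 0 <= enorm x ^+ 2 * ((enorm x * enorm y) ^+ 2 - dot x y ^+ 2).
  by apply: le_trans h _; rewrite le_eqVlt; apply/orP; left; apply/eqP; ring.
move: h2; rewrite pmulr_rge0 ?exprn_gt0// subr_ge0 => h2.
have /ler_normlP[_] : `|dot x y| <= enorm x * enorm y.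
  by rewrite -(@ler_pXn2r _ 2%N) ?nnegrE ?normr_ge0 ?mulr_ge0 ?enorm_ge0// real_normK// num_real.
exact.
Qed.

Lemma le_enormD x y : enorm (x + y) <= enorm x + enorm y.
Proof.
rewrite -(@ler_pXn2r _ 2%N) ?nnegrE ?addr_ge0 ?enorm_ge0//.
rewrite sqrrD !sqr_enorm dotDr !(dotC (x + y)) !dotDr (dotC y x).
have := dot_le_enorm x y; lra.
Qed.

Lemma normr_coord_le x i : `|x ord0 i| <= enorm x.
Proof.
rewrite -(@ler_pXn2r _ 2%N) ?nnegrE ?normr_ge0 ?enorm_ge0// real_normK ?num_real//.
rewrite sqr_enorm /dot (bigD1 i)//= expr2 lerDl.
by apply: sumr_ge0 => j _; rewrite -expr2 sqr_ge0.
Qed.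

End euclidean_norm.

Section weight.
Local Open Scope complex_scope.
Variables (R : realType) (d : nat) (w : R -> R).
Hypothesis ww : weight_class w.
Notation mu := (lebesgue_tuple R d).
Notation row := (@row_of_tuple R d).
Implicit Types (x y xi eta : 'rV[R]_d) (f g : 'rV[R]_d -> R[i]) (l : R).

Lemma weight_enorm_ge0 xi : 0 <= w (enorm xi).
Proof. by apply: (weight_ge0 ww); exact: enorm_ge0. Qed.

Lemma weight_enormD xi eta : w (enorm (xi + eta)) <= w (enorm xi) + w (enorm eta).
Proof.
apply: le_trans (weight_subadd ww (enorm_ge0 _) (enorm_ge0 _)).
by apply: (weight_ndecr ww); [exact: enorm_ge0|exact: le_enormD].
Qed.

Definition wexp l xi : R := expR (l * w (enorm xi)).

Lemma wexp_gt0 l xi : 0 < wexp l xi. Proof. exact: expR_gt0. Qed.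

Lemma wexp_ge1 l xi : 0 <= l -> 1 <= wexp l xi.
Proof.
by move=> l0; rewrite -expR0 ler_expR mulr_ge0// weight_enorm_ge0.
Qed.

(** Subadditivity of [w] makes the exponential weight submultiplicative; this is
    what turns the convolution formula into an algebra property. *)
Lemma wexpD l xi eta : 0 <= l -> wexp l (xi + eta) <= wexp l xi * wexp l eta.
Proof.
move=> l0; rewrite /wexp -expRD ler_expR -mulrDr ler_wpM2l//.
exact: weight_enormD.
Qed.

Lemma measurable_wexp l : measurable_fun setT (wexp l \o row).
Proof.
have mw : measurable_fun (`[0%R, +oo[%classic : set R) w.
  by apply: subspace_continuous_measurable_fun (weight_cont ww); exact: measurable_itv.
apply: (@measurableT_comp _ _ _ _ _ _ expR) => //.
apply: measurable_funM; first exact: measurable_cst.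
apply: (measurable_comp (measurable_itv _) _ mw).
  by move=> _ [t _ <-]; rewrite /= in_itv/= andbT; exact: enorm_ge0.
exact: (measurable_continuous_row (@continuous_enorm R d)).
Qed.

Lemma wnormE l f : wnorm w l f =
  integral_Rd (fun xi => (cmod (fourier f xi) * wexp l xi)%:E).
Proof. by []. Qed.

Lemma measurable_wnorm_integrand l f : ccontinuous f ->
  measurable_fun setT ((fun xi => (cmod (fourier f xi) * wexp l xi)%:E) \o row).
Proof.
move=> cf; apply/measurable_EFinP; apply: measurable_funM.
  exact: (measurable_cmod (cmeasurable_fourier (ccontinuous_cmeasurable cf))).
exact: measurable_wexp.
Qed.

Let integrand_ge0 l f xi : (0 <= (cmod (fourier f xi) * wexp l xi)%:E)%E.
Proof. by rewrite lee_fin mulr_ge0 ?cmod_ge0// ltW// wexp_gt0. Qed.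

Lemma wnorm_ge0 l f : (0 <= wnorm w l f)%E.
Proof. by apply: integral_ge0 => t _; exact: integrand_ge0. Qed.

(** The weight is at least 1, so finiteness of a weighted norm implies
    integrability of the transform. *)
Lemma fourier_integrable l f : 0 <= l -> ccontinuous f ->
  (wnorm w l f < +oo)%E -> cintegrable mu (fourier f \o row).
Proof.
move=> l0 cf foo; apply: cintegrable_lty.
  exact: cmeasurable_fourier (ccontinuous_cmeasurable cf).
apply: le_lt_trans foo; apply: ge0_le_integral => //.
- by move=> t _; rewrite lee_fin cmod_ge0.
- apply/measurable_EFinP; apply: measurable_cmod.
  exact: cmeasurable_fourier (ccontinuous_cmeasurable cf).
- exact: measurable_wnorm_integrand.
- by move=> t _; rewrite lee_fin ler_peMr ?cmod_ge0// wexp_ge1.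
Qed.

Lemma wnormD_le l f g (z : R[i]) : 0 <= l -> test_function f -> test_function g ->
  (wnorm w l (fun x => f x + z * g x)%R <=
   wnorm w l f + (cmod z)%:E * wnorm w l g)%E.
Proof.
move=> l0 tf tg.
have FE xi : fourier (fun x => f x + z * g x) xi = fourier f xi + z * fourier g xi.
  rewrite -[fourier g xi]/(cint mu _).
  rewrite -(cintZl z (test_function_fourier_integrable xi tg)).
  rewrite -[fourier f xi]/(cint mu _) -cintD.
  - by congr cint; apply/funext => t; rewrite mulrDl -mulrA.
  - exact: test_function_fourier_integrable.
  - exact/cintegrableZl/test_function_fourier_integrable.
have mf := measurable_wnorm_integrand l tf.1.
have mg := measurable_wnorm_integrand l tg.1.
rewrite -ge0_integralZl//; last 2 first.
- by move=> t _; exact: integrand_ge0.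
- by rewrite lee_fin cmod_ge0.
rewrite -ge0_integralD//; last 3 first.
- by move=> t _; exact: integrand_ge0.
- by move=> t _; rewrite mule_ge0 ?integrand_ge0// lee_fin cmod_ge0.
- by apply: emeasurable_funM => //; exact: measurable_cst.
apply: ge0_le_integral => //.
- by move=> t _; exact: integrand_ge0.
- apply: (@measurable_wnorm_integrand l (fun x => f x + z * g x)).
  split => x; under eq_fun do rewrite raddfD.
    have [h _] := ccontinuousM (f := fun _ => z) (conj (@cst_continuous _ _ _) (@cst_continuous _ _ _)) tg.1.
    exact: (cvgD (tf.1.1 x) (h x)).
  have [_ h] := ccontinuousM (f := fun _ => z) (conj (@cst_continuous _ _ _) (@cst_continuous _ _ _)) tg.1.
  exact: (cvgD (tf.1.2 x) (h x)).
- apply: emeasurable_funD => //; apply: emeasurable_funM => //.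
- move=> t _; rewrite -EFinM -EFinD lee_fin mulrA -mulrDl.
  rewrite ler_pM2r ?wexp_gt0// FE -cmodM; exact: le_cmodD.
Qed.

Lemma integral_Rd_translate (h : 'rV[R]_d -> \bar R) a :
  measurable_fun setT (h \o row) -> (forall x, (0 <= h x)%E) ->
  integral_Rd (fun x => h (a + 1 *: x)) = integral_Rd h.
Proof.
by move=> mh h0; rewrite (ge0_integral_Rd_affine a ltr01 mh h0) invr1 expr1n mul1e.
Qed.

(** Modulation translates the transform. *)
Lemma wnorm_modulation l f zeta : 0 <= l -> test_function f ->
  (wnorm w l (fun x => f x * expi (- dot x zeta))%R <=
   (wexp l zeta)%:E * wnorm w l f)%E.
Proof.
move=> l0 tf.
have mf := measurable_wnorm_integrand l tf.1.
have mz := measurable_row_affine zeta 1 mf.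
rewrite wnormE (wnormE l f).
rewrite -(integral_Rd_translate zeta mf (integrand_ge0 l f)).
rewrite -ge0_integralZl//; last first.
  by rewrite lee_fin ltW// wexp_gt0.
apply: ge0_le_integral => //.
- apply: (measurable_wnorm_integrand l (f := fun x => f x * expi (- dot x zeta))).
  exact: ccontinuousM tf.1 (ccontinuous_modulation zeta).
- by apply: emeasurable_funM => //; exact: measurable_cst.
- move=> t _; rewrite -EFinM lee_fin fourier_modulation scale1r mulrCA ler_wpM2l ?cmod_ge0//.
  rewrite -[X in wexp l X <= _](addKr zeta) (le_trans (wexpD _ _ l0))//.
  by rewrite /wexp enormN.
Qed.

Lemma measurable_row_sub (dT : measure_display) (T : measurableType dT)
    (h : 'rV[R]_d -> T) : measurable_fun setT (h \o row) ->
  measurable_fun setT (fun p : d.-tuple (measurableTypeR R) *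
    d.-tuple (measurableTypeR R) => h (row p.1 - row p.2)).
Proof.
move=> mh.
pose diff (p : d.-tuple (measurableTypeR R) * d.-tuple (measurableTypeR R)) :
  d.-tuple (measurableTypeR R) := [tuple (tnth p.1 i - tnth p.2 i)%R | i < d].
rewrite (_ : (fun p => _) = (h \o row) \o diff); last first.
  apply/funext => p /=; congr h; apply/rowP => i.
  by rewrite !mxE tnth_mktuple.
apply: (measurableT_comp mh); apply/measurable_fun_tnthP => i.
rewrite (_ : _ \o _ = fun p => (tnth p.1 i - tnth p.2 i)%R); last first.
  by apply/funext => p /=; rewrite tnth_mktuple.
apply: measurable_funB.
  exact: (measurableT_comp (measurable_tnth i) measurable_fst).
exact: (measurableT_comp (measurable_tnth i) measurable_snd).
Qed.

(** Distribute the weight at [xi] over [eta] and [xi - eta] in the convolution,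
    and integrate first in [xi]. *)
Lemma wnormM_le l f g : 0 <= l -> test_function f -> test_function g ->
  (wnorm w l f < +oo)%E ->
  (wnorm w l (fun x => f x * g x)%R <=
   (2 / inversion_cst R d)%:E * (wnorm w l f * wnorm w l g))%E.
Proof.
move=> l0 tf tg foo.
have iF := fourier_integrable l0 tf.1 foo.
have c0 := inversion_cst_gt0 R d.
pose A eta := cmod (fourier f eta) * wexp l eta.
pose B eta := cmod (fourier g eta) * wexp l eta.
have A0 eta : 0 <= A eta by have := integrand_ge0 l f eta; rewrite lee_fin.
have B0 eta : 0 <= B eta by have := integrand_ge0 l g eta; rewrite lee_fin.
have mA : measurable_fun setT (A \o row).
  apply/measurable_EFinP; exact: (measurable_wnorm_integrand l tf.1).
have mB : measurable_fun setT (B \o row).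
  apply/measurable_EFinP; exact: (measurable_wnorm_integrand l tg.1).
have mAB : measurable_fun setT (fun p : d.-tuple (measurableTypeR R) *
    d.-tuple (measurableTypeR R) => (A (row p.2) * B (row p.1 - row p.2))%:E).
  apply/measurable_EFinP; apply: measurable_funM.
    exact: (measurableT_comp mA measurable_snd).
  exact: measurable_row_sub.
pose C : \bar R := (2 / inversion_cst R d)%:E.
have C0 : (0 <= C)%E by rewrite lee_fin divr_ge0// ltW.
have pt t : ((cmod (fourier (fun x => f x * g x)%R (row t)) * wexp l (row t))%:E <=
    C * \int[mu]_s (A (row s) * B (row t - row s))%:E)%E.
  rewrite EFinM muleC.
  apply: (@le_trans _ _ ((wexp l (row t))%:E * (C * integral_Rd (fun eta =>
    (cmod (fourier f eta) * cmod (fourier g (row t - eta)))%:E))))%E.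
    by rewrite lee_wpmul2l ?lee_fin ?(ltW (wexp_gt0 _ _))// cmod_fourierM_le.
  rewrite muleCA lee_wpmul2l//.
  have mFG : measurable_fun setT (fun s =>
      (cmod (fourier f (row s)) * cmod (fourier g (row t - row s)))%:E).
    have mcf := measurable_cmod iF.1.
    have mcg := measurable_cmod (cmeasurable_fourier (ccontinuous_cmeasurable tg.1)).
    apply/measurable_EFinP; apply: measurable_funM => //.
    exact: (measurableT_comp (measurable_row_sub (h := fun x => cmod (fourier g x)) mcg)
      (pair1_measurable t)).
  rewrite -ge0_integralZl//; last 2 first.
  - by move=> s _; rewrite lee_fin mulr_ge0 ?cmod_ge0.
  - by rewrite lee_fin ltW// wexp_gt0.
  apply: ge0_le_integral => //.
  - by move=> s _; rewrite mule_ge0// lee_fin ?mulr_ge0 ?cmod_ge0// ltW// wexp_gt0.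
  - by apply: emeasurable_funM => //; exact: measurable_cst.
  - exact: (measurableT_comp mAB (pair1_measurable t)).
  - move=> s _; rewrite -EFinM lee_fin /A /B mulrACA mulrC.
    rewrite ler_wpM2l ?mulr_ge0 ?cmod_ge0//.
    by rewrite -[X in wexp l X <= _](addrNK (row s)) addrC wexpD.
have inner s : (\int[mu]_t (A (row s) * B (row t - row s))%:E =
    (A (row s))%:E * wnorm w l g)%E.
  under eq_integral do rewrite EFinM.
  have mBE : measurable_fun setT ((fun xi => (B xi)%:E) \o row) by exact/measurable_EFinP.
  have mBs : measurable_fun setT (fun t => (B (row t - row s))%:E).
    have := measurable_row_affine (- row s) 1 mBE.
    apply: eq_measurable_fun => t _.
    by rewrite /comp scale1r addrC.
  rewrite ge0_integralZl_EFin; [|exact: measurableT| |exact: mBs|exact: A0]; last first.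
    by move=> t _; rewrite lee_fin.
  rewrite -[wnorm w l g]/(integral_Rd (fun x => (B x)%:E)).
  rewrite -(integral_Rd_translate (- row s) mBE B0).
  apply: (congr1 (fun z => (A (row s))%:E * z)%E).
  apply: eq_integral => t _.
  by rewrite scale1r addrC.
rewrite wnormE; apply: (@le_trans _ _ (\int[mu]_t
    (C * \int[mu]_s (A (row s) * B (row t - row s))%:E))%E).
  apply: ge0_le_integral => //.
  - apply: (measurable_wnorm_integrand l (f := fun x => f x * g x)).
    exact: ccontinuousM tf.1 tg.1.
  - apply: emeasurable_funM; first exact: measurable_cst.
    by apply: (measurable_fun_fubini_tonelli_F _ mAB) => p; rewrite lee_fin mulr_ge0.
rewrite ge0_integralZl//; last 2 first.
- by apply: (measurable_fun_fubini_tonelli_F _ mAB) => p; rewrite lee_fin mulr_ge0.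
- by move=> t _; apply: integral_ge0 => s _; rewrite lee_fin mulr_ge0.
rewrite lee_wpmul2l//.
have -> := fubini_tonelli (m1 := mu) (m2 := mu) _ mAB (fun p => mulr_ge0 (A0 _) (B0 _)).
under eq_integral do rewrite inner.
rewrite ge0_integralZr//.
- exact/measurable_EFinP.
- by move=> s _; rewrite lee_fin.
- by apply: integral_ge0 => s _; rewrite lee_fin; exact: B0.
Qed.

End weight.

(** * The gliding hump *)

(** An abstract uniform boundedness principle.  [U e x] is thought of as the value
    of the functional of index [e] at the test function of index [x], whose
    seminorms grow like [expR (h * p x)]; [G e] is the rate of decrease.  If the
    functionals, which are bounded for each [e] and decrease faster than [G] at
    each [x], are not bounded by [n * G e * expR (n * p x)] uniformly in [x] for
    small [e], then some absolutely convergent combination of test functions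
    violates the rate [G]. *)
Section gliding_hump.
Variables (R : realType) (X : Type) (p : X -> R).
Variables (U : R -> X -> R) (M G : R -> R).
Hypothesis p_ge0 : forall x, 0 <= p x.
Hypothesis G_gt0 : forall e, 0 < G e.
Hypothesis M_ge0 : forall e, 0 <= M e.
Hypothesis U_le : forall e x, 0 < e < 1 -> `|U e x| <= M e.
Hypothesis U_small : forall x (c : R), 0 < c ->
  \forall e \near 0^'+, `|U e x| <= c * G e.

Let psum (L : seq (R * X)) (e : R) := \sum_(q <- L) q.1 * U e q.2.

Let psum_small L : \forall e \near 0^'+, `|psum L e| <= G e.
Proof.
suff : forall c, 0 < c -> \forall e \near 0^'+, `|psum L e| <= c * G e.
  by move=> /(_ 1 ltr01); apply: filterS => e; rewrite mul1r.
elim: L => [|q L IH] c c0.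
  apply: nearW => e; rewrite /psum big_nil normr0 mulr_ge0// ltW//.
have q1 : 0 < `|q.1| + 1 by rewrite ltr_wpDl.
have c2 : 0 < c / 2 by rewrite divr_gt0.
have := IH _ c2; have := U_small q.2 (divr_gt0 c2 q1).
apply: filterS2 => e h1 h2; rewrite /psum big_cons.
rewrite (le_trans (ler_normD _ _))// [c in leRHS]splitr mulrDl lerD//.
rewrite normrM; apply: (@le_trans _ _ (`|q.1| * (c / 2 / (`|q.1| + 1) * G e))).
  by rewrite ler_wpM2l.
rewrite mulrA ler_wpM2r ?(ltW (G_gt0 _))// mulrCA ler_piMr ?(ltW c2)//.
by rewrite ler_pdivrMr// mul1r lerDl.
Qed.

Hypothesis unbounded : ~ exists n : nat, \forall e \near 0^'+,
  forall x, `|U e x| <= n%:R * G e * expR (n%:R * p x).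

(** One step of the construction: a parameter, an index and an order at which the
    uniform bound fails. *)
Record hump := Hump { hump_e : R; hump_x : X; hump_n : nat }.

(** The state [s] consists of the coefficients and indices chosen so far and of
    the size [s.2] allowed for the next coefficient.  The conditions say that
    the hump is close to 0, that its height beats the smallness of the next
    coefficient by a factor 4, and that the terms chosen before contribute at
    most [G] there. *)
Let good (m : nat) (s : seq (R * X) * R) (t : hump) : Prop :=
  [/\ 0 < hump_e t < 1 /\ hump_e t < m.+1%:R^-1,
      (m <= hump_n t)%N /\ 4 <= s.2 * (hump_n t)%:R,
      `|psum s.1 (hump_e t)| <= G (hump_e t) &
      (hump_n t)%:R * G (hump_e t) * expR ((hump_n t)%:R * p (hump_x t)) <
        `|U (hump_e t) (hump_x t)|].

Let exists_hump m s : exists t, 0 < s.2 -> good m s t.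
Proof.
case: s => L c /=.
have [c0|c0] := ltP 0 c; last first.
  apply: contrapT => h; apply: unbounded; exists 0%N.
  apply: nearW => e x; exfalso; apply: h.
  by exists (Hump e x 0).
pose n := maxn m (Num.trunc (4 / c)).+1.
have n4 : 4 <= c * n%:R.
  rewrite mulrC -ler_pdivrMr//; apply: le_trans (ltW (truncnS_gt _)) _.
  by rewrite ler_nat leq_maxr.
apply: contrapT => h; apply: unbounded; exists n.
near=> e => x; rewrite leNgt; apply/negP => hx; apply: h.
exists (Hump e x n) => _; split => //=.
- split; last by near: e; apply: nbhs_right_lt; rewrite invr_gt0.
  by apply/andP; split; near: e; [exact: nbhs_right_gt|exact: nbhs_right_lt].
- by split => //; exact: leq_maxl.
- by near: e; exact: psum_small.
Unshelve. all: by end_near. Qed.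

Let pick m s : hump := projT1 (cid (exists_hump m s)).

Let pickP m s : 0 < s.2 -> good m s (pick m s).
Proof. exact: (projT2 (cid (exists_hump m s))). Qed.

Let weight_of (s : seq (R * X) * R) (t : hump) : R :=
  s.2 * expR (- (hump_n t)%:R * p (hump_x t)).

(** Halving the allowed size makes the series converge; the second bound keeps all
    later terms below [G] at the present hump. *)
Let next m (s : seq (R * X) * R) : seq (R * X) * R :=
  let t := pick m s in
  (rcons s.1 (weight_of s t, hump_x t),
   Num.min (s.2 / 2) (G (hump_e t) / (2 * (M (hump_e t) + 1)))).

Let state := fix state m := if m is k.+1 then next k (state k) else ([::], 1).

Let c_ m := (state m).2.
Let t_ m := pick m (state m).
Let a_ m := weight_of (state m) (t_ m).
Let x_ m := hump_x (t_ m).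
Let e_ m := hump_e (t_ m).
Let n_ m := hump_n (t_ m).

Let M1 e : 0 < 2 * (M e + 1). Proof. by rewrite mulr_gt0// ltr_wpDl. Qed.

Let c_gt0 m : 0 < c_ m.
Proof.
elim: m => [|m IH]; first by rewrite /c_ /= ltr01.
by rewrite /c_ /= lt_min !divr_gt0.
Qed.

Let c_half m : c_ m.+1 <= c_ m / 2.
Proof. by rewrite {1}/c_ /= ge_min lexx. Qed.

Let c_M m : 2 * c_ m.+1 * M (e_ m) <= G (e_ m).
Proof.
have : c_ m.+1 <= G (e_ m) / (2 * (M (e_ m) + 1)).
  by rewrite {1}/c_ /= ge_min lexx orbT.
rewrite ler_pdivlMr// => h; apply: le_trans h.
rewrite -mulrA mulrCA ler_wpM2l ?(ltW (c_gt0 _))// ler_wpM2l//.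
by rewrite lerDl.
Qed.

Let stateE m : (state m).1 = [seq (a_ j, x_ j) | j <- iota 0 m].
Proof.
elim: m => [//|m IH].
by rewrite -[m.+1]addn1 iotaD map_cat -IH /= cats1 addn1.
Qed.

Let psumE m e : psum (state m).1 e = \sum_(0 <= j < m) a_ j * U e (x_ j).
Proof. by rewrite stateE /psum big_map /index_iota subn0. Qed.

Let a_ge0 m : 0 <= a_ m.
Proof. by apply: mulr_ge0; [exact/ltW/c_gt0|exact: expR_ge0]. Qed.

(** Since the sizes are at least halved at each step, a tail is at most twice its
    first term. *)
Let sum_c m N : (m <= N)%N ->
  \sum_(m <= j < N) c_ j + 2 * c_ N <= 2 * c_ m.
Proof.
move=> /subnK <-; elim: (N - m)%N => [|k IH].
  by rewrite add0n big_geq// add0r.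
rewrite addSn big_nat_recr ?leq_addl//=; apply: le_trans IH.
by have := c_half (k + m); lra.
Qed.

Let a_exp_le h m : h <= m%:R -> a_ m * expR (h * p (x_ m)) <= c_ m.
Proof.
move=> hm; have [_ [mn _] _ _] := pickP m (c_gt0 m).
rewrite /a_ /weight_of -mulrA -expRD ler_piMr ?(ltW (c_gt0 _))//.
have hn : h <= (hump_n (t_ m))%:R by apply: le_trans hm _; rewrite ler_nat.
rewrite -[leRHS]expR0 ler_expR -mulrDl; apply: mulr_le0_ge0 => //.
by rewrite addrC subr_le0.
Qed.

Let a_le_c m : a_ m <= c_ m.
Proof. by have := @a_exp_le 0 m (ler0n _ _); rewrite mul0r expR0 mulr1. Qed.

Let cvg_bounded_series (u : R^nat) (N : nat) (B : R) :
  (forall n, 0 <= u n) -> (forall n, \sum_(N <= j < n) u j <= B) ->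
  cvgn (series u).
Proof.
move=> u0 uB; rewrite -(is_cvg_series_restrict N).
apply: nondecreasing_is_cvgn.
  apply/nondecreasing_seqP => n /=.
  have [Nn|nN] := leqP N n; first by rewrite big_nat_recr//= lerDl.
  by rewrite !big_geq//; exact: ltnW.
by exists B => _ [n _ <-] /=.
Qed.

Let summable h : cvgn (series (fun n => a_ n * expR (h * p (x_ n)))).
Proof.
(* From the index N on, the order of the hump exceeds h. *)
pose N := (Num.trunc `|h|).+1.
have hN m : (N <= m)%N -> h <= m%:R.
  move=> Nm; rewrite (le_trans (ler_norm _))// (le_trans (ltW (truncnS_gt _)))//.
  by rewrite ler_nat.
apply: (@cvg_bounded_series _ N (2 * c_ N)) => n.
  by rewrite mulr_ge0// expR_ge0.
have [Nn|nN] := leqP N n; last first.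
  by rewrite big_geq ?(ltnW nN)// mulr_ge0// ltW.
apply: (@le_trans _ _ (\sum_(N <= j < n) c_ j)).
  rewrite !big_nat; apply: ler_sum => j /andP[Nj _].
  by apply: a_exp_le; exact: hN.
by apply: le_trans (sum_c Nn); rewrite lerDl mulr_ge0// ltW.
Qed.

Let cvg_U e : 0 < e < 1 -> cvgn (series (fun n => a_ n * U e (x_ n))).
Proof.
move=> e01; apply: normed_cvg.
apply: (@cvg_bounded_series _ 0 (2 * c_ 0 * M e)) => n; first exact: normr_ge0.
apply: (@le_trans _ _ (\sum_(0 <= j < n) c_ j * M e)).
  apply: ler_sum => j _; rewrite /= normrM (ger0_norm (a_ge0 _)).
  by apply: ler_pM => //; exact: U_le.
rewrite -mulr_suml ler_wpM2r//; apply: le_trans (sum_c (leq0n n)).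
by rewrite lerDl mulr_ge0// ltW.
Qed.

(** At the [m]-th hump the main term is at least [4 * G], the earlier terms and the
    later terms are at most [G] each. *)
Let hump_large m : 2 * G (e_ m) <= `|limn (series (fun n => a_ n * U (e_ m) (x_ n)))|.
Proof.
have [[e01 _] [_ n4] Ps Ul] := pickP m (c_gt0 m).
rewrite -/(t_ m) -/(e_ m) -/(n_ m) -/(x_ m) -/(c_ m) psumE in e01 n4 Ps Ul.
have cv := cvg_U e01.
have Ge := ltW (G_gt0 (e_ m)).
have main : 4 * G (e_ m) <= `|a_ m * U (e_ m) (x_ m)|.
  rewrite normrM (ger0_norm (a_ge0 _)).
  apply: le_trans (_ : a_ m * ((n_ m)%:R * G (e_ m) * expR ((n_ m)%:R * p (x_ m))) <= _).
    rewrite /a_ /weight_of -/(c_ m) -/(n_ m) -/(x_ m).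
    rewrite [leRHS](_ : _ = (c_ m * (n_ m)%:R) * G (e_ m) *
      (expR (- (n_ m)%:R * p (x_ m)) * expR ((n_ m)%:R * p (x_ m)))); last by ring.
    by rewrite -expRD mulNr addNr expR0 mulr1 ler_wpM2r.
  by rewrite ler_wpM2l// ltW.
rewrite -lim_norm//; apply: limr_ge.
  exact: is_cvg_norm.
exists m.+1 => // N /= mN.
rewrite /series/= (big_cat_nat (leq0n m.+1) mN)/= big_nat_recr//=.
set P := \sum_(0 <= _ < m) _; set T := \sum_(m.+1 <= _ < N) _.
have TE : `|T| <= G (e_ m).
  apply: le_trans (c_M m); apply: (@le_trans _ _ (\sum_(m.+1 <= j < N) c_ j * M (e_ m))).
    apply: le_trans (ler_norm_sum _ _ _) _.
    apply: ler_sum => j _; rewrite normrM (ger0_norm (a_ge0 _)).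
    by apply: ler_pM => //; exact: U_le.
  rewrite -mulr_suml ler_wpM2r//; apply: le_trans (sum_c mN).
  by rewrite lerDl mulr_ge0// ltW.
have : `|a_ m * U (e_ m) (x_ m)| <= `|P + a_ m * U (e_ m) (x_ m) + T| + `|P| + `|T|.
  rewrite {1}(_ : a_ m * U (e_ m) (x_ m) =
    (P + a_ m * U (e_ m) (x_ m) + T) - P - T); last by ring.
  by rewrite (le_trans (ler_normB _ _))// lerD2r ler_normB.
lra.
Qed.

Lemma gliding_hump : exists (a : R^nat) (x : nat -> X),
  [/\ forall n, 0 <= a n,
      forall h, cvgn (series (fun n => a n * expR (h * p (x n)))) &
      ~ \forall e \near 0^'+,
        `|limn (series (fun n => a n * U e (x n)))| <= G e].
Proof.
exists a_, x_; split => // near_le.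
have [r /= r0 rP] := near_le.
have [m mr] : exists m : nat, m.+1%:R^-1 < r.
  exists (Num.trunc r^-1); rewrite invf_plt ?posrE//; exact: truncnS_gt.
have [[/andP[e0 e1] em] _ _ _] := pickP m (c_gt0 m).
have := rP (e_ m); rewrite /= sub0r normrN gtr0_norm// => /(_ (lt_trans em mr) e0).
have := hump_large m; have := G_gt0 (e_ m); lra.
Qed.

End gliding_hump.

(** * Series of characters *)

Section real_series.
Local Open Scope complex_scope.
Variable R : realType.

Lemma series_dominated (r a : R^nat) : (forall n, `|r n| <= a n) ->
  cvgn (series a) -> cvgn (series r) /\
  forall N, `|limn (series r) - series r N| <= limn (series a) - series a N.
Proof.
move=> ra ca.
have a0 n : 0 <= a n by exact: le_trans (ra n).
have cr : cvgn (series r).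
  by apply: normed_cvg; apply: series_le_cvg ca => // n /=.
split => // N.
have cN : cvgn (fun M => series r M - series r N).
  by apply: is_cvgB => //; exact: is_cvg_cst.
rewrite (_ : limn (series r) - _ = limn (fun M => series r M - series r N)); last first.
  by rewrite limB//; [rewrite lim_cst|exact: is_cvg_cst].
rewrite -lim_norm//; apply: limr_le; first exact: is_cvg_norm.
exists N => // M /= NM.
rewrite sub_series_geq// (le_trans (ler_norm_sum _ _ _))//.
apply: (@le_trans _ _ (series a M - series a N)).
  by rewrite sub_series_geq// ler_sum.
rewrite lerD2r; apply: nondecreasing_cvgn_le => //.
by apply: nondecreasing_series => n _ _.
Qed.

Lemma continuous_uniform_limit (d : nat) (f_ : nat -> 'rV[R]_d -> R) f (t : R^nat) :
  (forall n, continuous (f_ n)) -> (forall n x, `|f x - f_ n x| <= t n) ->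
  t n @[n --> \oo] --> (0 : R) -> continuous f.
Proof.
move=> cf ft t0; suff h (x : 'rV[R]_d) : f y @[y --> x] --> f x by exact: h.
have F := nbhs_filter x.
apply/(@cvgrPdist_lt _ _ _ _ F) => e e0.
have e3 : 0 < e / 3 by rewrite divr_gt0.
have /cvgrPdist_lt/(_ _ e3) [N _ /(_ N (leqnn N))] := t0.
rewrite sub0r normrN => tN.
have cfx : f_ N y @[y --> x] --> f_ N x := cf N x.
have /(@cvgrPdist_lt _ _ _ _ F)/(_ _ e3) := cfx.
apply: filterS => y fxy.
rewrite (_ : f x - f y = (f x - f_ N x) + (f_ N x - f_ N y) - (f y - f_ N y)); last by ring.
rewrite (le_lt_trans (ler_normB _ _))//.
have tN' : t N < e / 3 by rewrite (le_lt_trans (ler_norm _)).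
have := ler_normD (f x - f_ N x) (f_ N x - f_ N y).
have := ft N x; have := ft N y; lra.
Qed.

End real_series.

Lemma complex_Re_sum (R : realType) (I : Type) (s : seq I) (F : I -> R[i]) :
  complex.Re (\sum_(i <- s) F i) = \sum_(i <- s) complex.Re (F i).
Proof. by apply: (big_morph (@complex.Re R)) => [[? ?] [? ?]|]. Qed.

Lemma complex_Im_sum (R : realType) (I : Type) (s : seq I) (F : I -> R[i]) :
  complex.Im (\sum_(i <- s) F i) = \sum_(i <- s) complex.Im (F i).
Proof. by apply: (big_morph (@complex.Im R)) => [[? ?] [? ?]|]. Qed.

Lemma complex_ReB (R : realType) (x y : R[i]) :
  complex.Re (x - y) = complex.Re x - complex.Re y.
Proof. by case: x; case: y. Qed.

Lemma complex_ImB (R : realType) (x y : R[i]) :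
  complex.Im (x - y) = complex.Im x - complex.Im y.
Proof. by case: x; case: y. Qed.

Section character_series.
Local Open Scope complex_scope.
Variables (R : realType) (d : nat) (a : R^nat) (xi : nat -> 'rV[R]_d).
Hypotheses (a_ge0 : forall n, 0 <= a n) (a_cvg : cvgn (series a)).
Notation mu := (lebesgue_tuple R d).
Notation row := (@row_of_tuple R d).
Implicit Types (x : 'rV[R]_d) (u : 'rV[R]_d -> R[i]).

Definition charsum (N : nat) x : R[i] :=
  \sum_(0 <= n < N) (a n)%:C * expi (- dot x (xi n)).

Let rpart x n := a n * cos (- dot x (xi n)).
Let ipart x n := a n * sin (- dot x (xi n)).

Definition charseries x : R[i] :=
  limn (series (rpart x)) +i* limn (series (ipart x)).

Let Re_charsum N x : complex.Re (charsum N x) = series (rpart x) N.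
Proof.
rewrite /charsum complex_Re_sum; apply: eq_bigr => n _.
by rewrite complex_ReM /= mul0r subr0.
Qed.

Let Im_charsum N x : complex.Im (charsum N x) = series (ipart x) N.
Proof.
rewrite /charsum complex_Im_sum; apply: eq_bigr => n _.
by rewrite complex_ImM /= mul0r addr0.
Qed.

Let rpart_le x n : `|rpart x n| <= a n.
Proof.
by rewrite normrM (ger0_norm (a_ge0 _)) ler_piMr// ler_norml cos_geN1 cos_le1.
Qed.

Let ipart_le x n : `|ipart x n| <= a n.
Proof.
by rewrite normrM (ger0_norm (a_ge0 _)) ler_piMr// ler_norml sin_geN1 sin_le1.
Qed.

Let tail N := limn (series a) - series a N.

Let tail_cvg : tail N @[N --> \oo] --> (0 : R).
Proof.
rewrite -(subrr (limn (series a))); apply: cvgB => //; exact: cvg_cst.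
Qed.

Lemma ccontinuous_charsum N : ccontinuous (charsum N).
Proof.
split.
  under eq_fun do rewrite Re_charsum.
  apply: continuous_sum => n x.
  have [h _] := ccontinuous_modulation (xi n).
  exact: (cvgM (@cst_continuous _ _ (a n) x) (h x)).
under eq_fun do rewrite Im_charsum.
apply: continuous_sum => n x.
have [_ h] := ccontinuous_modulation (xi n).
exact: (cvgM (@cst_continuous _ _ (a n) x) (h x)).
Qed.

(** The distance of a partial sum to the limit is bounded uniformly in [x] by the
    tail of the coefficients, whence the continuity of the limit. *)
Lemma charsum_dist N x : cmod (charsum N x - charseries x) <= 2 * tail N.
Proof.
rewrite (le_trans (cmod_le _))// !raddfB /= Re_charsum Im_charsum.
have [_ hr] := series_dominated (rpart_le x) a_cvg.
have [_ hi] := series_dominated (ipart_le x) a_cvg.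
have := hr N; have := hi N; rewrite /tail distrC => h1; rewrite distrC => h2.
by rewrite mulr_natl mulr2n lerD.
Qed.

Lemma ccontinuous_charseries : ccontinuous charseries.
Proof.
split => /=.
  apply: (@continuous_uniform_limit R d (fun N x => series (rpart x) N) _ tail).
  - move=> N; have [h _] := ccontinuous_charsum N.
    by under eq_fun do rewrite -Re_charsum.
  - by move=> N x; have [_ hr] := series_dominated (rpart_le x) a_cvg.
  - exact: tail_cvg.
apply: (@continuous_uniform_limit R d (fun N x => series (ipart x) N) _ tail).
- move=> N; have [_ h] := ccontinuous_charsum N.
  by under eq_fun do rewrite -Im_charsum.
- by move=> N x; have [_ hr] := series_dominated (ipart_le x) a_cvg.
- exact: tail_cvg.
Qed.

Lemma cmod_charsum_le N x : cmod (charsum N x) <= limn (series a).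
Proof.
apply: (@le_trans _ _ (series a N)).
  rewrite /charsum /series/=; elim: N => [|N IH].
    by rewrite !big_geq// cmod0.
  rewrite !big_nat_recr//= (le_trans (le_cmodD _ _))// lerD//.
  by rewrite cmodM cmod_expi mulr1 cmod_real ger0_norm.
apply: nondecreasing_cvgn_le => //.
by apply: nondecreasing_series => n _ _.
Qed.

Lemma cmod_charseries_le x : cmod (charseries x) <= 2 * limn (series a).
Proof.
have := charsum_dist 0 x; rewrite /tail /charsum /series/= !big_geq//.
by rewrite sub0r cmodN subr0.
Qed.

Lemma cint_charsum_cvg u : test_function u ->
  cmod (cint mu (fun t => u (row t) * charsum N (row t)) -
        cint mu (fun t => u (row t) * charseries (row t))) @[N --> \oo] --> (0 : R).
Proof.
move=> tu; have [mu_ iu] := test_function_integrable tu.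
have A0 : 0 <= limn (series a) by have := cmod_charsum_le 0 0; apply: le_trans; exact: cmod_ge0.
apply: (@cint_dominated_cvg _ _ R mu _ _
    (fun t => (2 * limn (series a)) * cmod (u (row t)))).
- move=> N; apply: cmeasurableM => //.
  exact: (ccontinuous_cmeasurable (ccontinuous_charsum N)).
- apply: cmeasurableM => //.
  exact: (ccontinuous_cmeasurable ccontinuous_charseries).
- exact: (integrableZl measurableT _ iu).
- move=> N t; rewrite cmodM mulrC ler_wpM2r ?cmod_ge0//.
  by apply: le_trans (cmod_charsum_le N _) _; lra.
- by move=> t; rewrite cmodM mulrC ler_wpM2r ?cmod_ge0// cmod_charseries_le.
- move=> t.
  have h : 2 * tail N * cmod (u (row t)) @[N --> \oo] --> (0 : R).
    rewrite -(mul0r (cmod (u (row t)))) -[X in X * _](mulr0 2).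
    exact: (cvgM (cvgM (cvg_cst (2 : R)) tail_cvg) (cvg_cst (cmod (u (row t))))).
  apply: (squeeze_cvgr _ (cvg_cst 0) h); apply: nearW => N.
  rewrite cmod_ge0 -mulrBr cmodM mulrC ler_wpM2r ?cmod_ge0//.
  exact: charsum_dist.
Qed.

Lemma cint_charsum u N : test_function u ->
  cint mu (fun t => u (row t) * charsum N (row t)) =
  \sum_(0 <= n < N) (a n)%:C * fourier u (xi n).
Proof.
move=> tu; elim: N => [|N IH].
  rewrite big_geq//; transitivity (cint mu (fun=> (0 : R[i]))).
    by congr cint; apply/funext => t; rewrite /charsum big_geq// mulr0.
  by rewrite /cint /= integral0.
rewrite big_nat_recr//= -IH.
rewrite -[fourier u (xi N)]/(cint mu _).
have ti := test_function_fourier_integrable (xi N) tu.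
rewrite -(cintZl _ ti) -cintD.
- congr cint; apply/funext => t; rewrite /charsum big_nat_recr//= mulrDr.
  by congr (_ + _); rewrite mulrCA.
- exact: (test_function_integrable (test_functionM tu (ccontinuous_charsum N))).
- exact: cintegrableZl.
Qed.

(** The pairing with [u] of a series of characters is the series of the values of
    [fourier u]; it is stated by real and imaginary parts because the gliding
    hump is applied to each of them. *)
Lemma pairing_charseries u : test_function u ->
  complex.Re (cintegral_Rd (fun x => u x * charseries x)) =
    limn (series (fun n => a n * complex.Re (fourier u (xi n)))) /\
  complex.Im (cintegral_Rd (fun x => u x * charseries x)) =
    limn (series (fun n => a n * complex.Im (fourier u (xi n)))).
Proof.
move=> tu; set I := cintegral_Rd _.
have h : cmod (\sum_(0 <= n < N) (a n)%:C * fourier u (xi n) - I)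
    @[N --> \oo] --> (0 : R).
  under eq_fun do rewrite -cint_charsum//.
  exact: cint_charsum_cvg tu.
split; apply/esym/cvg_lim => //; apply/cvgrPdist_lt => e e0.
  have /cvgrPdist_lt/(_ _ e0) := h; apply: filterS => N.
  rewrite sub0r normrN (ger0_norm (cmod_ge0 _)); apply: le_lt_trans.
  rewrite distrC; apply: le_trans (normr_Re_le _); rewrite complex_ReB.
  rewrite complex_Re_sum le_eqVlt; apply/orP; left; apply/eqP.
  congr `|_ - _|; apply: eq_bigr => n _.
  by rewrite complex_ReM /= mul0r subr0.
have /cvgrPdist_lt/(_ _ e0) := h; apply: filterS => N.
rewrite sub0r normrN (ger0_norm (cmod_ge0 _)); apply: le_lt_trans.
rewrite distrC; apply: le_trans (normr_Im_le _); rewrite complex_ImB.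
rewrite complex_Im_sum le_eqVlt; apply/orP; left; apply/eqP.
congr `|_ - _|; apply: eq_bigr => n _.
by rewrite complex_ImM /= mul0r addr0.
Qed.

End character_series.

Section weighted_character_series.
Local Open Scope complex_scope.
Variables (R : realType) (d : nat) (w : R -> R).
Hypothesis ww : weight_class w.
Variables (a : R^nat) (xi : nat -> 'rV[R]_d) (l : R) (psi : 'rV[R]_d -> R[i]).
Hypotheses (a_ge0 : forall n, 0 <= a n) (l_ge0 : 0 <= l).
Hypothesis a_cvg : cvgn (series a).
Hypothesis aw_cvg : cvgn (series (fun n => a n * wexp w l (xi n))).
Hypothesis tpsi : test_function psi.
Hypothesis wpsi : (wnorm w l psi < +oo)%E.
Notation mu := (lebesgue_tuple R d).
Notation row := (@row_of_tuple R d).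

Let S := limn (series (fun n => a n * wexp w l (xi n))).

Let wnorm_charsum N : (wnorm w l (fun x => psi x * charsum a xi N x)%R <=
  (series (fun n => a n * wexp w l (xi n)) N)%:E * wnorm w l psi)%E.
Proof.
have Wfin : wnorm w l psi \is a fin_num by rewrite ge0_fin_numE// wnorm_ge0.
elim: N => [|N IH].
  rewrite /series/= big_geq// mul0e le_eqVlt; apply/orP; left; apply/eqP.
  apply: integral0_eq => t _.
  rewrite (_ : fourier _ _ = 0) ?cmod0 ?mul0r//.
  rewrite -[LHS]/(cint mu _).
  transitivity (cint mu (fun=> (0 : R[i]))).
    by congr cint; apply/funext => s; rewrite /= /charsum big_geq// mulr0 mul0r.
  by rewrite /cint /= integral0.
rewrite (_ : (fun x => _) = (fun x => psi x * charsum a xi N x +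
    (a N)%:C * (psi x * expi (- dot x (xi N))))); last first.
  apply/funext => x; rewrite /charsum big_nat_recr//= mulrDr.
  by congr (_ + _); rewrite mulrCA.
have aE : cmod (a N)%:C = a N by rewrite cmod_real ger0_norm.
apply: le_trans (wnormD_le ww _ l_ge0 _ _) _.
- exact: test_functionM tpsi (ccontinuous_charsum a xi N).
- exact: test_functionM tpsi (ccontinuous_modulation (xi N)).
have -> : series (fun n => a n * wexp w l (xi n)) N.+1 =
    series (fun n => a n * wexp w l (xi n)) N + a N * wexp w l (xi N).
  by rewrite /series /= big_nat_recr.
rewrite aE EFinD muleDl//; apply: leeD; first exact: IH.
rewrite EFinM -muleA; apply: lee_wpmul2l; first by rewrite lee_fin.
exact: wnorm_modulation.
Qed.

(** The partial sums have norms bounded by the weighted sum of the coefficients,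
    and their transforms converge pointwise: conclude by Fatou's lemma. *)
Lemma wnorm_charseries_lty :
  (wnorm w l (fun x => psi x * charseries a xi x)%R < +oo)%E.
Proof.
have Wfin : wnorm w l psi \is a fin_num by rewrite ge0_fin_numE// wnorm_ge0.
pose F N t : \bar R := (cmod (fourier (fun x => psi x * charsum a xi N x) (row t)) *
  wexp w l (row t))%:E.
have tN N := test_functionM tpsi (ccontinuous_charsum a xi N).
have F0 N t : (0 <= F N t)%E by rewrite lee_fin mulr_ge0 ?cmod_ge0// ltW// wexp_gt0.
have mF N : measurable_fun setT (F N).
  exact: (measurable_wnorm_integrand ww l (tN N).1).
have Fcvg t : F N t @[N --> \oo] -->
    (cmod (fourier (fun x => psi x * charseries a xi x) (row t)) * wexp w l (row t))%:E.
  apply: cvg_EFin; first exact: nearW.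
  have h := cint_charsum_cvg xi a_ge0 a_cvg
    (test_functionM tpsi (ccontinuous_modulation (row t))).
  apply: (@cvgM _ _ _ _ (fun N => cmod (fourier (fun x => psi x * charsum a xi N x) (row t)))
    (fun=> wexp w l (row t))); last exact: cvg_cst.
  apply/cvgrPdist_lt => e e0.
  have /cvgrPdist_lt/(_ _ e0) := h; apply: filterS => N.
  rewrite sub0r normrN (ger0_norm (cmod_ge0 _)); apply: le_lt_trans.
  have swap (f : 'rV[R]_d -> R[i]) : fourier (fun x => psi x * f x) (row t) =
      cint mu (fun s => psi (row s) * expi (- dot (row s) (row t)) * f (row s)).
    by congr cint; apply/funext => s; rewrite mulrAC.
  rewrite !swap distrC; set A := cint _ _; set B := cint _ _.
  rewrite ler_norml; apply/andP; split.
    rewrite lerNl opprB lerBlDr -(cmodN (A - B)) opprB.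
    by rewrite -[in leLHS](subrK A B) le_cmodD.
  by rewrite lerBlDr -[in leLHS](subrK B A) le_cmodD.
apply: (@le_lt_trans _ _ (S%:E * wnorm w l psi)%E); last first.
  by rewrite -(fineK Wfin) -EFinM ltry.
rewrite wnormE [leLHS](_ : _ = \int[mu]_t limn_einf (F ^~ t))%E; last first.
  by apply: eq_integral => t _; rewrite (cvg_limn_einf_sup (Fcvg t)).1.
apply: le_trans (fatou mu measurableT mF (fun N t _ => F0 N t)) _.
rewrite limn_einf_lim; apply: lime_le; first exact: is_cvg_einfs.
apply: nearW => N; apply: le_trans (_ : (\int[mu]_t F N t <= _)%E).
  apply: ereal_inf_lbound; exists N => //=.
apply: le_trans (wnorm_charsum N) _; apply: lee_wpmul2r; first exact: wnorm_ge0.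
rewrite lee_fin; apply: nondecreasing_cvgn_le => //.
by apply: nondecreasing_series => n _ _; rewrite mulr_ge0// ltW// wexp_gt0.
Qed.

End weighted_character_series.

(** * Spaces of test functions *)

Section smoothness.
Local Open Scope complex_scope.
Variables (R : realType) (d : nat) (Omega : set 'rV[R]_d).
Hypothesis Omega_open : open Omega.

Let near_Omega x : Omega x -> \forall y \near x, Omega y.
Proof. by move=> Ox; exact: open_nbhs_nbhs. Qed.

(** A partial derivative at a point depends on the germ only, and [Omega] is open. *)
Lemma iter_partialB (u v : 'rV[R]_d -> R) : smooth_on Omega u ->
  smooth_on Omega v -> forall s x, Omega x ->
  iter_partial s (fun y => u y - v y) x = iter_partial s u x - iter_partial s v x.
Proof.
move=> su sv; elim=> [//|i s IH] x Ox /=.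
rewrite (near_eq_derive (g := iter_partial s u - iter_partial s v)) //; last first.
  by apply: filterS (near_Omega Ox) => y Oy; exact: IH.
by rewrite deriveB//; [exact: (su s x Ox).2|exact: (sv s x Ox).2].
Qed.

Lemma smooth_onB (u v : 'rV[R]_d -> R) : smooth_on Omega u ->
  smooth_on Omega v -> smooth_on Omega (fun y => u y - v y).
Proof.
move=> su sv s x Ox.
have nearE : \forall y \near x, iter_partial s (fun y => u y - v y) y =
    (iter_partial s u - iter_partial s v) y.
  by apply: filterS (near_Omega Ox) => y Oy; exact: iter_partialB.
have [cu du] := su s x Ox; have [cv dv] := sv s x Ox.
split.
  have F := nbhs_filter x.
  suff : iter_partial s (fun y => u y - v y) y @[y --> x] -->
      iter_partial s u x - iter_partial s v x.
    by rewrite -(iter_partialB su sv s Ox).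
  apply: cvg_trans (cvgB cu cv); apply: near_eq_cvg.
  by apply: filterS nearE => y ->.
move=> i; apply: (near_eq_derivable _ (derivableB (du i) (dv i))).
by apply: filterS nearE => y ->.
Qed.

Lemma csmooth_onB (f g : 'rV[R]_d -> R[i]) : csmooth_on Omega f ->
  csmooth_on Omega g -> csmooth_on Omega (fun x => f x - g x).
Proof.
move=> [rf jf] [rg jg]; split.
  rewrite (_ : (fun _ => _) = fun x => complex.Re (f x) - complex.Re (g x)).
    exact: smooth_onB.
  by apply/funext => x; rewrite complex_ReB.
rewrite (_ : (fun _ => _) = fun x => complex.Im (f x) - complex.Im (g x)).
  exact: smooth_onB.
by apply/funext => x; rewrite complex_ImB.
Qed.

End smoothness.

Section weighted_spaces.
Local Open Scope complex_scope.
Variables (R : realType) (d : nat) (w : R -> R) (Omega : set 'rV[R]_d).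
Hypothesis (ww : weight_class w) (Omega_open : open Omega).
Implicit Types (K : set 'rV[R]_d) (f g psi rho : 'rV[R]_d -> R[i]) (l : R).

Lemma D_test_function f : D_space w Omega f -> test_function f.
Proof. by case. Qed.

Lemma D_lincomb f g (z : R[i]) : D_space w Omega f -> D_space w Omega g ->
  D_space w Omega (fun x => f x + z * g x).
Proof.
move=> [cf kf sf wf] [cg kg sg wg].
have cz : ccontinuous (fun _ : 'rV[R]_d => z).
  by split; exact: cst_continuous.
have [ch1 ch2] := ccontinuousM cz cg.
have sub : csupport (fun x => f x + z * g x) `<=` csupport f `|` csupport g.
  rewrite -closureU; apply: closureS => x /=.
  by have [->|] := eqVneq (f x) 0; [right; apply: contra H => /eqP ->; rewrite mulr0 addr0|left].
have compU : compact (csupport f `|` csupport g) by exact: compactU.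
split.
- split => x.
    rewrite (_ : (fun x => _) = fun x => complex.Re (f x) + complex.Re (z * g x)).
      exact: (cvgD (cf.1 x) (ch1 x)).
    by apply/funext => y; rewrite raddfD.
  rewrite (_ : (fun x => _) = fun x => complex.Im (f x) + complex.Im (z * g x)).
    exact: (cvgD (cf.2 x) (ch2 x)).
  by apply/funext => y; rewrite raddfD.
- by apply: (subclosed_compact _ compU) => //; exact: closed_closure.
- by apply: subset_trans sub _; rewrite subUset.
- move=> l l0; apply: le_lt_trans (wnormD_le ww z (ltW l0) (conj cf kf) (conj cg kg)) _.
  have fg := wg l l0; have ff := wf l l0.
  have Gfin : wnorm w l g \is a fin_num by rewrite ge0_fin_numE// wnorm_ge0.
  by rewrite lte_add_pinfty// -(fineK Gfin) -EFinM ltry.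
Qed.

Lemma D_modulation psi zeta : D_space w Omega psi ->
  D_space w Omega (fun x => psi x * expi (- dot x zeta)).
Proof.
move=> [cf kf sf wf].
have [cm km] := test_functionM (conj cf kf) (ccontinuous_modulation zeta).
split; [exact: cm|exact: km|exact: subset_trans (@csupportM _ _ _ _) sf|].
move=> l l0; apply: le_lt_trans (wnorm_modulation ww zeta (ltW l0) (conj cf kf)) _.
have ff := wf l l0.
have Gfin : wnorm w l psi \is a fin_num by rewrite ge0_fin_numE// wnorm_ge0.
by rewrite -(fineK Gfin) -EFinM ltry.
Qed.

Lemma D_charseries psi (a : R^nat) (xi : nat -> 'rV[R]_d) :
  D_space w Omega psi -> (forall n, 0 <= a n) ->
  (forall h, cvgn (series (fun n => a n * expR (h * w (enorm (xi n)))))) ->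
  cvgn (series a) ->
  D_space w Omega (fun x => psi x * charseries a xi x).
Proof.
move=> Dpsi a0 ha ca; have [cf kf sf wf] := Dpsi.
have [cm km] := test_functionM (conj cf kf) (ccontinuous_charseries xi a0 ca).
split; [exact: cm|exact: km|exact: subset_trans (@csupportM _ _ _ _) sf|].
move=> l l0.
exact: (wnorm_charseries_lty ww a0 (ltW l0) ca (ha l) (conj cf kf) (wf l l0)).
Qed.

Lemma E_spaceB f g : E_space w Omega f -> E_space w Omega g ->
  E_space w Omega (fun x => f x - g x).
Proof.
move=> [sf Df] [sg Dg]; split; first exact: csmooth_onB.
move=> psi Dpsi.
rewrite (_ : (fun x => _) = fun x => psi x * f x + (-1) * (psi x * g x)).
  by apply: D_lincomb; [exact: Df|exact: Dg].
by apply/funext => x; ring.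
Qed.

Lemma wnorm_on_ge0 K l f : (0 <= wnorm_on w Omega K l f)%E.
Proof. by apply: le_ereal_inf_tmp => _ [psi _ <-]; exact: wnorm_ge0. Qed.

Lemma wnorm_on_le K l f psi : D_space w Omega psi ->
  (forall x, K x -> psi x = 1) ->
  (wnorm_on w Omega K l f <= wnorm w l (fun x => psi x * f x)%R)%E.
Proof. by move=> Dpsi psi1; apply: ereal_inf_lbound; exists psi. Qed.

Lemma cutoff_absorb psi psi' f : (forall x, csupport psi x -> psi' x = 1) ->
  (fun x => psi x * f x) = (fun x => psi x * (psi' x * f x)).
Proof.
move=> psi'1; apply/funext => x.
have [/psi'1 ->|/csupport_out ->] := pselect (csupport psi x).
  by rewrite mul1r.
by rewrite !mul0r.
Qed.

(** This bounds the norm after a fixed cutoff by the infimum over all cutoffs: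
    any [psi'] equal to 1 on the support of [psi] is absorbed by [psi]. *)
Lemma wnorm_cutoff_le psi l : D_space w Omega psi -> 0 < l ->
  exists2 a : R, 0 < a & forall f, E_space w Omega f ->
    (wnorm w l (fun x => psi x * f x)%R <=
     a%:E * wnorm_on w Omega (csupport psi) l f)%E.
Proof.
move=> Dpsi l0; have [cf kf sf wf] := Dpsi.
have Wfin : wnorm w l psi \is a fin_num.
  by rewrite ge0_fin_numE ?wnorm_ge0//; exact: wf.
have W0 : 0 <= fine (wnorm w l psi) by rewrite fine_ge0// wnorm_ge0.
have c0 : 0 <= 2 / inversion_cst R d.
  by rewrite divr_ge0// ltW// inversion_cst_gt0.
(* The 1 makes a positive, so that one can divide by it under the infimum. *)
pose a := 2 / inversion_cst R d * fine (wnorm w l psi) + 1.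
have a0 : 0 < a by rewrite ltr_wpDl// mulr_ge0.
exists a => // f [_ Df].
rewrite -lee_pdivrMl//; apply: le_ereal_inf_tmp => _ [psi' [Dpsi' psi'1] <-].
rewrite lee_pdivrMl// (cutoff_absorb f psi'1).
have Dpf := Df _ Dpsi'.
apply: le_trans (wnormM_le ww (ltW l0) (D_test_function Dpsi)
  (D_test_function Dpf) (wf l l0)) _.
rewrite muleA; apply: lee_wpmul2r; first exact: wnorm_ge0.
by rewrite -(fineK Wfin) -EFinM lee_fin lerDl.
Qed.

End weighted_spaces.

(** * Growth of the weight and interpolation *)

Section weight_growth.
Local Open Scope complex_scope.
Variables (R : realType) (d : nat) (w : R -> R).
Hypothesis ww : weight_class w.
Notation mu := (lebesgue_tuple R d).
Notation row := (@row_of_tuple R d).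

Lemma growth_gt0 (k e : R) : 0 < growth w k e. Proof. exact: expR_gt0. Qed.

(** Beyond some point [w] dominates the logarithm; the constant absorbs the
    bounded interval before it. *)
Lemma weight_ge_log : exists2 B : R, 0 <= B &
  forall t, 0 <= t -> ln (1 + t) - B <= w t.
Proof.
have [T [_ hT]] := (cvgryPge _).1 (weight_log ww) 1.
(* Below T' the logarithm is at most ln (1 + T'), beyond it is at most w. *)
pose T' := Num.max T 0; have T'0 : 0 <= T' by rewrite le_max lexx orbT.
exists (ln (1 + T')); first by rewrite ln_ge0// lerDl.
move=> t t0; have [tT|Tt] := leP t T'.
  apply: (@le_trans _ _ 0); last exact: (weight_ge0 ww).
  by rewrite subr_le0 ler_ln ?posrE ?ltr_pwDl// lerD2l.
have tp : 0 < t by exact: le_lt_trans Tt.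
have Tt' : T < t by apply: le_lt_trans Tt; rewrite le_max lexx.
have := hT t Tt'; rewrite ler_pdivlMr ?mul1r; last by rewrite ln_gt0// ltrDl.
by apply: le_trans; rewrite lerBlDr lerDl ln_ge0// lerDl.
Qed.

Lemma growth_small (k c : R) : 0 < k -> 0 < c ->
  \forall e \near 0^'+, growth w (- k) e <= c.
Proof.
move=> k0 c0; have [B B0 hB] := weight_ge_log.
pose A := B + `|ln c| / k.
have A0 : 0 <= A by rewrite addr_ge0// divr_ge0// ltW.
near=> e.
have e0 : 0 < e by near: e; exact: nbhs_right_gt.
have eA : e < expR (- A) by near: e; apply: nbhs_right_lt; exact: expR_gt0.
have We : `|ln c| / k <= w e^-1.
  apply: le_trans (hB _ _); last by rewrite invr_ge0 ltW.
  rewrite lerBrDr addrC -/A -[leLHS]expRK ler_ln ?posrE ?expR_gt0//; last first.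
    by rewrite ltr_pwDl// invr_ge0 ltW.
  rewrite (@le_trans _ _ e^-1)//; last by rewrite lerDr.
  by rewrite -[leLHS]invrK -expRN lef_pV2 ?posrE ?expR_gt0// ltW.
rewrite /growth -[leRHS]lnK ?posrE// ler_expR mulNr lerNl.
apply: le_trans (_ : `|ln c| <= _); first by rewrite -normrN ler_norm.
by rewrite mulrC -ler_pdivrMr.
Unshelve. all: by end_near. Qed.

(** With [a = 2 d], [expR (- a * w t)] is at most a constant times
    [(1 + t) ^- (2 * d)], and [(1 + enorm x) ^+ 2] dominates each
    [1 + x ord0 i ^+ 2]. *)
Lemma wexp_integrable : exists a I : R, [/\ 0 <= a, 0 <= I &
  (integral_Rd (fun xi : 'rV[R]_d => (wexp w (- a) xi)%:E) <= I%:E)%E].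
Proof.
have [B B0 hB] := weight_ge_log.
pose a : R := 2 * d%:R; pose C := expR (a * B).
exists a, (C * inversion_cst R d); split.
- by rewrite mulr_ge0.
- by rewrite mulr_ge0 ?expR_ge0// ltW// inversion_cst_gt0.
rewrite EFinM -integral_poisson_row -ge0_integralZl//; last 3 first.
- by have /integrableP[] := integrable_poisson_row R d.
- by move=> t _; rewrite lee_fin ltW// poisson_row_gt0.
- by rewrite lee_fin expR_ge0.
apply: ge0_le_integral => //.
- by move=> t _; rewrite lee_fin ltW// wexp_gt0.
- by apply/measurable_EFinP; exact: (measurable_wexp ww).
- apply: emeasurable_funM; first exact: measurable_cst.
  by have /integrableP[] := integrable_poisson_row R d.
move=> t _; rewrite -EFinM lee_fin; set x := row t.
have n0 := enorm_ge0 x; have N0 : 0 < 1 + enorm x by rewrite ltr_pwDl.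
apply: (@le_trans _ _ (C * ((1 + enorm x) ^- 2) ^+ d)); last first.
  rewrite ler_wpM2l ?expR_ge0// -[X in _ ^+ X](card_ord d) -prodr_const.
  apply: ler_prod => i _; rewrite invr_ge0 exprn_ge0 ?(ltW N0)//=.
  have xi2 : x ord0 i ^+ 2 <= enorm x ^+ 2.
    by rewrite -[leLHS]real_normK ?num_real// ler_pXn2r ?nnegrE// normr_coord_le.
  have D1 : 0 < 1 + x ord0 i ^+ 2 by rewrite ltr_pwDl// sqr_ge0.
  apply: (@le_trans _ _ (1 + x ord0 i ^+ 2)^-1).
    rewrite lef_pV2 ?posrE ?exprn_gt0//.
    rewrite (_ : (1 + enorm x) ^+ 2 = 1 + 2 * enorm x + enorm x ^+ 2); last by ring.
    lra.
  have h12 : 1 <= 2 :> R by lra.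
  by rewrite /poisson; apply: ler_peMl => //; rewrite invr_ge0 ltW.
have -> : C * ((1 + enorm x) ^- 2) ^+ d = expR (a * B - a * ln (1 + enorm x)).
  rewrite expRD; congr (_ * _).
  by rewrite -exprVn -exprM -[(1 + enorm x)^-1]lnK ?posrE ?invr_gt0// -expRM_natl lnV ?posrE// /a natrM; congr expR; ring.
rewrite ler_expR -mulrBr mulNr -mulrN ler_wpM2l ?mulr_ge0//.
by have := hB _ n0; lra.
Qed.

(** Pointwise, the square of [x * y], with [x] the modulus of the transform and [y]
    the weight of order [h], is at most [A] times the product of the weighted
    transform of order [2 * h + l' + a] and of the integrable weight; bound the
    square root of that product by the sum of its factors. *)
Lemma wnorm_interpolation (u : 'rV[R]_d -> R[i]) (A l' h a I : R) :
  test_function u -> 0 <= A -> 0 <= l' -> 0 <= h -> 0 <= a -> 0 <= I ->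
  (forall xi, cmod (fourier u xi) <= A * wexp w l' xi) ->
  (integral_Rd (fun xi : 'rV[R]_d => (wexp w (- a) xi)%:E) <= I%:E)%E ->
  (wnorm w h u <= (Num.sqrt A)%:E * (wnorm w (2 * h + l' + a) u + I%:E))%E.
Proof.
move=> tu A0 l0 h0 a0 I0 uA aI; set H := 2 * h + l' + a.
have mwa : measurable_fun setT (fun t => (wexp w (- a) (row t))%:E).
  by apply/measurable_EFinP; exact: (measurable_wexp ww).
have mH := measurable_wnorm_integrand ww H tu.1.
apply: (@le_trans _ _ ((Num.sqrt A)%:E * (wnorm w H u +
    integral_Rd (fun xi : 'rV[R]_d => (wexp w (- a) xi)%:E)))%E); last first.
  by rewrite lee_wpmul2l ?lee_fin ?sqrtr_ge0// leeD2l.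
rewrite -ge0_integralD//; last 2 first.
- by move=> t _; rewrite lee_fin mulr_ge0 ?cmod_ge0// ltW// wexp_gt0.
- by move=> t _; rewrite lee_fin ltW// wexp_gt0.
rewrite -ge0_integralZl//; last 2 first.
- exact: (emeasurable_funD mH mwa).
- move=> t _; rewrite -EFinD lee_fin addr_ge0 ?mulr_ge0 ?cmod_ge0// ltW//; exact: wexp_gt0.
apply: ge0_le_integral.
- exact: measurableT.
- by move=> t _; rewrite lee_fin mulr_ge0 ?cmod_ge0// ltW// wexp_gt0.
- exact: (measurable_wnorm_integrand ww h tu.1).
- by apply: emeasurable_funM; [exact: measurable_cst|exact: (emeasurable_funD mH mwa)].
move=> t _; rewrite -EFinD -EFinM lee_fin.
set x := cmod (fourier u (row t)).
have x0 : 0 <= x by exact: cmod_ge0.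
have wl : wexp w h (row t) * wexp w h (row t) * wexp w l' (row t) =
    wexp w H (row t) * wexp w (- a) (row t).
  by rewrite /wexp -!expRD; congr expR; rewrite /H; ring.
set p := wexp w H (row t) in wl *; set q := wexp w (- a) (row t) in wl *.
have p0 : 0 < p by exact: wexp_gt0.
have q0 : 0 < q by exact: wexp_gt0.
set y := wexp w h (row t) in wl *; have y0 : 0 < y by exact: wexp_gt0.
set z := wexp w l' (row t) in wl; have z0 : 0 < z by exact: wexp_gt0.
have xz : x <= A * z by exact: uA.
have s0 : 0 <= x * p + q by rewrite addr_ge0 ?mulr_ge0// ltW.
rewrite -(@ler_pXn2r _ 2%N) ?nnegrE ?mulr_ge0 ?sqrtr_ge0// ?(ltW y0)//.
rewrite [leRHS]exprMn sqr_sqrtr//.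
apply: (@le_trans _ _ (A * (x * p * q))).
  rewrite -mulrA -wl (_ : (x * y) ^+ 2 = x * (x * (y * y))); last by ring.
  rewrite (_ : A * _ = x * (A * z * (y * y))); last by ring.
  by rewrite !ler_wpM2l// ler_wpM2r// mulr_ge0// ltW.
rewrite ler_wpM2l//.
have xp : 0 <= x * p by rewrite mulr_ge0// ltW.
have -> : (x * p + q) ^+ 2 = x * p * q + (x * p * q + (x * p) ^+ 2 + q ^+ 2) by ring.
by rewrite lerDl !addr_ge0 ?sqr_ge0// mulr_ge0// ltW.
Qed.

End weight_growth.

(** * Negligible nets *)

Lemma near_unit (R : realType) : \forall e \near (0 : R)^'+, 0 < e < 1.
Proof.
near=> e; apply/andP; split; near: e; [exact: nbhs_right_gt|exact: nbhs_right_lt].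
Unshelve. all: by end_near. Qed.

Section nets.
Local Open Scope complex_scope.
Variables (R : realType) (d : nat) (w : R -> R) (Omega : set 'rV[R]_d).
Hypothesis (ww : weight_class w) (Omega_open : open Omega).
Notation mu := (lebesgue_tuple R d).
Notation row := (@row_of_tuple R d).
Implicit Types (K : set 'rV[R]_d) (f psi rho : 'rV[R]_d -> R[i]) (l : R).
Implicit Types (g n : net R d).

Lemma littleo_growthE (u : R -> \bar R) (k : R) : (forall e, (0 <= u e)%E) ->
  ereal_littleo u (growth w k) <->
  forall c : R, 0 < c -> \forall e \near 0^'+, (u e <= (c * growth w k e)%:E)%E.
Proof.
move=> u0; split => h c c0; have := h c c0; apply: filterS => e;
  by rewrite (gee0_abs (u0 e)) (ger0_norm (ltW (growth_gt0 _ _ _))).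
Qed.

Lemma littleo_bound (u v : R -> \bar R) (k a : R) : 0 < a ->
  (forall e, (0 <= u e)%E) -> (forall e, (0 <= v e)%E) ->
  (\forall e \near 0^'+, u e <= a%:E * v e)%E ->
  ereal_littleo v (growth w k) -> ereal_littleo u (growth w k).
Proof.
move=> a0 u0 v0 uv /(littleo_growthE _ v0) hv; apply/littleo_growthE => // c c0.
have := hv (c / a) (divr_gt0 c0 a0); apply: filterS2 uv => e h1 h2.
apply: le_trans h1 _; rewrite (_ : c = a * (c / a)); last by field; rewrite gt_eqF.
by rewrite -mulrA EFinM lee_wpmul2l// lee_fin ltW.
Qed.

(** Otherwise the seminorms on [K] would be infima over the empty set. *)
Lemma moderate_cutoff g K : moderate w Omega g -> compact K -> K `<=` Omega ->
  exists2 psi, D_space w Omega psi & forall x, K x -> psi x = 1.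
Proof.
move=> [_ modg] cK sK; have [k k0 hk] := modg K cK sK 1 ltr01.
apply: contrapT => no.
have infty e : wnorm_on w Omega K 1 (g e) = +oo%E.
  rewrite /wnorm_on (_ : image _ _ = set0) ?ereal_inf0//.
  apply/seteqP; split => // x [psi [Dpsi psi1] _]; apply: no.
  by exists psi.
have := @filter_ex _ _ (at_right_proper_filter (0 : R)) _ (hk 1 ltr01).
case=> e.
by rewrite infty.
Qed.

Section cutoffs.
Local Open Scope complex_scope.
Hypothesis cutoff : forall K, compact K -> K `<=` Omega ->
  exists2 psi, D_space w Omega psi & forall x, K x -> psi x = 1.

(** Two nets come with different cutoffs, depending on [e]; both are replaced by
    one fixed cutoff by means of [wnorm_cutoff_le]. *)
Lemma negligible_lincomb n1 n2 n3 (z : R[i]) : negligible_net w Omega n1 ->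
  negligible_net w Omega n2 -> E_net w Omega n3 ->
  (forall e x, n3 e x = n1 e x + z * n2 e x) -> negligible_net w Omega n3.
Proof.
move=> [E1 N1] [E2 N2] E3 n3E; split; first exact: E3.
move=> K cK sK h h0 k k0.
have [psi Dpsi psi1] := cutoff cK sK.
have [a a0 ha] := wnorm_cutoff_le ww Dpsi h0.
have [_ kpsi spsi _] := Dpsi.
pose b := 1 + cmod z; have b0 : 0 < b by rewrite ltr_pwDl// cmod_ge0.
have /littleo_growthE h1 := N1 _ kpsi spsi h h0 k k0.
have /littleo_growthE h2 := N2 _ kpsi spsi h h0 k k0.
have {}h1 := h1 (fun e => wnorm_on_ge0 _ _ _ _ _).
have {}h2 := h2 (fun e => wnorm_on_ge0 _ _ _ _ _).
apply/littleo_growthE => [e|c c0]; first exact: wnorm_on_ge0.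
have c'0 : 0 < c / (a * b) by rewrite divr_gt0// mulr_gt0.
apply: filterS3 (near_unit R) (h1 _ c'0) (h2 _ c'0) => e e01 le1 le2.
have G0 := growth_gt0 w (- k) e.
apply: le_trans (wnorm_on_le _ _ Dpsi psi1) _.
rewrite (_ : (fun x => _) = fun x => psi x * n1 e x + z * (psi x * n2 e x)); last first.
  by apply/funext => x; rewrite n3E; ring.
have D1 := (E1 e e01).2 _ Dpsi; have D2 := (E2 e e01).2 _ Dpsi.
apply: le_trans (wnormD_le ww z (ltW h0) (D_test_function D1) (D_test_function D2)) _.
pose q := (a * (c / (a * b) * growth w (- k) e)).
have q1 : (wnorm w h (fun x => psi x * n1 e x)%R <= q%:E)%E.
  apply: le_trans (ha _ (E1 e e01)) _.
  rewrite /q EFinM; apply: lee_wpmul2l; last exact: le1.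
  by rewrite lee_fin; exact: ltW.
have q2 : (wnorm w h (fun x => psi x * n2 e x)%R <= q%:E)%E.
  apply: le_trans (ha _ (E2 e e01)) _.
  rewrite /q EFinM; apply: lee_wpmul2l; last exact: le2.
  by rewrite lee_fin; exact: ltW.
apply: (@le_trans _ _ (q%:E + (cmod z)%:E * q%:E)%E).
  apply: leeD; first exact: q1.
  by apply: lee_wpmul2l; [rewrite lee_fin cmod_ge0|exact: q2].
rewrite -EFinM -EFinD lee_fin le_eqVlt; apply/orP; left; apply/eqP.
by rewrite /q /b; field; rewrite !gt_eqF.
Qed.

Lemma pairing_absorb f psi rho : (forall x, csupport rho x -> psi x = 1) ->
  pairing f rho = pairing (fun x => psi x * f x) rho.
Proof.
move=> psi1; congr cintegral_Rd; apply/funext => x.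
have [/psi1 ->|/csupport_out ->] := pselect (csupport rho x).
  by rewrite mul1r.
by rewrite !mulr0.
Qed.

Lemma pairing_fourier f rho : pairing f rho = fourier (fun x => f x * rho x) 0.
Proof.
congr cintegral_Rd; apply/funext => x.
by rewrite -[0 : 'rV_d](scale0r (0 : 'rV[R]_d)) dotZr mul0r oppr0 expi0 mulr1.
Qed.

(** The pairing is the transform at 0 of the product of [rho] and the cut off net;
    by the convolution formula it is bounded by the norm of order 1 of the
    latter. *)
Lemma negligible_pairing n rho : negligible_net w Omega n ->
  D_space w Omega rho -> negligible_numbers w (fun e => pairing (n e) rho).
Proof.
move=> [En Nn] Drho k k0; have [crho krho srho wrho] := Drho.
have trho := D_test_function Drho.
pose A := fine (integral_Rd (fun x => (cmod (rho x))%:E)).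
have A0 : 0 <= A.
  by apply: fine_ge0; apply: integral_ge0 => t _; rewrite lee_fin cmod_ge0.
have c0 := inversion_cst_gt0 R d.
pose a := 2 / inversion_cst R d * (2 * A) + 1.
have a0 : 0 < a by rewrite ltr_wpDl// !mulr_ge0// invr_ge0 ltW.
apply: (@littleo_bound _ (fun e => wnorm_on w Omega (csupport rho) 1 (n e)) _ a a0).
- by move=> e; rewrite lee_fin cmod_ge0.
- by move=> e; exact: wnorm_on_ge0.
- apply: filterS (near_unit R) => e e01.
  rewrite -lee_pdivrMl//; apply: le_ereal_inf_tmp => _ [psi [Dpsi psi1] <-].
  rewrite lee_pdivrMl// (pairing_absorb (n e) psi1) pairing_fourier.
  have Du := (En e e01).2 _ Dpsi; have tu := D_test_function Du.
  have wu : (wnorm w 1 (fun x => psi x * n e x)%R < +oo)%E.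
    by have [_ _ _] := Du; apply.
  have iu := fourier_integrable ww ler01 tu.1 wu.
  apply: le_trans (cmod_fourierM_le 0 tu trho iu) _.
  apply: (@le_trans _ _ ((2 / inversion_cst R d)%:E *
      ((2 * A)%:E * wnorm w 1 (fun x => psi x * n e x)%R))%E); last first.
    rewrite muleA -EFinM; apply: lee_wpmul2r; first exact: wnorm_ge0.
    by rewrite lee_fin lerDl.
  apply: lee_wpmul2l; first by rewrite lee_fin mulr_ge0// invr_ge0 ltW.
  rewrite wnormE -ge0_integralZl; last 4 first.
  - exact: measurableT.
  - exact: (measurable_wnorm_integrand ww 1 tu.1).
  - by move=> t _; rewrite lee_fin mulr_ge0 ?cmod_ge0// ltW// wexp_gt0.
  - by rewrite lee_fin mulr_ge0.
  apply: ge0_le_integral.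
  - exact: measurableT.
  - by move=> t _; rewrite lee_fin mulr_ge0 ?cmod_ge0.
  - have mf := cmeasurable_fourier (ccontinuous_cmeasurable tu.1).
    have mr := measurable_cmod (cmeasurable_fourier (ccontinuous_cmeasurable crho)).
    have mrs := measurableT_comp (measurable_row_sub
      (h := fun x => cmod (fourier rho x)) mr) (pair1_measurable (tuple_of_row 0)).
    apply/measurable_EFinP; apply: measurable_funM; first exact: measurable_cmod.
    apply: eq_measurable_fun mrs => t _.
    by rewrite /comp /= tuple_of_rowK.
  - apply: emeasurable_funM; first exact: measurable_cst.
    exact: (measurable_wnorm_integrand ww 1 tu.1).
  - move=> t _; rewrite -EFinM lee_fin; set F := cmod (fourier _ (row t)).
    have r : cmod (fourier rho (0 - row t)) <= 2 * A.
      rewrite -lee_fin EFinM fineK; first exact: fourier_le.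
      exact: (integrable_fin_num _ (test_function_integrable trho).2).
    have F0 : 0 <= F := cmod_ge0 _.
    apply: (@le_trans _ _ (F * (2 * A))); first by rewrite ler_wpM2l.
    rewrite mulrC ler_wpM2l ?mulr_ge0// ler_peMr//.
    exact: (wexp_ge1 ww _ ler01).
exact: Nn.
Qed.

End cutoffs.
End nets.

(** * Regular nets *)

Section regular_nets.
Local Open Scope complex_scope.
Variables (R : realType) (d : nat) (w : R -> R) (Omega : set 'rV[R]_d).
Hypothesis (ww : weight_class w) (Omega_open : open Omega).
Notation mu := (lebesgue_tuple R d).
Notation row := (@row_of_tuple R d).
Implicit Types (K : set 'rV[R]_d) (f psi rho : 'rV[R]_d -> R[i]) (l : R).

Variable g : net R d.
Hypothesis Eg : E_net w Omega g.
Hypothesis g_weak : forall rho, D_space w Omega rho ->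
  negligible_numbers w (fun e => pairing (g e) rho).

Section cut.
Local Open Scope complex_scope.
Variable psi : 'rV[R]_d -> R[i].
Hypothesis Dpsi : D_space w Omega psi.

Let u (e : R) x := psi x * g e x.

Let tu e : 0 < e < 1 -> test_function (u e).
Proof. by move=> e01; exact: (D_test_function ((Eg e01).2 _ Dpsi)). Qed.

Let pairing_mul e (h : 'rV[R]_d -> R[i]) :
  pairing (g e) (fun x => psi x * h x) = cintegral_Rd (fun x => u e x * h x).
Proof. by congr cintegral_Rd; apply/funext => x; rewrite /u; ring. Qed.

Let fourier_small xi l c : 0 < l -> 0 < c ->
  \forall e \near 0^'+, cmod (fourier (u e) xi) <= c * growth w (- l) e.
Proof.
move=> l0 c0; have := g_weak (D_modulation ww xi Dpsi) l0 c0.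
apply: filterS => e; rewrite pairing_mul.
by rewrite abse_EFin lee_fin (ger0_norm (cmod_ge0 _)) (ger0_norm (ltW (growth_gt0 _ _ _))).
Qed.

Let bound e : R := 2 * fine (integral_Rd (fun x => (cmod (u e x))%:E)).

Let bound_ge0 e : 0 <= bound e.
Proof.
by rewrite mulr_ge0// fine_ge0//; apply: integral_ge0 => t _; rewrite lee_fin cmod_ge0.
Qed.

Let fourier_bound e xi : 0 < e < 1 -> cmod (fourier (u e) xi) <= bound e.
Proof.
move=> e01; rewrite -lee_fin /bound EFinM fineK; first exact: (fourier_le _ (tu e01)).
exact: (integrable_fin_num _ (test_function_integrable (tu e01)).2).
Qed.

(** The gliding hump applied to [part], which is either the real or the imaginary
    part. *)
Let part_bounded (part : R[i] -> R) l : 0 < l ->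
  (forall z, `|part z| <= cmod z) ->
  (forall e (a : R^nat) (xi : nat -> 'rV[R]_d), 0 < e < 1 -> (forall n, 0 <= a n) ->
    cvgn (series a) ->
    part (cintegral_Rd (fun x => u e x * charseries a xi x)) =
    limn (series (fun n => a n * part (fourier (u e) (xi n))))) ->
  exists n : nat, \forall e \near 0^'+, forall xi,
    `|part (fourier (u e) xi)| <= n%:R * growth w (- l) e * wexp w n%:R xi.
Proof.
move=> l0 part_le part_lim; apply: contrapT => unbounded.
have [|||||a [xi [a0 ha]]] := @gliding_hump R 'rV[R]_d (fun xi => w (enorm xi))
  (fun e xi => part (fourier (u e) xi)) bound (growth w (- l)) _ _ _ _ _ unbounded.
- exact: weight_enorm_ge0.
- exact: growth_gt0.
- exact: bound_ge0.
- move=> e xi e01; apply: le_trans (part_le _) _; exact: fourier_bound.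
- move=> xi c c0; apply: filterS (fourier_small xi l0 c0) => e.
  exact: le_trans (part_le _).
apply.
have ca : cvgn (series a).
  have := ha 0; under eq_fun do rewrite mul0r expR0 mulr1.
  exact.
have Drho := D_charseries ww Dpsi a0 ha ca.
apply: filterS2 (near_unit R) (g_weak Drho l0 ltr01) => e e01.
rewrite pairing_mul abse_EFin lee_fin (ger0_norm (cmod_ge0 _)) mul1r.
rewrite (ger0_norm (ltW (growth_gt0 _ _ _))); apply: le_trans.
by rewrite -part_lim.
Qed.

Lemma fourier_cutoff_bounded l : 0 < l ->
  exists n : nat, \forall e \near 0^'+, forall xi,
    cmod (fourier (u e) xi) <= n%:R * growth w (- l) e * wexp w n%:R xi.
Proof.
move=> l0.
have [n1 h1] := part_bounded l0 (@normr_Re_le R)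
  (fun e a xi e01 a0 ca => (pairing_charseries xi a0 ca (tu e01)).1).
have [n2 h2] := part_bounded l0 (@normr_Im_le R)
  (fun e a xi e01 a0 ca => (pairing_charseries xi a0 ca (tu e01)).2).
exists (n1 + n2)%N; apply: filterS2 h1 h2 => e h1 h2 xi.
apply: le_trans (cmod_le _) _.
have G0 := ltW (growth_gt0 w (- l) e).
have mono (n : nat) : (n <= n1 + n2)%N ->
    n%:R * growth w (- l) e * wexp w n%:R xi <=
    n%:R * growth w (- l) e * wexp w (n1 + n2)%:R xi.
  move=> nn; rewrite ler_wpM2l ?mulr_ge0// ler_expR.
  by rewrite ler_wpM2r ?weight_enorm_ge0// ler_nat.
rewrite natrD !mulrDl -natrD; apply: lerD.
  exact: le_trans (h1 xi) (mono _ (leq_addr _ _)).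
exact: le_trans (h2 xi) (mono _ (leq_addl _ _)).
Qed.

(** The regularity hypothesis [reg] has the same [kappa] for all orders [H].  This
    allows [H] to be chosen after the exponent [n] of [fourier_cutoff_bounded],
    which depends on [l], whereas [l] is chosen in terms of [kappa]. *)
Lemma cutoff_negligible (kappa h k : R) : 0 < h -> 0 < k -> 0 < kappa ->
  (forall H, 0 < H -> exists a : R, 0 < a /\ \forall e \near 0^'+,
     (wnorm w H (u e) <= (a * growth w kappa e)%:E)%E) ->
  ereal_littleo (fun e => wnorm w h (u e)) (growth w (- k)).
Proof.
move=> h0 k0 kappa0 reg.
have [a [I [a0 I0 aI]]] := wexp_integrable d ww.
(* The square root in the interpolation halves l; the 1 leaves room for o(). *)
pose l := 2 * (kappa + k + 1).
have l0 : 0 < l by rewrite mulr_gt0// !addr_gt0.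
have [n hn] := fourier_cutoff_bounded l0.
pose H := 2 * h + n%:R + a.
have H0 : 0 < H.
  by rewrite /H -addrA ltr_pwDl ?mulr_gt0// addr_ge0.
have [b [b0 hb]] := reg H H0.
apply/littleo_growthE => [e|c c0]; first exact: wnorm_ge0.
pose C := Num.sqrt n%:R * (b + I) + 1.
have C0 : 0 < C by rewrite ltr_wpDl// mulr_ge0 ?sqrtr_ge0// addr_ge0// ltW.
have small := growth_small ww ltr01 (divr_gt0 c0 C0).
apply: filterS2 (filterI (near_unit R) hn) (filterI hb small) => e [e01 ue] [He sm].
have G0 := growth_gt0 w (- l) e.
have A0 : 0 <= n%:R * growth w (- l) e by rewrite mulr_ge0// ltW.
have := wnorm_interpolation ww (tu e01) A0 (ler0n _ _) (ltW h0) a0 I0 ue aI.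
move=> interp; apply: le_trans interp _.
have Gk : 1 <= growth w kappa e.
  rewrite -expR0 ler_expR mulr_ge0 ?(ltW kappa0)// (weight_ge0 ww)// invr_ge0.
  by case/andP : e01 => /ltW.
apply: (@le_trans _ _ ((Num.sqrt (n%:R * growth w (- l) e))%:E *
    ((b + I) * growth w kappa e)%:E)%E).
  apply: lee_wpmul2l; first by rewrite lee_fin sqrtr_ge0.
  rewrite (mulrDl b) EFinD; apply: leeD; first exact: He.
  by rewrite lee_fin ler_peMr.
rewrite -EFinM lee_fin sqrtrM//.
have -> : Num.sqrt (growth w (- l) e) = growth w (- (kappa + k + 1)) e.
  rewrite (_ : growth w (- l) e = growth w (- (kappa + k + 1)) e ^+ 2).
    by rewrite sqrtr_sqr ger0_norm// ltW// growth_gt0.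
  by rewrite /growth -expRM_natl; congr expR; rewrite /l; ring.
have -> : growth w (- (kappa + k + 1)) e =
    growth w (- kappa) e * growth w (- k) e * growth w (- 1) e.
  by rewrite /growth -!expRD; congr expR; ring.
have kk : growth w (- kappa) e * growth w kappa e = 1.
  by rewrite /growth -expRD mulNr addNr expR0.
rewrite [leLHS](_ : _ = Num.sqrt n%:R * (b + I) * growth w (- 1) e * growth w (- k) e *
   (growth w (- kappa) e * growth w kappa e)); last by ring.
rewrite kk mulr1 ler_wpM2r ?(ltW (growth_gt0 _ _ _))//.
apply: (@le_trans _ _ (C * growth w (- 1) e)).
  by rewrite ler_wpM2r ?(ltW (growth_gt0 _ _ _))// lerDl.
by rewrite mulrC -ler_pdivlMr.
Qed.

End cut.

Theorem regular_weakly_negligible :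
  (forall K, compact K -> K `<=` Omega ->
    exists2 psi, D_space w Omega psi & forall x, K x -> psi x = 1) ->
  regular_net w Omega g -> negligible_net w Omega g.
Proof.
move=> cutoff reg; split; first exact: Eg.
move=> K cK sK h h0 k k0.
have [psi Dpsi psi1] := cutoff K cK sK.
have [_ kpsi spsi _] := Dpsi.
have [kappa kappa0 hk] := reg _ kpsi spsi.
apply: (@littleo_bound _ w _ (fun e => wnorm w h (fun x => psi x * g e x)) _ 1 ltr01).
- by move=> e; exact: wnorm_on_ge0.
- by move=> e; exact: wnorm_ge0.
- by apply: nearW => e; rewrite mul1e; exact: wnorm_on_le.
apply: (cutoff_negligible Dpsi h0 k0 kappa0) => H H0.
have [a a0 ha] := wnorm_cutoff_le ww Dpsi H0.
exists a; split; first exact: a0.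
have /littleo_growthE hH := hk H H0.
have {}hH := hH (fun e => wnorm_on_ge0 _ _ _ _ _) 1 ltr01.
apply: filterS2 (near_unit R) hH => e e01 He.
apply: le_trans (ha _ (Eg e01)) _.
by rewrite EFinM; apply: lee_wpmul2l; [rewrite lee_fin ltW|rewrite mul1r in He].
Qed.

End regular_nets.

Lemma negligible_numbersD (R : realType) (w : R -> R) (z1 z2 z3 : R -> R[i]) :
  negligible_numbers w z1 -> negligible_numbers w z2 ->
  (\forall e \near (0 : R)^'+, z3 e = z1 e + z2 e) -> negligible_numbers w z3.
Proof.
move=> N1 N2 zE l l0 c c0; have c2 : 0 < c / 2 by rewrite divr_gt0.
apply: filterS3 zE (N1 l l0 _ c2) (N2 l l0 _ c2) => e -> .
rewrite !abse_EFin !lee_fin !(ger0_norm (cmod_ge0 _)) => h1 h2.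
by rewrite (le_trans (le_cmodD _ _))// [c]splitr mulrDl lerD.
Qed.

Lemma pairingD (R : realType) (d : nat) (w : R -> R) (Omega : set 'rV[R]_d)
    (f g rho : 'rV[R]_d -> R[i]) : weight_class w -> D_space w Omega rho ->
  E_space w Omega f -> E_space w Omega g ->
  pairing f rho = pairing g rho + pairing (fun x => f x - g x) rho.
Proof.
move=> ww Drho [_ Df] [_ Dg].
have swap (h : 'rV[R]_d -> R[i]) : pairing h rho = cintegral_Rd (fun x => rho x * h x).
  by congr cintegral_Rd; apply/funext => x; rewrite mulrC.
have fi := test_function_integrable (D_test_function (Df _ Drho)).
have gi := test_function_integrable (D_test_function (Dg _ Drho)).
rewrite !swap !cintegral_RdE.
rewrite [X in _ + X](_ : _ = cint (lebesgue_tuple R d) ((fun x => rho x * f x) \o @row_of_tuple R d) -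
    cint (lebesgue_tuple R d) ((fun x => rho x * g x) \o @row_of_tuple R d)).
  by rewrite addrC subrK.
rewrite -(cintN gi) -(cintD fi (cintegrableN gi)).
by congr cint; apply/funext => t /=; rewrite mulrBr.
Qed.

Unset Implicit Arguments.

Theorem theorem8p4 (R : realType) (d : nat) (d_gt0 : (0 < d)%N)
    (Omega : set 'rV[R]_d) (Omega_open : open Omega)
    (w : R -> R) (w_weight : weight_class w)
    (g : net R d) (g_moderate : moderate w Omega g)
    (g_regular : G_regular w Omega (gclass w Omega g))
    (g_weakly_negligible : forall rho : 'rV[R]_d -> R[i],
      D_space w Omega rho ->
      negligible_numbers w (fun e => pairing (g e) rho)) :
  gclass w Omega g = G_zero w Omega.
Proof.
have cutoff K := moderate_cutoff g_moderate (K := K).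
have [_ [g0 [mod0 negl0] reg0]] := g_regular.
have [E0 _] := mod0; have [Eg _] := g_moderate.
have weak0 rho : D_space w Omega rho ->
    negligible_numbers w (fun e => pairing (g0 e) rho).
  move=> Drho.
  apply: negligible_numbersD (g_weakly_negligible _ Drho)
    (negligible_pairing w_weight negl0 Drho) _.
  apply: filterS (near_unit R) => e e01.
  exact: (pairingD w_weight Drho (E0 e e01) (Eg e e01)).
have N0 := regular_weakly_negligible w_weight E0 weak0 cutoff reg0.
have Ng : negligible_net w Omega g.
  apply: (negligible_lincomb w_weight cutoff (z := -1) N0 negl0 Eg) => e x.
  by ring.
apply/seteqP; split => g' [mod' negl']; split; [exact: mod'| |exact: mod'|].
  apply: (negligible_lincomb w_weight cutoff (z := 1) negl' Ng) => [e e01|e x]; last by ring.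
  rewrite (_ : (fun x => _) = g' e); first exact: mod'.1.
  by apply/funext => x; rewrite subr0.
apply: (negligible_lincomb w_weight cutoff (z := -1) negl' Ng) => [e e01|e x]; last by ring.
exact: (E_spaceB w_weight Omega_open (mod'.1 e e01) (Eg e e01)).
Qed.
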